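(* Let $X$ be a reflexive Banach space with $1$-symmetric basis and let $K=(B_{(V_X^0)^{*}},w^{*})$. For a function $f\in V_X\setminus V_X^0$, one has $f\in C[0,1]$ if and only if $f$, regarded as a function on $K$, is a difference of bounded semicontinuous functions on $K$.
   Context: $X$ is a (infinite-dimensional, real) reflexive Banach space with a $1$-symmetric basis $(e_n)_n$, i.e. $\|\sum_n \epsilon_n a_n e_{\pi(n)}\|_X=\|\sum_n a_n e_n\|_X$ for all finitely supported real $(a_n)$, signs $\epsilon_n$ and permutations $\pi$ of $\mathbb{N}$. For $f:[0,1]\to\mathbb{R}$ and a partition $\mathcal{P}=\{0=t_0<\dots<t_n=1\}$ put $\alpha_X(f,\mathcal{P})=\|\sum_{i=0}^{n-1}(f(t_{i+1})-f(t_i))e_i\|_X$ (with $e_0,\dots,e_{n-1}$ any $n$ distinct basis vectors) and $\delta(\mathcal{P})=\max_i(t_{i+1}-t_i)$. Let $\|f\|_{V_X}=\sup_{\mathcal{P}}\alpha_X(f,\mathcal{P})$, $V_X=\{f:[0,1]\to\mathbb{R}: f(0)=0,\ \|f\|_{V_X}<\infty\}$ and $V_X^0=\{f\in V_X:\lim_{\varepsilon\to0}\sup\{\alpha_X(f,\mathcal{P}):\delta(\mathcal{P})\le\varepsilon\}=0\}$, Banach spaces with norm $\|\cdot\|_{V_X}$; $V_X^0\subset C[0,1]$. $B_{(V_X^0)^*}$ is the closed unit ball of the dual of $V_X^0$, and $K$ is this ball with the weak$^*$ topology, a compact metrizable space. The bidual $(V_X^0)^{**}$ is identified isometrically with $V_X$: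 $F\in(V_X^0)^{**}$ corresponds to the function $t\mapsto F(\delta_t)$, where $\delta_t\in(V_X^0)^*$ is evaluation at $t\in[0,1]$. Via this identification each $f\in V_X$ is a bounded function on $K$, $x^*\mapsto\langle f,x^*\rangle$. *)

(* Defs.v *)
From HB Require Import structures.
From mathcomp Require Import all_boot all_order all_algebra.
From mathcomp Require Import all_classical all_reals all_analysis.

Set Implicit Arguments.
Unset Strict Implicit.
Unset Printing Implicit Defensive.

Import Order.TTheory GRing.Theory Num.Theory.
Import numFieldNormedType.Exports.

Local Open Scope classical_set_scope.
Local Open Scope ring_scope.

Section Dual.
Context {R : realType} (V : normedModType R).

Definition dual_pred : {pred V -> R^o} :=
  fun phi => `[< linear phi /\ continuous phi >].

Record dual := Dual { dual_fun :> V -> R^o; dual_funP : dual_fun \in dual_pred }.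

HB.instance Definition _ := [isSub for dual_fun].
HB.instance Definition _ := [Choice of dual by <:].

Lemma dual_pred_submod : submod_closed dual_pred.
Proof.
split=> [|a phi psi /asboolP[lp cp] /asboolP[lq cq]]; apply/asboolP.
  split; first by move=> k x y; rewrite /= scaler0 addr0.
  exact: cst_continuous.
split.
  move=> k x y; rewrite !fctE lp lq /= -[LHS]/(a * _ + _).
  rewrite -[RHS]/(k * (a * _ + _) + (a * _ + _)) -![k *: _]/(k * _).
  by rewrite !mulrDr mulrCA addrACA.
move=> x; apply: cvgD; last exact: cq.
by apply: cvgZl_tmp; exact: cp.
Qed.

HB.instance Definition _ :=
  GRing.isSubmodClosed.Build R _ dual_pred dual_pred_submod.
HB.instance Definition _ := [SubChoice_isSubLmodule of dual by <:].

Definition dual_norm (phi : dual) : R :=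
  sup [set `|phi x| | x in [set x : V | `|x| <= 1]].

Lemma dual_linear (phi : dual) : linear phi.
Proof. by have /asboolP[] := dual_funP phi. Qed.

Lemma dual_continuous (phi : dual) : continuous phi.
Proof. by have /asboolP[] := dual_funP phi. Qed.

Lemma dualZ (phi : dual) k x : phi (k *: x) = k * phi x.
Proof.
have h0 : phi 0 = 0.
  by have := dual_linear phi 1 0 0; rewrite !scale1r addr0 => /eqP;
     rewrite -subr_eq subrr eq_sym => /eqP.
by have := dual_linear phi k x 0; rewrite addr0 h0 addr0.
Qed.

Lemma dual_norm_has_sup (phi : dual) :
  has_sup [set `|phi x| | x in [set x : V | `|x| <= 1]].
Proof.
pose f : {linear V -> R^o} :=
  HB.pack (phi : V -> R^o) (GRing.isLinear.Build _ _ _ _ _ (dual_linear phi)).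
split; first by exists `|phi 0|, 0 => //=; rewrite normr0.
have /bounded_funP/(_ 1)[M hM] : bounded_near f (nbhs (0 : V)).
  by apply/linear_bounded_continuous; exact: dual_continuous.
by exists M => _ [x /= x1 <-]; exact: hM.
Qed.

Lemma dual_norm_le (phi : dual) x : `|x| <= 1 -> `|phi x| <= dual_norm phi.
Proof.
by move=> x1; apply: ub_le_sup; [exact: (dual_norm_has_sup phi).2|exists x].
Qed.

Lemma dual_norm_ge (phi : dual) M :
  (forall x, `|x| <= 1 -> `|phi x| <= M) -> dual_norm phi <= M.
Proof.
move=> h; apply: ge_sup; first exact: (dual_norm_has_sup phi).1.
by move=> _ [x /= x1 <-]; exact: h.
Qed.

Lemma dual_normD phi psi :
  dual_norm (phi + psi) <= dual_norm phi + dual_norm psi.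
Proof.
apply: dual_norm_ge => x x1; apply: (le_trans (ler_normD _ _)).
by apply: lerD; exact: dual_norm_le.
Qed.

Lemma dual_normZ_le k phi : dual_norm (k *: phi) <= `|k| * dual_norm phi.
Proof.
apply: dual_norm_ge => x x1; rewrite -[X in `|X|]/(k * phi x) normrM.
by apply: ler_wpM2l => //; exact: dual_norm_le.
Qed.

Lemma dual_normZ k phi : dual_norm (k *: phi) = `|k| * dual_norm phi.
Proof.
apply/eqP; rewrite eq_le dual_normZ_le /=.
have [->|k0] := eqVneq k 0.
  rewrite normr0 mul0r; apply: le_trans (dual_norm_le (0 *: phi) (x := 0) _) => //.
  by rewrite normr0.
rewrite -ler_pdivlMl ?normr_gt0// -normfV -[X in dual_norm X <= _](scalerK k0).
exact: dual_normZ_le.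
Qed.

Lemma dual_norm_eq0 phi : dual_norm phi = 0 -> phi = 0.
Proof.
move=> h; apply: val_inj; apply/funext => x /=.
have [->|x0] := eqVneq x 0; first by rewrite -(scale0r 0) dualZ mul0r.
have := dual_norm_le phi (x := `|x|^-1 *: x).
rewrite normrZ normfV normr_id mulVf ?normr_eq0// lexx h => /(_ isT).
rewrite normr_le0 dualZ mulf_eq0 invr_eq0 normr_eq0 (negbTE x0) /=.
by move/eqP.
Qed.

HB.instance Definition _ := @Lmodule_isNormed.Build R dual
  dual_norm dual_normD dual_normZ dual_norm_eq0.

End Dual.

Section WeakStar.
Context {R : realType}.

(* Surjectivity of the canonical embedding into the bidual. *)
Definition reflexive_space (V : normedModType R) :=
  forall F : dual (dual V), exists x : V, forall phi : dual V, F phi = phi x.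

(* The dual as a set, with the topology of pointwise convergence on V. *)
Definition weak_star (V : normedModType R) : Type :=
  initial_topology (fun phi : dual V => (phi : {ptws V -> R^o})).

HB.instance Definition _ (V : normedModType R) := Topological.on (weak_star V).

Definition dual_ball (V : normedModType R) : set (weak_star V) :=
  [set phi : dual V | `|phi| <= 1].

(* Taking both functions lower semicontinuous is no restriction: negation
   exchanges upper and lower semicontinuity, and if u is lower and v upper
   semicontinuous then u - v is itself lower semicontinuous and bounded. *)
Definition diff_bounded_semicontinuous {T : topologicalType} (g : T -> R) :=
  exists u v : T -> R,
    [/\ bounded_fun u, bounded_fun v,
        lower_semicontinuous (EFin \o u), lower_semicontinuous (EFin \o v)
      & g = u \- v].

End WeakStar.

Arguments dual_ball {R} V _.

Section SymmetricBasis.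
Context {R : realType} {X : normedModType R}.

Definition schauder_basis (e : nat -> X) :=
  forall x : X, exists! a : nat -> R, series (fun n => a n *: e n) @ \oo --> x.

Definition symmetric_basis (e : nat -> X) :=
  schauder_basis e /\
  forall (n : nat) (a : nat -> R) (eps : nat -> bool) (pi : nat -> nat),
    bijective pi ->
    `|\sum_(i < n) ((-1) ^+ eps i * a i) *: e (pi i)| =
    `|\sum_(i < n) a i *: e i|.

End SymmetricBasis.

Notation I01 R := (set_type (`[0, 1]%classic : set R)).

Section Variation.
Context {R : realType} {X : normedModType R} (e : nat -> X).

Lemma zero01_subproof : (0 : R) \in (`[0, 1]%classic : set R).
Proof. by rewrite inE /= in_itv /= lexx ler01. Qed.
Definition zero01 : I01 R := exist _ 0 zero01_subproof.

(* [s] lists t_1, ..., t_n, and t_0 = 0 is implicit, as in [itv_partition]. *)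
Definition partition01 (s : seq (I01 R)) :=
  itv_partition (0 : R) 1 [seq \val t | t <- s].

Definition mesh (s : seq (I01 R)) : R :=
  \big[Num.max/0]_(i < size s)
    (\val (nth zero01 (zero01 :: s) i.+1) - \val (nth zero01 (zero01 :: s) i)).

(* [alpha] uses the first n basis vectors; for a 1-symmetric basis any n
   distinct ones give the same value. *)
Definition alpha (f : I01 R -> R) (s : seq (I01 R)) : R :=
  `|\sum_(i < size s) (f (nth zero01 (zero01 :: s) i.+1)
                       - f (nth zero01 (zero01 :: s) i)) *: e i|.

Definition VX_norm (f : I01 R -> R) : \bar R :=
  ereal_sup [set (alpha f s)%:E | s in partition01].

Definition VX : set (I01 R -> R) :=
  [set f | f zero01 = 0 /\ (VX_norm f < +oo)%E].

Definition VX0 : set (I01 R -> R) :=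
  [set f | VX f /\
    ereal_sup [set (alpha f s)%:E | s in [set s | partition01 s /\ mesh s <= eps]]
      @[eps --> 0^'+] --> 0%E].

Lemma one01_subproof : (1 : R) \in (`[0, 1]%classic : set R).
Proof. by rewrite inE /= in_itv /= lexx ler01. Qed.
Let one01 : I01 R := exist _ 1 one01_subproof.

Lemma alpha_ge0 f s : 0 <= alpha f s.
Proof. exact: normr_ge0. Qed.

Lemma alphaD f g s : alpha (f + g) s <= alpha f s + alpha g s.
Proof.
apply: le_trans (ler_normD _ _); rewrite -big_split /= /alpha.
rewrite le_eqVlt; apply/orP; left; apply/eqP; congr (`|_|).
by apply: eq_bigr => i _; rewrite -scalerDl !fctE opprD addrACA.
Qed.

Lemma alphaZ k f s : alpha (k *: (f : I01 R -> R^o)) s = `|k| * alpha f s.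
Proof.
rewrite /alpha -normrZ scaler_sumr; congr (`|_|); apply: eq_bigr => i _.
by rewrite scalerA mulrBr.
Qed.

Lemma partition01_ex : exists s, partition01 s.
Proof.
exists [:: one01]; rewrite /partition01 /=.
exact: itv_partition1.
Qed.

Lemma partition01_fine (eps : R) : 0 < eps ->
  exists2 s, partition01 s & mesh s <= eps.
Proof.
move=> e0; pose n := (Num.truncn eps^-1).+1.
have n0 : 0 < n%:R :> R by rewrite ltr0n.
have ne : n%:R^-1 <= eps.
  rewrite -[leRHS]invrK lef_pV2 ?posrE ?invr_gt0//.
  by apply/ltW; exact: truncnS_gt.
pose pt (i : nat) : I01 R := insubd one01 (i%:R / n%:R : R).
have ptE i : (i <= n)%N -> \val (pt i) = i%:R / n%:R.
  move=> le_in; have h : (i%:R / n%:R : R) \in (`[0, 1]%classic : set R).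
    rewrite inE /= in_itv /= divr_ge0 ?ler0n//=.
    by rewrite ler_pdivrMr// mul1r ler_nat.
  by rewrite val_insubd h.
have pt0 : pt 0%N = zero01 by apply: val_inj; rewrite ptE//= mul0r.
pose g (i : nat) : R := i%:R / n%:R.
have g0 : g 0%N = 0 by rewrite /g mul0r.
have valE : [seq \val t | t <- [seq pt i | i <- iota 1 n]] = map g (iota 1 n).
  rewrite -map_comp; apply/eq_in_map => i; rewrite mem_iota add1n ltnS.
  by move=> /andP[_ ?]; rewrite /= ptE.
exists [seq pt i | i <- iota 1 n].
  rewrite /partition01 valE -g0; split.
    rewrite path_map; apply: (@sub_path _ ltn); last exact: (iota_ltn_sorted 0 n.+1).
    by move=> i j /= ij; rewrite ltr_pM2r ?invr_gt0// ltr_nat.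
  rewrite last_map.
  have -> : last 0%N (iota 1 n) = n.
    by rewrite (last_nth 0%N) size_iota -[0%N :: iota 1 n]/(iota 0 n.+1) nth_iota.
  by rewrite /g divff// gt_eqF.
rewrite /mesh -pt0 -[pt 0 :: _]/(map pt (iota 0 n.+1)) size_map size_iota.
apply: bigmax_le => [|i _]; first exact: ltW.
have lt_in := ltn_ord i.
rewrite !(nth_map 0%N) ?size_iota// ?ltnS ?(ltnW lt_in)//.
rewrite !nth_iota ?ltnS ?(ltnW lt_in)// !add0n !ptE ?(ltnW lt_in)//.
by rewrite -mulrBl -natrB// subSnn mul1r.
Qed.

Lemma VX_alpha_le f s : VX f -> partition01 s -> alpha f s <= fine (VX_norm f).
Proof.
move=> [_ foo] ps; have h : ((alpha f s)%:E <= VX_norm f)%E.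
  by apply: ereal_sup_ubound; exists s.
rewrite -lee_fin fineK//; apply/fin_real; rewrite foo andbT.
by apply: lt_le_trans h; exact: ltNyr.
Qed.

Lemma VX_norm_ge f M : (forall s, partition01 s -> alpha f s <= M) ->
  (VX_norm f <= M%:E)%E.
Proof.
by move=> h; apply: ge_ereal_sup => _ [s ps <-]; rewrite lee_fin; exact: h.
Qed.

Lemma VX_fine_norm_ge f M : (forall s, partition01 s -> alpha f s <= M) ->
  fine (VX_norm f) <= M.
Proof.
move=> h; rewrite -lee_fin fineK ?VX_norm_ge//.
apply/fin_real; rewrite (le_lt_trans (VX_norm_ge h)) ?ltry// andbT.
have [s ps] := partition01_ex.
apply: (@lt_le_trans _ _ (alpha f s)%:E); first exact: ltNyr.
by apply: ereal_sup_ubound; exists s.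
Qed.

Lemma VXP f : VX f <-> f zero01 = 0 /\
  exists M, forall s, partition01 s -> alpha f s <= M.
Proof.
split=> [fV|[f0 [M h]]].
  by split; [exact: fV.1|exists (fine (VX_norm f)) => s; exact: VX_alpha_le].
by split=> //; rewrite (le_lt_trans (VX_norm_ge h)) ?ltry.
Qed.

Lemma VX0P f : VX0 f <-> VX f /\ forall eps : R, 0 < eps ->
  exists2 eta : R, 0 < eta &
    forall s, partition01 s -> mesh s <= eta -> alpha f s <= eps.
Proof.
split=> -[fV h]; split=> //.
  move=> eps eps0.
  have /h : nbhs (0%E : \bar R) [set x | (x < eps%:E)%E].
    by apply: open_nbhs_nbhs; split; [exact: open_ereal_lt_ereal|rewrite /= lte_fin].
  move=> [d /= d0 /(_ (d / 2))] /=; rewrite sub0r normrN gtr0_norm ?divr_gt0//.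
  rewrite ltr_pdivrMr// ltr_pMr// ltr1n => /(_ isT isT) hd.
  exists (d / 2); first by rewrite divr_gt0.
  move=> s ps ms; apply/ltW; rewrite -lte_fin; apply: le_lt_trans hd.
  by apply: ereal_sup_ubound; exists s.
have bd (eps : R) : 0 < eps -> \forall x \near 0^'+,
   (0 <= ereal_sup [set (alpha f s)%:E | s in
      [set s | partition01 s /\ (mesh s <= x)%R]] <= eps%:E)%E.
  move=> /h[d d0 hd]; near=> x.
  have x0 : 0 < x by [].
  have xd : x <= d by near: x; exact: nbhs_right_le.
  apply/andP; split.
    have [s ps ms] := partition01_fine x0.
    apply: (@le_trans _ _ (alpha f s)%:E); first by rewrite lee_fin alpha_ge0.
    by apply: ereal_sup_ubound; exists s.
  apply: ge_ereal_sup => _ [s [ps ms] <-]; rewrite lee_fin; apply: hd => //.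
  exact: (le_trans ms).
apply/fine_cvgP; split.
  have := bd 1 ltr01; apply: filterS => x /andP[h0 h1].
  by apply: fin_real; rewrite (lt_le_trans (ltNyr 0))//= (le_lt_trans h1)// ltry.
apply/cvgrPdist_le => eps eps0; have := bd _ eps0; apply: filterS.
move=> x /andP[h0 h1] /=; rewrite sub0r normrN ger0_norm ?fine_ge0//.
rewrite -lee_fin fineK//.
by apply: fin_real; rewrite (lt_le_trans (ltNyr 0))//= (le_lt_trans h1)// ltry.
Unshelve. all: by end_near. Qed.

End Variation.

Section VX0Space.
Context {R : realType} {X : normedModType R} {e : nat -> X}.

Definition VX0_pred : {pred I01 R -> R^o} := fun f => `[< VX0 e f >].

Lemma VX0_pred_submod : submod_closed VX0_pred.
Proof.
have a0 s : alpha e (0 : I01 R -> R^o) s = 0.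
  by rewrite -(scale0r 0) alphaZ normr0 mul0r.
split=> [|a f g /asboolP/VX0P[/VXP[f0 [M hM]] hf]].
  apply/asboolP/VX0P; split.
    by apply/VXP; split=> //; exists 0 => s _; rewrite a0.
  by move=> eps e0; exists 1 => // s _ _; rewrite a0 ltW.
move=> /asboolP/VX0P[/VXP[g0 [N hN]] hg]; apply/asboolP/VX0P; split.
  apply/VXP; split; first by rewrite !fctE f0 g0 scaler0 addr0.
  exists (`|a| * M + N) => s ps; apply: le_trans (alphaD _ _ _ _) _.
  by rewrite alphaZ lerD ?hN// ler_wpM2l// hM.
move=> eps e0; have a1 : 0 < `|a| + 1 by rewrite ltr_wpDl.
have [d d0 hd] := hf (eps / 2 / (`|a| + 1)) ltac:(by rewrite !divr_gt0).
have [d' d'0 hd'] := hg (eps / 2) ltac:(by rewrite divr_gt0).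
exists (Num.min d d'); first by rewrite lt_min d0.
move=> s ps; rewrite le_min => /andP[ms ms']; apply: le_trans (alphaD _ _ _ _) _.
rewrite [leRHS](splitr eps) alphaZ lerD ?hd'//.
apply: le_trans (ler_wpM2l (normr_ge0 a) (hd _ ps ms)) _.
rewrite mulrCA ger_pMr ?divr_gt0// ler_pdivrMr// mul1r.
by rewrite lerDl ler01.
Qed.

(* The proof that [e] is a 1-symmetric basis is a parameter because the
   variation norm separates points only under such an assumption. *)
Record VX0_space (he : symmetric_basis e) :=
  VX0Space { VX0_fun :> I01 R -> R^o; VX0_funP : VX0_fun \in VX0_pred }.

Variable he : symmetric_basis e.
Local Notation V := (VX0_space he).

HB.instance Definition _ := [isSub for @VX0_fun he].
HB.instance Definition _ := [Choice of V by <:].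
HB.instance Definition _ :=
  GRing.isSubmodClosed.Build R _ VX0_pred VX0_pred_submod.
HB.instance Definition _ := [SubChoice_isSubLmodule of V by <:].

Lemma VX0_funVX (f : V) : VX e f.
Proof. by have /asboolP/VX0P[] := VX0_funP f. Qed.

Lemma basis0_gt0 : 0 < `|e 0%N|.
Proof.
rewrite normr_gt0; apply/eqP => e00; have [a [_ ua]] := he.1 0.
have h (b : nat -> R) : (forall n, b n.+1 = 0) ->
    series (fun n => b n *: e n) @ \oo --> (0 : X).
  move=> b0; rewrite (_ : series _ = cst 0); first exact: cvg_cst.
  apply/funext => n; rewrite /series /= big1// => -[_|i _].
    by rewrite e00 scaler0.
  by rewrite b0 scale0r.
have e1 := ua (fun=> 0) (h _ (fun=> erefl)).
have e2 := ua (fun n => (n == 0%N)%:R) (h _ (fun=> erefl)).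
have := congr1 (fun b : nat -> R => b 0%N) (etrans (esym e1) e2) => /= /eqP.
by rewrite eq_sym oner_eq0.
Qed.

Lemma VX_eval_le (f : I01 R -> R) (t : I01 R) : VX e f ->
  `|f t| * `|e 0%N| <= fine (VX_norm e f).
Proof.
move=> fV; have f0 : f (@zero01 R) = 0 by case: fV.
have : \val t \in (`[0, 1]%classic : set R) by exact: valP.
rewrite inE /= in_itv /= => /andP[t0 t1].
rewrite -normrZ; have [t00|t0'] := eqVneq (\val t) 0.
  have -> : t = zero01 by apply: val_inj.
  rewrite f0 scale0r normr0; have [s ps] := @partition01_ex R.
  exact: le_trans (alpha_ge0 _ _ _) (VX_alpha_le fV ps).
have tgt0 : 0 < \val t by rewrite lt_def t0' t0.
have [t11|t1'] := eqVneq (\val t) 1.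
  have ps : partition01 [:: t] by rewrite /partition01 /= t11; exact: itv_partition1.
  apply: le_trans (VX_alpha_le fV ps).
  by rewrite /alpha /= big_ord_recl big_ord0 /= f0 subr0 addr0.
have tlt1 : \val t < 1 by rewrite lt_neqAle t1' t1.
pose u : I01 R := exist _ 1 (@one01_subproof R).
have ps : partition01 [:: t; u] by rewrite /partition01 /itv_partition /= tgt0 tlt1 /=.
apply: le_trans (VX_alpha_le fV ps).
rewrite /alpha /= 2!big_ord_recl big_ord0 /= f0 subr0 addr0.
set a := f t; set b := f u - a.
have := he.2 2%N (fun i => if i == 0%N then a else b) (fun i => i == 1%N) id.
rewrite !big_ord_recl !big_ord0 /= !addr0 expr0 expr1 mul1r mulN1r scaleNr.
move=> /(_ (inv_bij (fun=> erefl))) hs.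
have -> : `|a *: e 0%N| = 2^-1 * `|(a *: e 0%N) *+ 2|.
  by rewrite normrMn -[X in _ = _ * X]mulr_natl mulrA mulVf ?mul1r ?pnatr_eq0.
have -> : (a *: e 0%N) *+ 2 = (a *: e 0%N + b *: e 1%N) + (a *: e 0%N - b *: e 1%N).
  by rewrite addrACA subrr addr0 mulr2n.
rewrite ler_pdivrMl// mulr_natl mulr2n (le_trans (ler_normD _ _))// lerD2l.
by rewrite hs.
Qed.

Definition VX0_norm (f : V) : R := fine (VX_norm e f).

Lemma VX0_normD (f g : V) : VX0_norm (f + g) <= VX0_norm f + VX0_norm g.
Proof.
apply: VX_fine_norm_ge => s ps; apply: le_trans (alphaD _ _ _ _) _.
by apply: lerD; apply: VX_alpha_le => //; exact: VX0_funVX.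
Qed.

Lemma VX0_normZ_le k (f : V) : VX0_norm (k *: f) <= `|k| * VX0_norm f.
Proof.
apply: VX_fine_norm_ge => s ps; rewrite alphaZ ler_wpM2l//.
by apply: VX_alpha_le => //; exact: VX0_funVX.
Qed.

Lemma VX0_normZ k (f : V) : VX0_norm (k *: f) = `|k| * VX0_norm f.
Proof.
apply/eqP; rewrite eq_le VX0_normZ_le /=.
have [->|k0] := eqVneq k 0.
  rewrite normr0 mul0r; have [s ps] := @partition01_ex R.
  exact: le_trans (alpha_ge0 _ _ _) (VX_alpha_le (VX0_funVX _) ps).
rewrite -ler_pdivlMl ?normr_gt0// -normfV -[X in VX0_norm X <= _](scalerK k0).
exact: VX0_normZ_le.
Qed.

Lemma VX0_norm_eq0 (f : V) : VX0_norm f = 0 -> f = 0.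
Proof.
move=> h; apply: val_inj; apply/funext => t /=.
have := VX_eval_le t (VX0_funVX f); rewrite -/(VX0_norm f) h.
by rewrite pmulr_lle0 ?basis0_gt0// normr_le0 => /eqP.
Qed.

HB.instance Definition _ := @Lmodule_isNormed.Build R V
  VX0_norm VX0_normD VX0_normZ VX0_norm_eq0.

Lemma delta_subproof (t : I01 R) : (fun f : V => f t : R^o) \in @dual_pred R V.
Proof.
apply/asboolP; have lin : linear (fun f : V => f t : R^o) by [].
split=> //.
pose d : {linear V -> R^o} :=
  HB.pack (fun f : V => f t : R^o) (GRing.isLinear.Build _ _ _ _ _ lin).
apply/(linear_bounded_continuous d)/bounded_funP => r.
exists (r / `|e 0%N|) => f fr; rewrite ler_pdivlMr ?basis0_gt0//.
by apply: le_trans fr; exact: VX_eval_le (VX0_funVX f).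
Qed.

Definition delta (t : I01 R) : dual V := Dual (delta_subproof t).

(* The bidual is identified with V_X through F |-> (t |-> F (delta t)), a
   bijection onto [VX e] when X is reflexive; this is its inverse.  The default
   value of [get] is thus never used for f in [VX e]. *)
Definition VX_bidual (f : I01 R -> R) : dual (dual V) :=
  get [set F : dual (dual V) | forall t, F (delta t) = f t].

End VX0Space.

(* Main.v *)
(* The identification of the bidual rests on two consequences of reflexivity.
   First, |e_0 + ... + e_{n-1}| tends to infinity and is o(n); hence monotone
   continuous functions lie in V_X^0.  Second, a bounded sequence of V_X^0 that
   tends to 0 pointwise is weakly null, by Simons' argument, since an ultralimit
   of functionals norming V_X^0 through partitions is given by a sequence of
   intervals and an element of X^*.  So a functional is small on the functions
   of the unit ball that vanish on a suitable finite set; subtracting piecewise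
   linear interpolants, an element of the bidual is determined by its values at
   the evaluations delta_t.

   If f = u - v on K with u, v bounded and lower semicontinuous, and f jumps by
   eps at t from one side, put L_N = |e_0 + ... + e_{N-1}|.  The functional
   (L_N / N) sum_(j < N) (-1)^j delta_{z_j} lies in K for monotone z and even N.
   Starting from z_j = t and moving the points off t one after the other, each
   move changes f by at least eps L_N / N and hence, u and v being lower
   semicontinuous, raises u + v by almost as much.  So u + v grows by about
   eps L_N, which is unbounded.

   Conversely, a continuous f in V_X is the pointwise limit of functions G_k in
   V_X^0 that are monotone between the nodes of finer and finer partitions and
   whose increments over an interval are controlled by the oscillation of f
   there.  An interval of length l is long for the early differences
   G_{k+1} - G_k, which are uniformly small, short for the late ones, and in
   between for at most two of them; thus all signed sums of these differences
   are bounded in norm and sum_k |x^*(G_{k+1} - G_k)| is bounded on K.  The sums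
   of the positive and of the negative parts are lower semicontinuous. *)
From HB Require Import structures.
Require Import Defs.
From mathcomp Require Import all_boot all_order all_fingroup all_algebra.
From mathcomp Require Import all_classical all_reals all_analysis.
From mathcomp Require Import ring lra zify.

Set Implicit Arguments.
Unset Strict Implicit.
Unset Printing Implicit Defensive.

Import Order.TTheory GRing.Theory Num.Theory.
Import numFieldNormedType.Exports.

Local Open Scope classical_set_scope.
Local Open Scope ring_scope.

(** * Functionals and ultralimits *)

Section DualFacts.
Context {R : realType} {V : normedModType R}.
Implicit Types (phi : dual V) (x : V).

(** The two directions use the bidual differently. From semicontinuity to continuity only the values
    of f at the evaluations enter, so the existence of an element of the bidual with these values is
    enough. The converse has to know f at every functional, and uniqueness is what identifies it
    with the limit of the G_k. The obstacle in the converse is that f lies outside the closed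
    subspace V_X^0, so the G_k cannot converge to f in norm; what survives is a weakly
    unconditionally Cauchy series. Two requirements on the scales d_k make the splitting by length
    summable. First, G_k is within d_k^2 of f: on an interval of length l > d_k the k-th difference
    has an increment of at most 4 d_k^2 <= 4 l d_k, which can be summed over the partition and over
    k. Second, d_(k+1) is chosen after G_k, so small that partitions of mesh at most d_(k+1) give
    G_k variation at most d_k. Between these ranges neither estimate applies and only the comparison
    with the oscillation of f is left. *)

Lemma dualD phi x y : phi (x + y) = phi x + phi y.
Proof. by rewrite -[x]scale1r dual_linear !scale1r. Qed.

Lemma dual0 phi : phi 0 = 0.
Proof. by rewrite -(scale0r 0) dualZ mul0r. Qed.

Lemma dualN phi x : phi (- x) = - phi x.
Proof. by rewrite -scaleN1r dualZ mulN1r. Qed.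

Lemma dualB phi x y : phi (x - y) = phi x - phi y.
Proof. by rewrite dualD dualN. Qed.

Lemma dual_sum phi I (r : seq I) (P : pred I) (F : I -> V) :
  phi (\sum_(i <- r | P i) F i) = \sum_(i <- r | P i) phi (F i).
Proof. exact: (big_morph phi (dualD phi) (dual0 phi)). Qed.

Lemma dual_le phi x : `|phi x| <= `|phi| * `|x|.
Proof.
have [->|x0] := eqVneq x 0; first by rewrite dual0 !normr0 mulr0.
have x1 : `| `|x|^-1 *: x| <= 1.
  by rewrite normrZ normfV normr_id mulVf ?normr_eq0.
have := dual_norm_le phi x1; rewrite -[dual_norm phi]/(`|phi|).
rewrite dualZ normrM normfV normr_id ler_pdivrMl ?normr_gt0//.
by rewrite mulrC.
Qed.

Lemma dual_norm_bound phi (M : R) : 0 <= M ->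
  (forall x, `|phi x| <= M * `|x|) -> `|phi| <= M.
Proof.
move=> M0 h; apply: dual_norm_ge => x x1; apply: le_trans (h x) _.
by rewrite ler_piMr.
Qed.

Lemma dual_ex (f : V -> R) (M : R) :
  (forall x y, f (x + y) = f x + f y) -> (forall k x, f (k *: x) = k * f x) ->
  (forall x, `|f x| <= M * `|x|) -> exists phi : dual V, forall x, phi x = f x.
Proof.
move=> fD fZ fM; have lin : linear (f : V -> R^o).
  by move=> k x y; rewrite fD fZ.
have fp : (f : V -> R^o) \in @dual_pred R V.
  apply/asboolP; split=> //.
  pose d : {linear V -> R^o} :=
    HB.pack (f : V -> R^o) (GRing.isLinear.Build _ _ _ _ _ lin).
  apply/(linear_bounded_continuous d)/bounded_funP => r.
  exists (`|M| * r) => x xr; apply: le_trans (fM x) _.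
  apply: (@le_trans _ _ (`|M| * `|x|)); last exact: ler_wpM2l.
  by apply: ler_wpM2r => //; exact: ler_norm.
by exists (Dual fp).
Qed.

End DualFacts.

(** * The Hahn-Banach theorem in the form of norming functionals *)

Section HahnBanach.
Context {R : realType} {V : normedModType R}.

Definition sublinear (q : V -> R) :=
  [/\ forall x y, q (x + y) <= q x + q y, forall t x, 0 <= t -> q (t *: x) = t * q x
    & forall x, q x <= `|x|].

Lemma sublinear0 q : sublinear q -> q 0 = 0.
Proof. by move=> [_ qZ _]; have := qZ 0 0 (lexx _); rewrite scale0r mul0r. Qed.

Lemma sublinear_ge q x : sublinear q -> - `|x| <= q x.
Proof.
move=> sq; have [qD qZ qn] := sq.
have := qD x (- x); rewrite subrr (sublinear0 sq) => h; have := qn (- x).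
by rewrite normrN => h'; lra.
Qed.

(* Pushing q down along the direction y; minimal sublinear functions are
   fixed by this operation, hence linear. *)
Lemma sublinear_push q y : sublinear q -> exists2 q', sublinear q' &
  (forall x, q' x <= q x) /\ q' (- y) <= - q y.
Proof.
move=> sq; have [qD qZ qn] := sq.
pose S x := [set q (x + t *: y) - t * q y | t in [set t : R | 0 <= t]].
have Slb x : has_inf (S x).
  split; first by exists (q (x + 0 *: y) - 0 * q y), 0 => //=.
  exists (- q (- x)) => _ [t /= t0 <-].
  have := qD (- x) (x + t *: y); rewrite addKr qZ//; lra.
have Sle x t : 0 <= t -> inf (S x) <= q (x + t *: y) - t * q y.
  by move=> t0; apply: ge_inf; [exact: (Slb x).2|exists t].
exists (fun x => inf (S x)); last first.
  split=> [x|]; first by have := Sle x 0 (lexx _); rewrite scale0r mul0r addr0 subr0.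
  have := Sle (- y) 1 ler01; rewrite scale1r addNr mul1r.
  by rewrite (sublinear0 sq) add0r.
split.
- move=> x x'; apply/ler_addgt0Pr => e e0.
  have e2 : 0 < e / 2 by rewrite divr_gt0.
  have [_ [t /= t0 <-] h] := inf_adherent e2 (Slb x).
  have [_ [t' /= t'0 <-] h'] := inf_adherent e2 (Slb x').
  have := Sle (x + x') (t + t') (addr_ge0 t0 t'0).
  have := qD (x + t *: y) (x' + t' *: y).
  by rewrite addrACA -scalerDl; lra.
- move=> t x; rewrite le_eqVlt => /predU1P[<-|t0].
    rewrite scale0r mul0r; apply/eqP; rewrite eq_le; apply/andP; split.
      have := Sle 0 0 (lexx _); rewrite scale0r mul0r addr0 subr0.
      by rewrite (sublinear0 sq).
    apply: lb_le_inf; first exact: (Slb 0).1.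
    by move=> _ [t' /= t'0 <-]; rewrite add0r qZ// subrr.
  have tt : t \is a GRing.unit by rewrite unitf_gt0.
  have key s z : 0 < s -> inf (S (s *: z)) <= s * inf (S z).
    move=> s0; rewrite -ler_pdivrMl//; apply: lb_le_inf; first exact: (Slb z).1.
    move=> _ [r /= r0 <-]; rewrite ler_pdivrMl//.
    have := Sle (s *: z) (s * r) (mulr_ge0 (ltW s0) r0).
    by rewrite -scalerA -scalerDr qZ ?(ltW s0)//; lra.
  apply/eqP; rewrite eq_le key//= -ler_pdivlMl//.
  have := key t^-1 (t *: x); rewrite invr_gt0 => /(_ t0).
  by rewrite scalerA mulVr// scale1r.
- move=> x; apply: le_trans (qn x).
  by have := Sle x 0 (lexx _); rewrite scale0r mul0r addr0 subr0.
Qed.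

(** Zorn's lemma is applied to sublinear functions instead of partial extensions. Pushing the norm
    along [x0] gives [q0] with [q0 (- x0) <= - |x0|], and everything below [q0] inherits this. A
    minimal [q] below [q0] is unchanged by every push, which makes it odd; an odd subadditive
    function is additive. *)
Lemma norming_functional (x0 : V) :
  exists phi : dual V, (forall x, `|phi x| <= `|x|) /\ phi x0 = `|x0|.
Proof.
have snorm : sublinear (fun x : V => `|x|).
  split=> [x y|t x t0|x]; [exact: ler_normD|by rewrite normrZ ger0_norm|by []].
have [q0 sq0 [_ q0x]] := sublinear_push x0 snorm.
pose T := {q : V -> R | sublinear q /\ forall x, q x <= q0 x}.
(* The order is reversed: a maximal element for [Rel] is a minimal sublinear function. *)
pose Rel (p q : T) := `[< forall x, sval q x <= sval p x >].
have [q qmax] : exists t : T, forall s, Rel t s -> s = t.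
  apply: Zorn.
  - by move=> t; apply/asboolP.
  - by move=> r s t /asboolP h /asboolP h'; apply/asboolP => x; exact: le_trans (h x).
  - move=> [s hs] [t ht] /asboolP h /asboolP h'; apply: eq_exist.
    by apply/funext => x; apply/eqP; rewrite eq_le h h'.
  - move=> A Atot.
    have [[a Aa]|A0] := pselect (A !=set0); last first.
      have h0 : sublinear q0 /\ forall x, q0 x <= q0 x by [].
      by exists (exist _ q0 h0) => s As; exfalso; apply: A0; exists s.
    pose S x := [set sval q x | q in A].
    have Si x : has_inf (S x).
      split; first by exists (sval a x), a.
      exists (- `|x|) => _ [q Aq <-]; exact: sublinear_ge (svalP q).1.
    have Sle x q : A q -> inf (S x) <= sval q x.
      by move=> Aq; apply: ge_inf; [exact: (Si x).2|exists q].
    have hT : sublinear (fun x => inf (S x)) /\ forall x, inf (S x) <= q0 x.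
      split; last by move=> x; exact: le_trans (Sle x a Aa) ((svalP a).2 x).
      split.
      + move=> x y; apply/ler_addgt0Pr => e e0.
        have e2 : 0 < e / 2 by rewrite divr_gt0.
        have [_ [q Aq <-] h] := inf_adherent e2 (Si x).
        have [_ [q' Aq' <-] h'] := inf_adherent e2 (Si y).
        (* In a chain the smaller of the two approximating functions serves both points. *)
        wlog : x y q q' Aq Aq' h h' / Rel q q'.
          move=> hw; have [|r] := Atot q q' Aq Aq'; first exact: hw.
          by have := hw y x q' q Aq' Aq h' h r; rewrite (addrC y) (addrC (inf (S y))).
        move=> /asboolP r; have [[+ _ _] _] := svalP q' => /(_ x y) h1.
        by have := Sle (x + y) q' Aq'; have := r x; lra.
      + move=> t x t0; apply/eqP; rewrite eq_le; apply/andP; split.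
          rewrite le_eqVlt in t0; case/predU1P: t0 => [<-|t0].
            rewrite scale0r mul0r; apply: le_trans (Sle 0 a Aa) _.
            by rewrite (sublinear0 (svalP a).1).
          rewrite -ler_pdivrMl//; apply: lb_le_inf; first exact: (Si x).1.
          move=> _ [q Aq <-]; rewrite ler_pdivrMl//.
          by have [[_ qZ _] _] := svalP q; rewrite -qZ ?(ltW t0)//; exact: Sle.
        apply: lb_le_inf; first exact: (Si _).1.
        move=> _ [q Aq <-]; have [[_ qZ _] _] := svalP q; rewrite qZ//.
        by apply: ler_wpM2l => //; exact: Sle.
      + by move=> x; apply: le_trans (Sle x a Aa) _; have [[]] := svalP a.
    exists (exist _ (fun x => inf (S x)) hT) => q Aq; apply/asboolP => x /=; exact: Sle.
have [sq qle] := svalP q; have [qD qZ qn] := sq.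
have q00 := sublinear0 sq.
have qN x : sval q (- x) = - sval q x.
  have [q' sq' [q'q q'x]] := sublinear_push x sq.
  have hT : sublinear q' /\ forall x, q' x <= q0 x.
    by split=> // z; exact: le_trans (q'q z) (qle z).
  have := qmax (exist _ q' hT); rewrite /Rel => /(_ ltac:(exact/asboolP)) e.
  have e1 : q' = sval q by rewrite -e.
  move: q'x; rewrite e1 => h; apply/eqP; rewrite eq_le h /=.
  by have := qD x (- x); rewrite subrr q00; lra.
have qA x y : sval q (x + y) = sval q x + sval q y.
  apply/eqP; rewrite eq_le qD /=.
  by have := qD (- x) (- y); rewrite -opprD !qN; lra.
have qS k x : sval q (k *: x) = k * sval q x.
  have [k0|k0] := leP 0 k; first by rewrite qZ.
  by rewrite -[k]opprK scaleNr qN qZ ?oppr_ge0 ?ltW// !mulNr.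
have qb x : `|sval q x| <= `|x|.
  by rewrite ler_norml sublinear_ge//= qn.
have qb1 x : `|sval q x| <= 1 * `|x| by rewrite mul1r.
have [phi hphi] := dual_ex qA qS qb1.
exists phi; split=> [x|]; rewrite hphi//.
apply/eqP; rewrite eq_le qn /=.
by have := le_trans (qle (- x0)) q0x; rewrite qN; lra.
Qed.

End HahnBanach.

(** * Limits of bounded real functions along an ultrafilter *)

Section UltraLimits.
Context {R : realType} {T : Type} (U : set_system T) {UU : UltraFilter U}.

(** Compactness of [[- M, M]] gives a cluster point, and an ultrafilter converges to each of its
    cluster points. *)
Lemma ultra_bounded_cvg (u : T -> R) M :
  (forall i, `|u i| <= M) -> cvg (u i @[i --> U]).
Proof.
move=> uM; have uP : (u @ U) `[- M, M]%classic.
  by rewrite /fmap /=; apply: (@filterS _ U _ setT) => [i _ /=|];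
    [rewrite in_itv /= -ler_norml uM|exact: filterT].
have [l [_ lc]] := @segment_compact R (- M) M (u @ U) _ uP.
apply/cvg_ex; exists l => A Al.
have [//|UA] := in_ultra_setVsetC (u @^-1` A) UU.
by have [z [? ?]] := lc (~` A) A UA Al.
Qed.

Definition ulim (u : T -> R) : R := lim (u i @[i --> U]).

Lemma ulimP (u : T -> R) M : (forall i, `|u i| <= M) -> u i @[i --> U] --> ulim u.
Proof. by move=> /ultra_bounded_cvg. Qed.

Lemma ulim_norm_le (u : T -> R) M : (forall i, `|u i| <= M) -> `|ulim u| <= M.
Proof.
move=> uM; have /cvg_norm c := ulimP uM.
rewrite -(cvg_lim _ c)//; apply: limr_le; first by apply/cvg_ex; exists (`|ulim u|).
by apply: (@filterS _ U _ setT) => [i _ /=|]; [exact: uM|exact: filterT].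
Qed.

End UltraLimits.

(** * Norms of combinations of the basis vectors *)

Lemma eq_ler (R : realType) (x y : R) : x = y -> x <= y.
Proof. by move->. Qed.

Section BasisNorm.
Context {R : realType} {X : normedModType R} (e : nat -> X).
Hypothesis he : symmetric_basis e.

Definition comb_norm n (a : nat -> R) : R := `|\sum_(i < n) a i *: e i|.

(** The list form carries the symmetry: its value depends only on the multiset of non-zero entries,
    so that increments can be sorted, filtered and compared as sublists. *)
Definition seq_norm (c : seq R) : R := comb_norm (size c) (nth 0 c).

Lemma comb_norm_ge0 n a : 0 <= comb_norm n a. Proof. exact: normr_ge0. Qed.

Lemma eq_comb_norm n a b : (forall i, (i < n)%N -> a i = b i) -> comb_norm n a = comb_norm n b.
Proof. by move=> h; congr (`|_|); apply: eq_bigr => i _; rewrite h. Qed.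

Lemma comb_normD n a b : comb_norm n (fun i => a i + b i) <= comb_norm n a + comb_norm n b.
Proof.
apply: le_trans (ler_normD _ _); rewrite -big_split /= le_eqVlt; apply/orP; left.
by apply/eqP; congr (`|_|); apply: eq_bigr => i _; rewrite scalerDl.
Qed.

Lemma comb_normZ n k a : comb_norm n (fun i => k * a i) = `|k| * comb_norm n a.
Proof.
rewrite /comb_norm -normrZ scaler_sumr; congr (`|_|).
by apply: eq_bigr => i _; rewrite scalerA.
Qed.

Lemma comb_norm_sum (I : Type) (r : seq I) n (a : I -> nat -> R) :
  comb_norm n (fun i => \sum_(k <- r) a k i) <= \sum_(k <- r) comb_norm n (a k).
Proof.
elim: r => [|k r IH].
  rewrite big_nil /comb_norm big1 ?normr0// => i _.
  by rewrite big_nil scale0r.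
rewrite big_cons; apply: le_trans (lerD (lexx _) IH); apply: le_trans (comb_normD _ _ _).
by rewrite le_eqVlt; apply/orP; left; apply/eqP; apply: eq_comb_norm => i _; rewrite big_cons.
Qed.

Lemma comb_norm_sign n a (s : nat -> bool) : comb_norm n (fun i => (-1) ^+ s i * a i) = comb_norm n a.
Proof. by have := he.2 n a s id (inv_bij (fun=> erefl)). Qed.

(** [symmetric_basis] speaks of bijections of the naturals; a permutation of the first n indices is
    extended by the identity. *)
Lemma comb_norm_perm n (s : {perm 'I_n}) (a : 'I_n -> R) :
  `|\sum_i a (s i) *: e i| = `|\sum_i a i *: e i|.
Proof.
pose pi (t : {perm 'I_n}) (i : nat) :=
  if insub i is Some j then nat_of_ord (t j) else i.
have piK (t t' : {perm 'I_n}) : cancel t t' -> cancel (pi t) (pi t').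
  move=> tK i; rewrite /pi; case: (insubP 'I_n i) => [j _ <-|h].
    by rewrite valK tK.
  by rewrite insubN.
have bpi : bijective (pi s).
  exists (pi (s^-1)%g); apply: piK => i; [exact: permK|exact: permKV].
pose b i := if insub i is Some j then a (s j) else 0.
have := he.2 n b (fun=> false) (pi s) bpi.
have -> : \sum_(i < n) b i *: e i = \sum_i a (s i) *: e i.
  by apply: eq_bigr => i _; rewrite /b valK.
move=> <-; congr (`|_|); rewrite [RHS](reindex_inj (@perm_inj _ s)).
by apply: eq_bigr => i _; rewrite /b /pi valK expr0 mul1r.
Qed.

Lemma norm_basis i : `|e i| = `|e 0%N|.
Proof.
pose s j := if j == 0%N then i else if j == i then 0%N else j.
have sK : involutive s by move=> j; rewrite /s; repeat case: eqP => //=; congruence.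
have := he.2 1%N (fun=> 1) (fun=> false) s (inv_bij sK).
by rewrite !big_ord1 expr0 mul1r !scale1r.
Qed.

Lemma basis_gt0 : 0 < `|e 0%N|.
Proof. exact: basis0_gt0 he. Qed.

Lemma comb_norm_l1 n a : comb_norm n a <= (\sum_(i < n) `|a i|) * `|e 0%N|.
Proof.
rewrite mulr_suml; apply: le_trans (ler_norm_sum _ _ _) _.
by apply: ler_sum => i _; rewrite normrZ norm_basis.
Qed.

(** The coordinates are replaced one at a time. If [a k = t * b k] with [|t| <= 1], the new vector
    is the convex combination with weights (1 + t)/2 and (1 - t)/2 of the old one and of the old one
    with the sign of its k-th coordinate changed. *)
Lemma comb_norm_le n a b : (forall i, (i < n)%N -> `|a i| <= `|b i|) -> comb_norm n a <= comb_norm n b.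
Proof.
move=> ab; pose c k i := if (i < k)%N then a i else b i.
have key k : (k <= n)%N -> comb_norm n (c k) <= comb_norm n b.
  elim: k => [_|k IH kn]; first by rewrite (@eq_comb_norm _ (c 0) b).
  apply: le_trans (IH (ltnW kn)).
  have [bk0|bk0] := eqVneq (b k) 0.
    have ak0 : a k = 0 by apply/normr0_eq0/le_anti; rewrite normr_ge0 -(normr0 R) -bk0 ab.
    rewrite le_eqVlt; apply/orP; left; apply/eqP; apply: eq_comb_norm => i _; rewrite /c ltnS.
    by case: ltngtP => // ->; rewrite ak0 bk0.
  pose t := a k / b k.
  have t1 : `|t| <= 1 by rewrite normrM normfV ler_pdivrMr ?normr_gt0// mul1r ab.
  have tb : a k = t * b k by rewrite mulfVK.
  pose s i := i == k.
  have -> : comb_norm n (c k.+1) = comb_norm n (fun i => (1 + t) / 2 * c k i +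
      (1 - t) / 2 * ((-1) ^+ s i * c k i)).
    apply: eq_comb_norm => i _; rewrite /c /s ltnS; case: ltngtP => [_|_|->].
    - by rewrite expr0 mul1r -mulrDl; field.
    - by rewrite expr0 mul1r -mulrDl; field.
    - by rewrite expr1 tb; field.
  apply: le_trans (comb_normD _ _ _) _; rewrite !comb_normZ comb_norm_sign -mulrDl.
  move: t1; rewrite ler_norml => /andP[t1 t2].
  rewrite !ger0_norm; [|lra|lra].
  by rewrite -mulrDl addrACA subrr addr0 -[1 + 1]/2%:R divff// mul1r.
by rewrite -(@eq_comb_norm n (c n))=> [|i ni]; [exact: key|rewrite /c ni].
Qed.

Lemma comb_norm_widen n m a : (n <= m)%N -> (forall i, (n <= i < m)%N -> a i = 0) ->
  comb_norm m a = comb_norm n a.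
Proof.
move=> nm a0; congr (`|_|); rewrite -!(big_mkord xpredT (fun i => a i *: e i)).
rewrite (big_cat_nat _ nm)//= [X in _ + X]big1_seq ?addr0// => i.
by rewrite mem_index_iota => /andP[_ /a0->]; rewrite scale0r.
Qed.

Lemma comb_norm_leq n m a : (n <= m)%N -> comb_norm n a <= comb_norm m a.
Proof.
move=> nm; pose b i := if (i < n)%N then a i else 0.
have -> : comb_norm n a = comb_norm m b.
  rewrite (@comb_norm_widen n m b)// => [|i /andP[ni _]]; last by rewrite /b ltnNge ni.
  by apply: eq_comb_norm => i ni; rewrite /b ni.
by apply: comb_norm_le => i _; rewrite /b; case: ifP => // _; rewrite normr0 normr_ge0.
Qed.

Lemma seq_norm_perm c d : perm_eq c d -> seq_norm c = seq_norm d.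
Proof.
move=> cd; have sz := perm_size cd; rewrite /seq_norm sz.
have /tuple_permP[s cs] : perm_eq c (in_tuple d) by [].
rewrite /comb_norm -(comb_norm_perm s (fun i => nth 0 d i)); congr (`|_|).
by apply: eq_bigr => i _; rewrite cs -tnth_nth tnth_mktuple (tnth_nth 0).
Qed.

Lemma seq_norm_catl c d : seq_norm c <= seq_norm (c ++ d).
Proof.
rewrite /seq_norm size_cat; apply: (@le_trans _ _ (comb_norm (size c) (nth 0 (c ++ d)))).
  by apply/eq_ler/eq_comb_norm => i ic; rewrite nth_cat ic.
exact/comb_norm_leq/leq_addr.
Qed.

Lemma seq_norm_filter (p : pred R) (c : seq R) : seq_norm (seq.filter p c) <= seq_norm c.
Proof.
apply: le_trans (seq_norm_catl _ (seq.filter (predC p) c)) _.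
by apply/eq_ler/seq_norm_perm; rewrite perm_filterC.
Qed.

Lemma seq_norm_nz (c : seq R) : seq_norm [seq x <- c | x != 0] = seq_norm c.
Proof.
apply/eqP; rewrite eq_le seq_norm_filter /=.
set p := (fun x => x != 0); rewrite -(seq_norm_perm (permEl (perm_filterC p c))).
rewrite /seq_norm size_cat; set d := [seq x <- c | predC p x].
rewrite (@comb_norm_widen (size (seq.filter p c))) ?leq_addr//.
  by apply/eq_ler/eq_comb_norm => i ic; rewrite nth_cat ic.
move=> i /andP[i1 i2]; rewrite nth_cat ltnNge i1 /=.
have : nth 0 d (i - size (seq.filter p c)) \in d by rewrite mem_nth// ltn_subLR.
by rewrite mem_filter /= negbK => /andP[/eqP].
Qed.

Lemma seq_norm_subseq c d : subseq c d -> seq_norm c <= seq_norm d.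
Proof.
by move=> /perm_to_subseq[d' dd']; rewrite (seq_norm_perm dd') seq_norm_catl.
Qed.

Lemma seq_norm_map_le T (s : seq T) (f g : T -> R) :
  (forall x, `|f x| <= `|g x|) -> seq_norm (map f s) <= seq_norm (map g s).
Proof.
move=> fg; rewrite /seq_norm !size_map; apply: comb_norm_le => i si.
case: s si => // x s si; by rewrite !(nth_map x).
Qed.

(** The fundamental function of the basis, the L_n of the overview. *)
Definition fundamental n := comb_norm n (fun=> 1).

(* Averaging over cyclic shifts turns a into a constant vector. *)
Lemma comb_norm_mean n (a : nat -> R) : `|\sum_(i < n) a i| * fundamental n <= n%:R * comb_norm n a.
Proof.
case: n => [|n]; first by rewrite big_ord0 normr0 mul0r mul0r.
rewrite /fundamental -comb_normZ.
have -> : comb_norm n.+1 (fun=> (\sum_(i < n.+1) a i) * 1) =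
    `|\sum_(k < n.+1) \sum_(i < n.+1) a (nat_of_ord (i + k)) *: e i|.
  rewrite exchange_big /=; congr (`|_|); apply: eq_bigr => i _.
  by rewrite -scaler_suml mulr1 (reindex_inj (@addrI _ i)).
apply: le_trans (ler_norm_sum _ _ _) _.
rewrite -[X in X%:R](card_ord n.+1) mulr_natl -sumr_const; apply: ler_sum => k _.
rewrite /comb_norm -(comb_norm_perm (perm (@addIr _ k)) (fun i => a (nat_of_ord i))).
by apply/eq_ler; congr (`|_|); apply: eq_bigr => i _; rewrite permE.
Qed.

End BasisNorm.

(** * Consequences of reflexivity *)

Section Reflexive.
Context {R : realType} {X : normedModType R} (e : nat -> X).
Hypothesis he : symmetric_basis e.

Lemma partial_sum_le (x : X) (a : nat -> R) n :
  series (fun n => a n *: e n) @ \oo --> x -> comb_norm e n a <= `|x|.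
Proof.
move=> ax; have /cvg_norm c := ax.
rewrite -(cvg_lim _ c)//; apply: limr_ge; first by apply/cvg_ex; exists `|x|.
near=> m; rewrite /series /= big_mkord; apply: (comb_norm_leq he).
by near: m; exact: nbhs_infty_ge.
Unshelve. all: by end_near. Qed.

(** Linearity comes from uniqueness of the expansion. Continuity comes from unconditionality with
    constant 1: a single term of the expansion has norm at most that of a partial sum, hence at most
    [|x|]. *)
Lemma coord_functional : exists c : nat -> dual X,
  (forall i j, c i (e j) = (i == j)%:R) /\
  (forall x, series (fun n => c n x *: e n) @ \oo --> x).
Proof.
have hex (x : X) : {a : nat -> R | series (fun n => a n *: e n) @ \oo --> x}.
  by apply: cid; have [a [ax _]] := he.1 x; exists a.
pose a x := sval (hex x); have ax x : series (fun n => a x n *: e n) @ \oo --> x.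
  exact: svalP (hex x).
have au x b : series (fun n => b n *: e n) @ \oo --> x -> a x = b.
  move=> bx; have [a' [_ ua]] := he.1 x.
  by rewrite -(ua _ (ax x)) -(ua _ bx).
have aD x y i : a (x + y) i = a x i + a y i.
  rewrite (au _ (fun i => a x i + a y i))//.
  rewrite (_ : series _ = (fun n => series (fun n => a x n *: e n) n +
      series (fun n => a y n *: e n) n)); first by apply: cvgD; exact: ax.
  apply/funext => n; rewrite /series /= -big_split /=.
  by apply: eq_bigr => j _; rewrite scalerDl.
have aZ i k x : a (k *: x) i = k * a x i.
  rewrite (au _ (fun i => k * a x i))//.
  rewrite (_ : series _ = (fun n => k *: series (fun n => a x n *: e n) n)).
    by apply: cvgZl_tmp; exact: ax.
  apply/funext => n; rewrite /series /= scaler_sumr.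
  by apply: eq_bigr => j _; rewrite scalerA.
have ab i x : `|a x i| <= `|e 0%N|^-1 * `|x|.
  rewrite mulrC ler_pdivlMr ?basis_gt0//.
  apply: le_trans (partial_sum_le i.+1 (ax x)).
  apply: (@le_trans _ _ (comb_norm e i.+1 (fun j => if j == i then a x i else 0))).
    rewrite /comb_norm (bigD1 ord_max)//= eqxx big1 ?addr0; first by rewrite normrZ (norm_basis he).
    by move=> j ji; rewrite (negbTE (_ : nat_of_ord j != i)) ?scale0r//.
  by apply: (comb_norm_le he) => j _; case: eqP => [->//|_]; rewrite normr0.
have ex i := dual_ex (fun x y => aD x y i) (aZ i) (ab i).
exists (fun i => sval (cid (ex i))).
have cE i x : sval (cid (ex i)) x = a x i by exact: (svalP (cid (ex i))).
split=> [i j|x].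
  rewrite cE (au _ (fun i => (i == j)%:R))//.
  apply: cvg_near_cst; near=> n.
  have jn : (j < n)%N by near: n; exact: nbhs_infty_gt.
  rewrite /series /= big_mkord (bigD1 (Ordinal jn))//= eqxx scale1r big1 ?addr0//.
  by move=> k kj; rewrite (negbTE (_ : nat_of_ord k != j)) ?scale0r//.
by under [X in series X]eq_fun do rewrite cE; exact: ax.
Unshelve. all: by end_near. Qed.

Lemma coord_eq0 (c : nat -> dual X) (x : X) :
  series (fun n => c n x *: e n) @ \oo --> x -> (forall i, c i x = 0) -> x = 0.
Proof.
move=> cx c0; apply: cvg_unique cx _ => //.
rewrite (_ : series _ = cst 0); first exact: cvg_cst.
by apply/funext => n; rewrite /series /= big1// => i _; rewrite c0 scale0r.
Qed.

Hypothesis hX : reflexive_space X.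

(** The ultralimit of the values [phi (x i)] is a bounded functional of [phi], and reflexivity
    represents it by a vector. This is how bounded sets of X become weakly compact. *)
Lemma weak_ulim T (U : set_system T) (UU : UltraFilter U) (x : T -> X) M :
  (forall i, `|x i| <= M) ->
  exists y, forall phi : dual X, phi (x i) @[i --> U] --> phi y.
Proof.
move=> xM; have M0 : 0 <= M.
  have [i _] := @filter_ex _ U _ _ filterT; exact: le_trans (xM i).
have pM (phi : dual X) i : `|phi (x i)| <= M * `|phi|.
  by apply: le_trans (dual_le _ _) _; rewrite mulrC ler_wpM2r.
have pl (phi : dual X) := @ulimP _ _ U UU _ _ (pM phi).
have [|||F hF] := @dual_ex R (dual X) (fun phi => ulim U (fun i => phi (x i))) M.
- move=> phi psi; apply/cvg_lim => //; apply: cvgD; exact: pl.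
- move=> k phi; apply/cvg_lim => //.
  rewrite (_ : (fun i => (k *: phi) (x i)) = (fun i => k * phi (x i)))//.
  by apply: cvgM; [exact: cvg_cst|exact: pl].
- by move=> phi; exact: ulim_norm_le.
have [y hy] := hX F; exists y => phi; rewrite -hy hF; exact: pl.
Qed.

(** Otherwise [phi] stays away from 0 on an infinite set of indices. Along an ultrafilter containing
    this set, a weak ultralimit has all coordinates 0, hence is 0, which [phi] contradicts. *)
Lemma weakly_null (c : nat -> dual X) (x : nat -> X) M (phi : dual X) :
  (forall x, series (fun n => c n x *: e n) @ \oo --> x) ->
  (forall n, `|x n| <= M) -> (forall i, c i (x n) @[n --> \oo] --> (0 : R)) ->
  phi (x n) @[n --> \oo] --> (0 : R).
Proof.
move=> cx xM c0; apply/cvgrPdist_lt => eps eps0; apply: contrapT => h.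
pose A := [set n | eps <= `|phi (x n)|].
have FF : ProperFilter (within A \oo).
  apply: Build_ProperFilter_ex.
  move=> B [N _ hN]; apply: contrapT => nB; apply: h; exists N => // n /= Nn.
  rewrite sub0r normrN ltNge; apply/negP => An.
  by apply: nB; exists n; exact: hN.
have [U [UU FU]] := ultraFilterLemma FF.
have oU : \oo `<=` U by move=> B oB; apply: FU; rewrite /within /=; apply: filterS oB.
have [y hy] := weak_ulim UU xM.
have y0 : y = 0.
  apply: (coord_eq0 (cx y)) => i; apply: cvg_unique (hy (c i)) _ => //.
  by move=> B /(c0 i) /oU.
have := hy phi; rewrite y0 dual0 => /cvgrPdist_lt/(_ _ eps0) h1.
have h2 : U A.
  by apply: FU; rewrite /within; apply: (@filterS _ \oo _ setT) => //; exact: filterT.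
have [n [/=]] := filter_ex (filterI h1 h2).
by rewrite /A /= sub0r normrN ltNge => /negP.
Qed.

(** Excludes behaviour like c_0: were the sums e_0 + ... + e_(n-1) bounded, a weak ultralimit would
    have all coordinates 1, but an expansion whose terms all have norm [|e 0|] does not converge. *)
Lemma fundamental_unbounded M : exists n, M < fundamental e n.
Proof.
apply: contrapT => h; have lM n : fundamental e n <= M.
  by rewrite leNgt; apply/negP => hn; apply: h; exists n.
have [c [ce cx]] := coord_functional.
have [U [UU oU]] := ultraFilterLemma (@eventually_filter).
pose s n := \sum_(i < n) 1 *: e i.
have [y hy] := weak_ulim UU (lM : forall n, `|s n| <= M).
have cy i : c i y = 1.
  apply: cvg_unique (hy (c i)) _ => //.
  have : c i (s n) @[n --> \oo] --> (1 : R).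
    apply: cvg_near_cst; near=> n.
    have jn : (i < n)%N by near: n; exact: nbhs_infty_gt.
    rewrite /s dual_sum (bigD1 (Ordinal jn))//= scale1r ce eqxx big1 ?addr0//.
    by move=> j ji; rewrite scale1r ce eq_sym (negbTE (_ : nat_of_ord j != i)).
  by move=> h1 B /h1 /oU.
have e2 : 0 < `|e 0%N| / 2 by rewrite divr_gt0// basis_gt0.
have := cx y; set S := series _ => Sy.
have /cvgrPdist_lt/(_ _ e2)[N _ hN] := Sy.
have h1 : `|y - S N| < `|e 0%N| / 2 := hN N (leqnn N).
have h2 : `|y - S N.+1| < `|e 0%N| / 2 := hN N.+1 (leqnSn N).
have SN : S N.+1 = S N + e N by rewrite /S /series /= big_nat_recr//= cy scale1r.
have : `|(y - S N) - (y - S N.+1)| < `|e 0%N|.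
  by rewrite [ltRHS]splitr; apply: le_lt_trans (ler_normB _ _) (ltrD h1 h2).
by rewrite opprB addrC addrA subrK SN addrAC subrr add0r (norm_basis he) ltxx.
Unshelve. all: by end_near. Qed.

(** Excludes behaviour like l_1: if the fundamental function were at least t n, [comb_norm_mean]
    would make the sum of coordinates a bounded functional F with F (e_j) = 1 for all j, although
    the basis is weakly null. *)
Lemma fundamental_sublinear t : 0 < t -> exists n, fundamental e n < t * n%:R.
Proof.
move=> t0; apply: contrapT => h; have lM n : t * n%:R <= fundamental e n.
  by rewrite leNgt; apply/negP => hn; apply: h; exists n.
have [c [ce cx]] := coord_functional.
have [U [UU oU]] := ultraFilterLemma (@eventually_filter).
have sb n (a : nat -> R) : `|\sum_(i < n) a i| <= t^-1 * comb_norm e n a.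
  case: n => [|n]; first by rewrite big_ord0 normr0 mulr_ge0 ?invr_ge0 ?comb_norm_ge0// ltW.
  rewrite ler_pdivlMl// -(ler_pM2r (_ : 0 < n.+1%:R :> R)) ?ltr0n//.
  apply: le_trans (le_trans (comb_norm_mean he n.+1 a) _); last by rewrite mulrC.
  by rewrite mulrAC mulrC; apply: ler_wpM2l.
have sbx (x : X) n : `|\sum_(i < n) c i x| <= t^-1 * `|x|.
  apply: le_trans (sb n (fun i => c i x)) _.
  by rewrite ler_wpM2l ?invr_ge0 ?(ltW t0)//; exact: partial_sum_le.
have pl x := @ulimP _ _ U UU _ _ (sbx x).
have [|||F hF] := @dual_ex R X (fun x => ulim U (fun n => \sum_(i < n) c i x)) t^-1.
- move=> x y; apply/cvg_lim => //.
  rewrite (_ : (fun n => _) = (fun n => \sum_(i < n) c i x + \sum_(i < n) c i y)).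
    by apply: cvgD; exact: pl.
  by apply/funext => n; rewrite -big_split; apply: eq_bigr => i _; rewrite dualD.
- move=> k x; apply/cvg_lim => //.
  rewrite (_ : (fun n => _) = (fun n => k * \sum_(i < n) c i x)).
    by apply: cvgM; [exact: cvg_cst|exact: pl].
  by apply/funext => n; rewrite mulr_sumr; apply: eq_bigr => i _; rewrite dualZ.
- by move=> x; exact: ulim_norm_le.
have Fe j : F (e j) = 1.
  rewrite hF; apply: cvg_unique (pl (e j)) _ => //.
  have : \sum_(i < n) c i (e j) @[n --> \oo] --> (1 : R).
    apply: cvg_near_cst; near=> n.
    have jn : (j < n)%N by near: n; exact: nbhs_infty_gt.
    rewrite (bigD1 (Ordinal jn))//= ce eqxx big1 ?addr0//.
    by move=> k kj; rewrite ce (negbTE (_ : nat_of_ord k != j)).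
  by move=> h1 B /h1 /oU.
have := @weakly_null c e `|e 0%N| F cx.
move=> /(_ (fun n => eq_ler (norm_basis he n))).
have c0 i : c i (e n) @[n --> \oo] --> (0 : R).
  apply: cvg_near_cst; near=> n; rewrite ce.
  have jn : (i < n)%N by near: n; exact: nbhs_infty_gt.
  by rewrite (ltn_eqF jn).
move=> /(_ c0) F0.
have F1 : F (e n) @[n --> \oo] --> (1 : R).
  by apply: cvg_near_cst; near=> n; rewrite Fe.
have e10 : (1 : R) = 0 := cvg_unique (@Rhausdorff R) F1 F0.
by have := oner_eq0 R; rewrite e10 eqxx.
Unshelve. all: by end_near. Qed.

(* An element phi of the dual ball has few large coordinates: n0 of them
   larger than t would give t * n0 <= fundamental n0. *)
Lemma comb_norm_small (L eps : R) : 0 <= L -> 0 < eps -> exists2 eta : R, 0 < eta &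
  forall n (a : nat -> R), \sum_(i < n) `|a i| <= L ->
    (forall i, (i < n)%N -> `|a i| <= eta) -> comb_norm e n a <= eps.
Proof.
move=> L0 eps0; pose t := eps / 2 / (L + 1).
have t0 : 0 < t by rewrite !divr_gt0// ltr_wpDl.
have tL : t * L <= eps / 2.
  by rewrite /t -mulrA ger_pMr ?divr_gt0// mulrC ler_pdivrMr ?mul1r ?lerDl// ltr_wpDl.
have [n0 hn0] := fundamental_sublinear t0.
(* With this [eta] the at most [n0] indices where [phi (e i)] exceeds [t] contribute at most eps/2;
   the others contribute at most [t * L <= eps / 2]. *)
pose eta := eps / 2 / (n0%:R + 1) / `|e 0%N|.
have n1 : 0 < n0%:R + 1 :> R by rewrite ltr_wpDl.
have eta0 : 0 < eta by rewrite !divr_gt0// basis_gt0.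
exists eta => // n a aL aeta.
have [phi [phi1 phix]] := norming_functional (\sum_(i < n) a i *: e i).
rewrite /comb_norm -phix dual_sum.
under eq_bigr do rewrite dualZ.
pose p (i : 'I_n) := t < `|phi (e i)|.
have count : (#|p| <= n0)%N.
  rewrite leqNgt; apply/negP => hlt.
  pose r := take n0 (enum p); pose A := [set i in r]%SET.
  have Ap i : i \in A -> p i.
    by rewrite inE => /mem_take; rewrite mem_enum.
  have cA : #|A| = n0.
    rewrite cardsE; have /card_uniqP-> : uniq r by rewrite take_uniq ?enum_uniq.
    by rewrite size_takel// -cardE ltnW.
  pose b i : R := if insub i is Some j then (j \in A)%:R else 0.
  have : t * n0%:R <= comb_norm e n (fun i => (-1) ^+ (phi (e i) < 0)%R * b i).
    apply: (@le_trans _ _ `|phi (\sum_(i < n) ((-1) ^+ (phi (e i) < 0)%R * b i) *: e i)|); last exact: phi1.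
    apply: le_trans (ler_norm _); rewrite dual_sum.
    rewrite -cA mulr_natr -sumr_const big_mkcond /=; apply: ler_sum => i _.
    rewrite dualZ /b valK; case: ifP => iA.
      rewrite mulr1; apply: le_trans (ltW (Ap _ iA)) _.
      by rewrite normrEsign.
    by rewrite mulr0 mul0r.
  rewrite (comb_norm_sign he) leNgt => /negP; apply; apply: le_lt_trans hn0.
  have -> : fundamental e n0 = seq_norm e (nseq n0 1).
    by rewrite /seq_norm size_nseq; apply: eq_comb_norm => i ni; rewrite nth_nseq ni.
  have -> : comb_norm e n b = seq_norm e (mkseq b n).
    by rewrite /seq_norm size_mkseq; apply: eq_comb_norm => i ni; rewrite nth_mkseq.
  rewrite -(seq_norm_nz he); apply/eq_ler; congr seq_norm.
  rewrite /mkseq -val_enum_ord -map_comp.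
  rewrite (eq_map (_ : _ =1 fun i : 'I_n => (i \in A)%:R)) => [|i]; last first.
    by rewrite /= /b valK.
  rewrite filter_map (eq_filter (_ : _ =1 mem A)) => [|i]; last first.
    by rewrite /= pnatr_eq0 eqb0 negbK.
  have -> : [seq i <- enum 'I_n | mem A i] = enum A.
    by rewrite enumT [RHS]/enum_mem.
  rewrite -cA cardE.
  apply: (@eq_from_nth _ 0); first by rewrite size_map size_nseq.
  move=> i; rewrite size_map => iA; rewrite nth_nseq iA.
  have [x0 _] : exists x0 : 'I_n, true by case: (enum A) iA => // x0 *; exists x0.
  by rewrite (nth_map x0)// -mem_enum mem_nth.
apply: le_trans (ler_norm _) _; apply: le_trans (ler_norm_sum _ _ _) _.
rewrite (bigID p) /= [leRHS](splitr eps); apply: lerD.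
  apply: (@le_trans _ _ (\sum_(i < n | p i) eta * `|e 0%N|)).
    apply: ler_sum => i _; rewrite normrM; apply: ler_pM => //; first exact: aeta.
    by rewrite -(norm_basis he i).
  rewrite sumr_const -[leLHS]mulr_natr.
  apply: (@le_trans _ _ (eta * `|e 0%N| * (n0%:R + 1))).
    apply: ler_wpM2l; first by rewrite mulr_ge0// ltW.
    by rewrite (@le_trans _ _ n0%:R) ?ler_nat// lerDl.
  by rewrite /eta mulfVK ?mulfVK// gt_eqF// basis_gt0.
apply: le_trans tL; apply: (@le_trans _ _ (t * \sum_(i < n) `|a i|)); last first.
  by rewrite ler_wpM2l// ltW.
rewrite mulr_sumr [leRHS](bigID p) /= ler_wpDl//.
  by apply: sumr_ge0 => i _; rewrite mulr_ge0// ltW.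
by apply: ler_sum => i; rewrite -leNgt => h; rewrite normrM mulrC ler_wpM2r.
Qed.

End Reflexive.

(** * Increments along paths *)

Section Increments.
Context {R : realType} {X : normedModType R} (e : nat -> X).
Hypothesis he : symmetric_basis e.
Implicit Types (x y : I01 R) (l s : seq (I01 R)) (f g : I01 R -> R).

Definition le01 x y := \val x <= \val y.
Definition lt01 x y := \val x < \val y.
Definition one01 : I01 R := exist _ 1 (@one01_subproof R).

Lemma I01_ge0 x : 0 <= \val x.
Proof. by have := valP x; rewrite inE /= in_itv /= => /andP[]. Qed.

Lemma I01_le1 x : \val x <= 1.
Proof. by have := valP x; rewrite inE /= in_itv /= => /andP[]. Qed.

Lemma I01_ex (r : R) : 0 <= r -> r <= 1 -> exists x, \val x = r.
Proof.
move=> r0 r1; have h : r \in (`[0, 1]%classic : set R) by rewrite inE /= in_itv /= r0.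
by exists (exist _ r h).
Qed.

Lemma le01_trans : transitive le01.
Proof. by move=> y x z; exact: le_trans. Qed.

Definition cells x l := pairmap pair x l.
Definition incr f (p : I01 R * I01 R) := f p.2 - f p.1.
Definition len (p : I01 R * I01 R) : R := \val p.2 - \val p.1.

Lemma alphaE f s : alpha e f s = seq_norm e [seq incr f p | p <- cells (@zero01 R) s].
Proof.
rewrite /alpha /seq_norm size_map size_pairmap; congr (`|_|); apply: eq_bigr => i _.
rewrite (nth_map (@zero01 R, @zero01 R)) ?size_pairmap//.
by rewrite (nth_pairmap (@zero01 R)).
Qed.

Lemma partition01P s :
  partition01 s <-> path lt01 (@zero01 R) s /\ last (@zero01 R) s = one01.
Proof.
have h1 : path <%R (0 : R) [seq \val t | t <- s] = path lt01 (@zero01 R) s.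
  have h x : path <%R (\val x) [seq \val t | t <- s] = path lt01 x s.
    by elim: s x => //= y s IH x; rewrite IH.
  exact: (h (@zero01 R)).
have h2 : last (0 : R) [seq \val t | t <- s] = \val (last (@zero01 R) s).
  exact: (last_map _ s (@zero01 R)).
rewrite /partition01 /itv_partition h1 h2.
by split=> [[h /eqP h']|[h ->]]; split=> //; exact: val_inj.
Qed.

Lemma meshP s (eta : R) : 0 <= eta ->
  mesh s <= eta <-> all (fun p => len p <= eta) (cells (@zero01 R) s).
Proof.
move=> eta0; split=> h.
  apply/(all_nthP (@zero01 R, @zero01 R)) => i; rewrite size_pairmap => si.
  rewrite (nth_pairmap (@zero01 R))//; apply: le_trans h.
  exact: (le_bigmax _ (fun i : 'I_(size s) => \val (nth (@zero01 R) (@zero01 R :: s) i.+1)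
    - \val (nth (@zero01 R) (@zero01 R :: s) i)) (Ordinal si)).
apply: bigmax_le => // i _.
have /(all_nthP (@zero01 R, @zero01 R))/(_ i) := h.
by rewrite size_pairmap (nth_pairmap (@zero01 R))// => ->.
Qed.

Lemma subdivide x y (eta : R) : 0 < eta -> lt01 x y -> exists l,
  [/\ path lt01 x l, last x l = y & all (fun p => len p <= eta) (cells x l)].
Proof.
move=> eta0 xy; have [n hn] : exists n, \val y - \val x <= n%:R * eta.
  exists (Num.truncn ((\val y - \val x) / eta)).+1.
  by rewrite -ler_pdivrMr// ltW// truncnS_gt.
elim: n x xy hn => [|n IH] x xy hn.
  by move: hn xy; rewrite mul0r subr_le0 leNgt /lt01 => /negbTE->.
have [h|h] := leP (\val y - \val x) eta.
  by exists [:: y]; split; rewrite //= ?andbT.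
have [m mE] : exists m : I01 R, \val m = \val x + eta.
  apply: I01_ex; first by rewrite addr_ge0 ?I01_ge0// ltW.
  by have := I01_le1 y; lra.
have [||l [h1 h2 h3]] := IH m.
- by rewrite /lt01 mE; lra.
- by rewrite mE; move: hn; rewrite -natr1; lra.
exists (m :: l); split=> //=; first by rewrite h1 andbT /lt01 mE ltrDl.
by rewrite h3 andbT /len /= mE addrAC subrr add0r.
Qed.

(** Degenerate cells are dropped and long ones subdivided; the short cells stay as they are, so
    their increments survive as a sublist. Discarding zero values accounts for the dropped cells. *)
Lemma refine_path x l (eta : R) : 0 < eta -> path le01 x l -> exists l',
  [/\ path lt01 x l', last x l' = last x l, all (fun p => len p <= eta) (cells x l') &
    forall f, subseq [seq v <- [seq incr f p | p <- cells x l & len p <= eta] | v != 0]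
      [seq incr f p | p <- cells x l']].
Proof.
move=> eta0; elim: l x => [|y l IH] x /=; first by exists [::]; split.
move=> /andP[xy yl]; have [l' [h1 h2 h3 h4]] := IH y yl.
have [yx|nxy] := eqVneq x y.
  subst y; exists l'; split=> // f /=; case: ifP => _ //=.
  have -> : incr f (x, x) = 0 by rewrite /incr subrr.
  by rewrite eqxx /=; exact: h4.
have {xy nxy}xy : lt01 x y.
  rewrite /lt01 lt_neqAle; apply/andP; split; last exact: xy.
  by apply: contra_neq nxy => /val_inj.
have [short|long] := leP (\val y - \val x) eta.
  exists (y :: l'); split=> [|||f] //=; first by rewrite xy.
  - by rewrite h3 andbT.
  - case: ifP => _ /=; first by rewrite eqxx; exact: h4.
    exact: (subseq_trans (h4 f) (subseq_cons _ _)).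
have [m [m1 m2 m3]] := subdivide eta0 xy.
exists (m ++ l'); rewrite /cells cat_path last_cat pairmap_cat m2; split=> // [||f].
- by rewrite m1.
- by rewrite all_cat m3.
- rewrite map_cat; apply: subseq_trans (h4 f) _; exact: suffix_subseq.
Qed.

(** The condition defining V_X^0 speaks of whole partitions of small mesh. Refining the long cells
    localizes it: in any path, the short cells alone obey the same bound. *)
Lemma path_incr_le f l (eta M : R) : 0 < eta ->
  (forall s, partition01 s -> mesh s <= eta -> alpha e f s <= M) ->
  path le01 (@zero01 R) l ->
  seq_norm e [seq incr f p | p <- cells (@zero01 R) l & len p <= eta] <= M.
Proof.
move=> eta0 fM /(refine_path eta0)[l' [h1 h2 h3 h4]].
have [l'' [h1' h2' h3' h4']] : exists l'',
    [/\ path lt01 (@zero01 R) l'', last (@zero01 R) l'' = one01,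
     all (fun p => len p <= eta) (cells (@zero01 R) l'') &
     subseq [seq v <- [seq incr f p | p <- cells (@zero01 R) l & len p <= eta] | v != 0]
      [seq incr f p | p <- cells (@zero01 R) l'']].
  have [e1|ne1] := eqVneq (last (@zero01 R) l') one01; first by exists l'; split.
  have lt1 : lt01 (last (@zero01 R) l') one01.
    rewrite /lt01 lt_neqAle; apply/andP; split; last exact: I01_le1.
    by apply: contra_neq ne1 => /val_inj.
  have [m [m1 m2 m3]] := subdivide eta0 lt1.
  exists (l' ++ m); rewrite /cells cat_path last_cat pairmap_cat; split=> //.
  - by rewrite h1.
  - by rewrite all_cat h3.
  - rewrite map_cat; apply: subseq_trans (h4 f) _; exact: prefix_subseq.
rewrite -(seq_norm_nz he); apply: le_trans (seq_norm_subseq he h4') _.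
rewrite -alphaE; apply: fM; first by apply/partition01P.
by apply/meshP => //; exact: ltW.
Qed.

Lemma path_incr_VX f l : VX e f -> path le01 (@zero01 R) l ->
  seq_norm e [seq incr f p | p <- cells (@zero01 R) l] <= fine (VX_norm e f).
Proof.
move=> fV pl; have := @path_incr_le f l 1 (fine (VX_norm e f)) ltr01.
rewrite (eq_filter (_ : _ =1 predT)) ?filter_predT => [|p]; last first.
  by rewrite /= /len; have := I01_le1 p.2; have := I01_ge0 p.1; lra.
by apply=> // s ps _; exact: VX_alpha_le.
Qed.

(** Allows one subinterval to be chosen inside each cell: the increments over the chosen
    subintervals are among those of a longer path. *)
Lemma insert_path x l (u v : I01 R * I01 R -> I01 R) :
  (forall p, le01 p.1 p.2 -> [/\ le01 p.1 (u p), le01 (u p) (v p) & le01 (v p) p.2]) ->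
  path le01 x l -> exists2 l', path le01 x l' &
    last x l' = last x l /\ subseq [seq (u p, v p) | p <- cells x l] (cells x l').
Proof.
move=> uv; elim: l x => [|y l IH] x /=; first by exists [::].
move=> /andP[xy yl]; have [l' h1 [h2 h3]] := IH y yl.
have [/= a b c] := uv (x, y) xy.
exists [:: u (x, y), v (x, y), y & l']; first by rewrite /= a b c.
split=> //; rewrite [cells x _]/= -/(cells y l') -/(cells y l).
apply: (@subseq_trans _ [:: (u (x, y), v (x, y)), (v (x, y), y) & cells y l']).
  rewrite -[X in subseq X _]cat1s -[X in subseq _ X]cat1s; apply: cat_subseq => //.
  exact: subseq_trans h3 (subseq_cons _ _).
exact: subseq_cons.
Qed.

Lemma insert_incr_VX f l (u v : I01 R * I01 R -> I01 R) : VX e f ->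
  (forall p, le01 p.1 p.2 -> [/\ le01 p.1 (u p), le01 (u p) (v p) & le01 (v p) p.2]) ->
  path le01 (@zero01 R) l ->
  seq_norm e [seq f (v p) - f (u p) | p <- cells (@zero01 R) l] <= fine (VX_norm e f).
Proof.
move=> fV uv /(insert_path uv)[l' pl' [_ sl]].
apply: le_trans (path_incr_VX fV pl').
apply: (seq_norm_subseq he).
by have := map_subseq (incr f) sl; rewrite -map_comp.
Qed.

Lemma comp_alpha_le f (psi : R -> R) (k : I01 R -> I01 R) (eta M : R) : 0 < eta ->
  (forall s, partition01 s -> mesh s <= eta -> alpha e f s <= M) ->
  (forall a b, `|psi a - psi b| <= `|a - b|) ->
  (forall x y, le01 x y -> le01 (k x) (k y) /\ \val (k y) - \val (k x) <= \val y - \val x) ->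
  forall s, partition01 s -> mesh s <= eta -> alpha e (psi \o f \o k) s <= M.
Proof.
move=> eta0 fM psil kl s /partition01P[ps _] /(meshP _ (ltW eta0)) ms.
rewrite alphaE.
apply: (@le_trans _ _ (seq_norm e [seq incr f (k p.1, k p.2) | p <- cells (@zero01 R) s])).
  by apply: (seq_norm_map_le he) => p; exact: psil.
have pk x l : path lt01 x l -> path le01 (k x) (map k l).
  rewrite path_map; apply: sub_path => a b /= ab; exact: (kl _ _ (ltW ab)).1.
(* [k] need not fix 0, so the image path receives an extra first cell from 0 to [k 0], which is
   discarded in the end. *)
have p0 : path le01 (@zero01 R) (k (@zero01 R) :: map k s).
  by rewrite /= pk// andbT; exact: I01_ge0.
apply: le_trans (path_incr_le eta0 fM p0); apply: (seq_norm_subseq he).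
have kE x l : cells (k x) (map k l) = [seq (k p.1, k p.2) | p <- cells x l].
  by elim: l x => //= y l IH x; rewrite -/(cells (k y) _) IH.
rewrite (map_comp (incr f) (fun p => (k p.1, k p.2))) -kE.
apply: map_subseq; rewrite [cells (@zero01 R) _]/= -/(cells _ _).
have short : all (fun p => len p <= eta) (cells (k (@zero01 R)) (map k s)).
  rewrite kE all_map.
  elim: s (@zero01 R) ps ms {p0} => //= y s IH x /andP[xy ys] /andP[l1 l2].
  rewrite -/(cells y s) IH// andbT; apply: le_trans l1.
  exact: (kl _ _ (ltW xy)).2.
rewrite /= (all_filterP short); case: ifP => _ //; exact: subseq_cons.
Qed.

(** If x and y are close, the pair is a short cell of the path 0, x, y. *)
Lemma VX0_unif_continuous f (eps : R) : VX0 e f -> 0 < eps -> exists2 eta : R, 0 < eta &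
  forall x y, `|\val x - \val y| <= eta -> `|f x - f y| <= eps.
Proof.
move=> /VX0P[_ h] eps0; have e0 := basis_gt0 he.
have [eta eta0 hs] := h (eps * `|e 0%N|) (mulr_gt0 eps0 e0).
exists eta => // x y; wlog xy : x y / le01 x y.
  move=> hw; have [xy|yx] := leP (\val x) (\val y); first exact: hw.
  by rewrite distrC => ?; rewrite distrC; apply: hw => //; exact: ltW.
rewrite distrC ger0_norm ?subr_ge0// => d.
have pl : path le01 (@zero01 R) [:: x; y] by rewrite /= xy /le01 I01_ge0.
have h1 := path_incr_le eta0 hs pl; rewrite -(ler_pM2r e0).
rewrite distrC; apply: le_trans h1.
apply: (@le_trans _ _ (seq_norm e [:: incr f (x, y)])).
  by rewrite /seq_norm /comb_norm big_ord1 /= normrZ.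
apply: (seq_norm_subseq he); rewrite -[[:: _]]/(map (incr f) [:: (x, y)]).
apply: map_subseq; rewrite sub1seq mem_filter /= !inE eqxx orbT andbT.
exact: d.
Qed.

(** The absolute increments along a partition telescope to [f one01], and uniform continuity makes
    each of them small on a fine partition. By [comb_norm_small], where the o(n) growth of the
    fundamental function enters, a vector with bounded l_1 norm and small entries has small norm. *)
Lemma monotone_VX0 (hX : reflexive_space X) f : f (@zero01 R) = 0 ->
  (forall x y, le01 x y -> f x <= f y) ->
  (forall eps : R, 0 < eps -> exists2 eta : R, 0 < eta &
    forall x y, le01 x y -> \val y - \val x <= eta -> f y - f x <= eps) ->
  VX0 e f.
Proof.
move=> f0 fm fc.
have tele x l : path lt01 x l ->
    \sum_(i < size l) `|nth 0 [seq incr f p | p <- cells x l] i| = f (last x l) - f x.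
  elim: l x => [|y l IH] x /=; first by rewrite big_ord0 subrr.
  move=> /andP[/ltW xy yl]; rewrite big_ord_recl /= IH// ger0_norm ?subr_ge0 ?fm//.
  by rewrite addrC addrA subrK.
have f1 : 0 <= f one01 by rewrite -f0; apply: fm; exact: I01_ge0.
have sum s : partition01 s ->
    \sum_(i < size s) `|nth 0 [seq incr f p | p <- cells (@zero01 R) s] i| <= f one01.
  by move=> /partition01P[ps ls]; rewrite tele// ls f0 subr0.
apply/VX0P; split.
  apply/VXP; split=> //; exists (f one01 * `|e 0%N|) => s ps.
  rewrite alphaE /seq_norm size_map size_pairmap; apply: le_trans (comb_norm_l1 he _ _) _.
  by rewrite ler_wpM2r// sum.
move=> eps eps0; have [d d0 hd] := comb_norm_small he hX f1 eps0.
have [eta eta0 heta] := fc d d0; exists eta => // s ps ms.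
rewrite alphaE /seq_norm size_map size_pairmap; apply: hd; first exact: sum.
move=> i si; rewrite (nth_map (@zero01 R, @zero01 R)) ?size_pairmap//.
move: ms => /(meshP _ (ltW eta0)) /(all_nthP (@zero01 R, @zero01 R))/(_ i).
rewrite size_pairmap => /(_ si); set p := nth _ _ i => lp.
have p12 : le01 p.1 p.2.
  rewrite /p (nth_pairmap (@zero01 R))//=.
  have /partition01P[/(pathP (@zero01 R))/(_ i si) + _] := ps; exact: ltW.
by rewrite ger0_norm ?subr_ge0 ?fm//; exact: heta.
Qed.

Lemma comp_VX0 f (psi : R -> R) (k : I01 R -> I01 R) : VX0 e f ->
  psi (f (k (@zero01 R))) = 0 ->
  (forall a b, `|psi a - psi b| <= `|a - b|) ->
  (forall x y, le01 x y -> le01 (k x) (k y) /\ \val (k y) - \val (k x) <= \val y - \val x) ->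
  VX0 e (psi \o f \o k).
Proof.
move=> /VX0P[/VXP[f0 [M hM]] hf] p0 psil kl; apply/VX0P; split.
  apply/VXP; split=> //; exists M => s ps.
  apply: (@comp_alpha_le f psi k 1 M) => //; first by move=> s' ps' _; exact: hM.
  apply/meshP => //; apply/allP => p _; rewrite /len.
  by have := I01_le1 p.2; have := I01_ge0 p.1; lra.
move=> eps eps0; have [eta eta0 heta] := hf eps eps0; exists eta => // s.
exact: (@comp_alpha_le f psi k).
Qed.

Lemma comp_VX_norm f (psi : R -> R) (k : I01 R -> I01 R) s : VX e f ->
  (forall a b, `|psi a - psi b| <= `|a - b|) ->
  (forall x y, le01 x y -> le01 (k x) (k y)) ->
  path le01 (@zero01 R) s -> alpha e (psi \o f \o k) s <= fine (VX_norm e f).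
Proof.
move=> fV psil kl ps; rewrite alphaE.
apply: (@le_trans _ _ (seq_norm e [seq incr f (k p.1, k p.2) | p <- cells (@zero01 R) s])).
  by apply: (seq_norm_map_le he) => p; exact: psil.
have p0 : path le01 (@zero01 R) (k (@zero01 R) :: map k s).
  rewrite /= /le01 I01_ge0/= path_map; apply: sub_path ps => a b /=; exact: kl.
apply: le_trans (path_incr_VX fV p0); apply: (seq_norm_subseq he).
have kE x l : cells (k x) (map k l) = [seq (k p.1, k p.2) | p <- cells x l].
  by elim: l x => //= y l IH x; rewrite -/(cells (k y) _) IH.
rewrite (map_comp (incr f) (fun p => (k p.1, k p.2))) -kE.
apply: map_subseq; rewrite [X in subseq _ X]/= -/(cells _ _); exact: subseq_cons.
Qed.

End Increments.

(** * Bounded pointwise null sequences are weakly null *)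

Section Simons.
Context {R : realType} {V : normedModType R} (U : set_system nat).
Context {UU : UltraFilter U}.
Hypothesis oU : \oo `<=` U.

Lemma ulim_bound (u : nat -> R) M a b : (forall i, `|u i| <= M) ->
  (\forall N \near U, a <= u N <= b) -> a <= ulim U u <= b.
Proof.
move=> uM ab; have c := ulimP uM; apply/andP; split.
  by apply: limr_ge; [apply/cvg_ex; eexists; exact: c|near=> N; have /andP[] : a <= u N <= b by near: N].
by apply: limr_le; [apply/cvg_ex; eexists; exact: c|near=> N; have /andP[] : a <= u N <= b by near: N].
Unshelve. all: by end_near. Qed.

Lemma ulimD (u v : nat -> R) M M' : (forall i, `|u i| <= M) -> (forall i, `|v i| <= M') ->
  ulim U (fun i => u i + v i) = ulim U u + ulim U v.
Proof.
move=> uM vM; apply/cvg_lim => //; apply: cvgD.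
- exact: (@ulimP _ _ U UU _ _ uM).
- exact: (@ulimP _ _ U UU _ _ vM).
Qed.

Lemma ulimZ k (u : nat -> R) M : (forall i, `|u i| <= M) ->
  ulim U (fun i => k * u i) = k * ulim U u.
Proof.
move=> uM; apply/cvg_lim => //; apply: cvgM; first exact: cvg_cst.
exact: (@ulimP _ _ U UU _ _ uM).
Qed.

Variables (C : nat -> set V) (M m : R) (B : set (dual V)).
Hypothesis m0 : 0 < m.
Hypothesis C_mid : forall n x y, C n x -> C n y -> C n (2^-1 *: (x + y)).
Hypothesis C_dec : forall n, C n.+1 `<=` C n.
Hypothesis C_ne : forall n, C n !=set0.
Hypothesis C_bd : forall n y, C n y -> `|y| <= M.
Hypothesis C_low : forall y, C 0%N y -> m <= `|y|.
Hypothesis B_norm : forall b, B b -> forall x, `|b x| <= `|x|.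
Hypothesis B_norming : forall (x : V) (eps : R), 0 < eps -> exists2 b, B b & `|x| - eps <= b x.

(* Simons' argument: choosing y_n in C_n so that v_n + 2 * 2^-n y_n almost has
   minimal norm, where v_n = sum_(k < n) 2^-k y_k, forces any limit b of
   functionals norming these vectors to satisfy
   b(y_n) <= (average of b(y_k), k >= n) + small. *)
Lemma simons_sequence : exists (b : nat -> dual V) (y : nat -> V),
  [/\ forall n, B (b n), forall n, C n (y n) &
    ~ (ulim U (fun N => b N (y n)) @[n --> \oo] --> (0 : R))].
Proof.
pose t : R := 2^-1; have t0 : 0 < t by rewrite invr_gt0.
have tt : t + t = 1 by rewrite /t; lra.
(* This is exactly the loss that the induction [rlow] tolerates: with r_n = L - VV n, [key] gives
   r_(n+1) >= (r_n - eps n)/2, and the extra term m 4^-n in the lower bound for r_n pays for it. *)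
pose eps n : R := m * t * (t ^+ n * t ^+ n).
have tn0 n : 0 < t ^+ n by rewrite exprn_gt0.
have eps0 n : 0 < eps n by rewrite !mulr_gt0.
have pick n v : {y | C n y /\ forall z, C n z ->
    `|v + (2 * t ^+ n) *: y| <= `|v + (2 * t ^+ n) *: z| + eps n}.
  apply: cid; pose S := [set `|v + (2 * t ^+ n) *: z| | z in C n].
  have hS : has_inf S.
    split; first by have [z Cz] := C_ne n; exists `|v + (2 * t ^+ n) *: z|, z.
    by exists 0 => _ [z _ <-].
  have [_ [y Cy <-] hy] := inf_adherent (eps0 n) hS.
  exists y; split=> // z Cz; apply: (le_trans (ltW hy)); rewrite lerD2r.
  by apply: ge_inf; [exact: hS.2|exists z].
pose v := fix v n := if n is n'.+1 then v n' + t ^+ n' *: sval (pick n' (v n')) else 0.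
pose y n := sval (pick n (v n)).
have yC n : C n (y n) by have [] := svalP (pick n (v n)).
have ymin n z : C n z ->
    `|v n + (2 * t ^+ n) *: y n| <= `|v n + (2 * t ^+ n) *: z| + eps n.
  by have [_] := svalP (pick n (v n)); exact.
have vS n : v n.+1 = v n + t ^+ n *: y n by [].
pose w n := v n + (2 * t ^+ n) *: y n.
(* Since t^n y + 2 t^(n+1) z is 2 t^n times the midpoint of y and z, every later [w N] has the form
   v_n + 2 t^n z' with z' in [C n]: it competes in the minimization made at stage n. *)
have back n j z : C (n + j)%N z -> exists2 z', C n z' &
    v (n + j)%N + (2 * t ^+ (n + j)) *: z = v n + (2 * t ^+ n) *: z'.
  elim: j z => [|j IH] z; first by rewrite addn0; exists z.
  rewrite addnS => Cz; have [z' Cz' h] := IH (t *: (y (n + j)%N + z)) (C_mid (yC _) (C_dec Cz)).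
  exists z' => //; rewrite -h vS -addrA; congr (_ + _).
  rewrite scalerA scalerDr exprS mulrA /t divff ?mul1r//.
  by rewrite mulrAC divff// mul1r.
have wback n j : exists2 z, C n z & w (n + j)%N = v n + (2 * t ^+ n) *: z.
  exact: back (yC _).
have w0 N : exists2 z, C 0%N z & w N = 2 *: z.
  have [z Cz] := wback 0%N N; rewrite add0n expr0 mulr1 => ->.
  by exists z; rewrite ?add0r.
have wM N : `|w N| <= 2 * M.
  have [z Cz ->] := w0 N; rewrite normrZ ger0_norm//.
  by rewrite ler_pM2l//; exact: C_bd Cz.
have wm N : 2 * m <= `|w N|.
  have [z Cz ->] := w0 N; rewrite normrZ ger0_norm//.
  by rewrite ler_pM2l//; exact: C_low.
have bex N : {b | B b /\ `|w N| - t ^+ N <= b (w N)}.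
  by apply: cid; have [b Bb hb] := B_norming (w N) (tn0 N); exists b.
pose b N := sval (bex N).
have bB N : B (b N) by have [] := svalP (bex N).
have bw N : `|w N| - t ^+ N <= b N (w N) by have [] := svalP (bex N).
exists b, y; split=> // beta0.
have by_bd x N : `|b N x| <= `|x| by exact: B_norm.
have bwM N : `|b N (w N)| <= 2 * M by apply: le_trans (wM N); exact: B_norm.
pose beta n := ulim U (fun N => b N (y n)).
pose L := ulim U (fun N => b N (w N)).
pose VV n := ulim U (fun N => b N (v n)).
have VVS n : VV n.+1 = VV n + t ^+ n * beta n.
  rewrite /VV /beta -(ulimZ (t ^+ n) (by_bd (y n))).
  rewrite -(ulimD (by_bd (v n)) (M' := `|t ^+ n *: y n|)).
    by congr (ulim U); apply/funext => N; rewrite vS dualD dualZ.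
  by move=> N; rewrite -dualZ.
have VV0 : VV 0%N = 0.
  by apply/cvg_lim => //; apply: cvg_near_cst; near=> N; rewrite dual0.
have tsmall e : 0 < e -> \forall N \near U, t ^+ N <= e.
  move=> e0; apply: oU.
  have : t ^+ N @[N --> \oo] --> (0 : R).
    by apply: cvg_expr; rewrite gtr0_norm// /t invf_lt1// ltr1n.
  move=> /cvgr0Pnorm_le/(_ e e0); apply: filterS => N.
  by rewrite ger0_norm// ltW.
have Lm : 2 * m <= L.
  apply/ler_addgt0Pr => e e0; rewrite -lerBlDr.
  suff /andP[] : 2 * m - e <= L <= 2 * M by [].
  apply: (ulim_bound bwM).
  near=> N; apply/andP; split; last by apply: le_trans (bwM N); exact: ler_norm.
  apply: le_trans (bw N); apply: lerB => //.
  by near: N; exact: tsmall.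
have r_small n : `|L - VV n| <= 2 * t ^+ n * M.
  have -> : L - VV n = ulim U (fun N => b N (w N) + -1 * b N (v n)).
    rewrite (ulimD bwM (M' := `|v n|)); last by move=> N; rewrite mulN1r normrN.
    by rewrite (ulimZ (-1) (by_bd (v n))) mulN1r.
  rewrite ler_norml; apply: (@ulim_bound _ (2 * M + `|v n|)).
    move=> N; apply: le_trans (ler_normD _ _) _; apply: lerD => //.
    by rewrite mulN1r normrN.
  near=> N; rewrite mulN1r -dualB -ler_norml; apply: le_trans (B_norm (bB N) _) _.
  have nN : (n <= N)%N by near: N; apply: oU; exact: nbhs_infty_ge.
  have [z Cz] := wback n (N - n)%N; rewrite subnKC// => ->.
  rewrite addrC addKr normrZ ger0_norm; last by rewrite mulr_ge0// ltW.
  by rewrite ler_wpM2l ?mulr_ge0 ?(ltW (tn0 n))//; exact: C_bd Cz.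
(* For N >= n, near-minimality gives |w_n| <= |w_N| + eps n, while b_N almost norms w_N; hence b_N
   (w_n) <= b_N (w_N) + eps n + t^N. *)
have key n : VV n + 2 * t ^+ n * beta n <= L + eps n.
  have -> : VV n + 2 * t ^+ n * beta n = ulim U (fun N => b N (w n)).
    rewrite /beta -(ulimZ _ (by_bd (y n))).
    rewrite -(ulimD (by_bd (v n)) (M' := `|(2 * t ^+ n) *: y n|)).
      by congr (ulim U); apply/funext => N; rewrite dualD dualZ.
    by move=> N; rewrite -dualZ.
  have bn1 N : `|b N (w n)| <= 2 * M by apply: le_trans (wM n); exact: B_norm.
  suff : ulim U (fun N => b N (w n) + -1 * b N (w N)) <= eps n.
    rewrite (ulimD bn1 (M' := 2 * M)); last by move=> N; rewrite mulN1r normrN.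
    by rewrite (ulimZ (-1) bwM) -/L; lra.
  apply/ler_addgt0Pr => e e0.
  suff /andP[] : - (2 * M + 2 * M) <= ulim U (fun N => b N (w n) + -1 * b N (w N))
    <= eps n + e by [].
  apply: (@ulim_bound _ (2 * M + 2 * M)).
    move=> N; apply: le_trans (ler_normD _ _) _; apply: lerD => //.
    by rewrite mulN1r normrN.
  near=> N; apply/andP; split.
    have := bn1 N; have := bwM N; rewrite !ler_norml => /andP[? ?] /andP[? ?]; lra.
  have nN : (n <= N)%N by near: N; apply: oU; exact: nbhs_infty_ge.
  have h1 : t ^+ N <= e by near: N; exact: tsmall.
  have h2 := bw N; have h3 : `|w n| <= `|w N| + eps n.
    by have [z Cz] := wback n (N - n)%N; rewrite subnKC// => ->; exact: ymin.
  have h4 := le_trans (ler_norm _) (B_norm (bB N) (w n)).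
  lra.
have rlow n : (m + m * t ^+ n) * t ^+ n <= L - VV n.
  elim: n => [|n IH]; first by rewrite VV0 expr0 !mulr1 subr0; lra.
  rewrite VVS exprS; have := key n; rewrite /eps.
  have := IH; set T := t ^+ n; set r := VV n; set be := beta n => h1 h2.
  have tE : t = 2^-1 by [].
  have : 2 * ((m + m * (t * T)) * (t * T)) <= 2 * (L - (r + T * be)).
    have -> : 2 * ((m + m * (t * T)) * (t * T)) = (m + m * T) * T - m * t * (T * T).
      by rewrite tE; field.
    lra.
  by rewrite ler_pM2l.
have /cvgr0Pnorm_le/(_ (m / 4)) := beta0; rewrite divr_gt0// => /(_ isT)[n _ hn].
(* If beta_k <= m/4 from n on, the geometric sum gives r_n <= r_(n+j) + (m/2)(2^-n - 2^-(n+j)). For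
   large j also r_(n+j) < (m/2) 2^-n, so r_n < m 2^-n, against [rlow]. *)
have rup j : L - VV n <= L - VV (n + j)%N + m * t * (t ^+ n - t ^+ (n + j)).
  elim: j => [|j IH]; first by rewrite addn0 subrr mulr0 addr0.
  apply: (le_trans IH); rewrite addnS VVS exprS.
  have : `|beta (n + j)%N| <= m / 4 by apply: hn; exact: leq_addr.
  rewrite ler_norml => /andP[_ h].
  have := ler_wpM2l (ltW (tn0 (n + j)%N)) h.
  by rewrite /t; set T := (2^-1 : R) ^+ (n + j); lra.
have [j hj] : exists j, 2 * t ^+ (n + j) * M < m * t * t ^+ n.
  have := cvg_expr (_ : `|t| < 1); rewrite gtr0_norm// {1}/t invf_lt1// ltr1n => /(_ isT).
  have M0 : 0 <= M by have [z Cz] := C_ne 0; exact: le_trans (C_bd Cz).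
  have e0 : 0 < m * t / (2 * (M + 1)) by rewrite !mulr_gt0// invr_gt0 mulr_gt0// ltr_wpDl.
  move=> /cvgr0Pnorm_le/(_ _ e0)[j _ /(_ j (leqnn j))] /=.
  rewrite ger0_norm ?(ltW (tn0 j))// ler_pdivlMr; last by rewrite mulr_gt0// ltr_wpDl.
  move=> h; exists j; rewrite exprD.
  have := tn0 n; have := tn0 j; set T := t ^+ n; set S := t ^+ j in h * => S0 T0.
  have h' : 2 * (S * M) < m * t by lra.
  by rewrite -(ltr_pM2l T0) in h'; lra.
have fin (T T' M' r r' : R) : 0 < T -> 0 < T' -> (m + m * T) * T <= r ->
    r <= r' + m * 2^-1 * (T - T') -> r' <= M' -> M' < m * 2^-1 * T -> False.
  move=> T0 T'0; have := mulr_gt0 m0 (mulr_gt0 T0 T0); have := mulr_gt0 m0 T'0.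
  lra.
apply: (fin _ _ _ _ _ (tn0 n) (tn0 (n + j)%N) (rlow n) (rup j) _ hj).
by apply: le_trans (r_small (n + j)%N); exact: ler_norm.
Unshelve. all: by end_near. Qed.

End Simons.

Lemma I01_ulim {R : realType} (U : set_system nat) (UU : UltraFilter U) (t : nat -> I01 R) :
  exists t0 : I01 R, \val (t N) @[N --> U] --> \val t0.
Proof.
have tb N : `|\val (t N)| <= 1 by rewrite ger0_norm ?I01_ge0 ?I01_le1.
have c := @ulimP _ _ U UU _ _ tb.
have [t0 t0E] : exists t0 : I01 R, \val t0 = ulim U (fun N => \val (t N)).
  apply: I01_ex.
    by apply: (cvgr_to_ge c); apply: (@filterS _ U _ setT) => [N _|]; [exact: I01_ge0|exact: filterT].
  by apply: (cvgr_to_le c); apply: (@filterS _ U _ setT) => [N _|]; [exact: I01_le1|exact: filterT].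
by exists t0; rewrite t0E.
Qed.

(** * Functionals given by partitions, and their ultralimits *)

Section VariationFunctionals.
Context {R : realType} {X : normedModType R} {e : nat -> X}.
Variable he : symmetric_basis e.
Hypothesis hX : reflexive_space X.
Local Notation V := (VX0_space he).
Implicit Types (s : seq (I01 R)) (p : seq (I01 R * I01 R)).

(** A degenerate cell as default: positions past the end of a list contribute increment 0, so
    [psum f p m] is meaningful for every m. *)
Definition pair0 : I01 R * I01 R := (@zero01 R, @zero01 R).
Definition longer (a b : I01 R * I01 R) := len b <= len a.
Definition psum (f : I01 R -> R) p m : X := \sum_(i < m) incr f (nth pair0 p i) *: e i.

Lemma incr_pair0 (f : I01 R -> R) : incr f pair0 = 0.
Proof. by rewrite /incr subrr. Qed.

Lemma sum_len (x : I01 R) l : \sum_(q <- cells x l) len q = \val (last x l) - \val x.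
Proof.
elim: l x => [|y l IH] x /=; first by rewrite big_nil subrr.
by rewrite big_cons -/(cells y l) IH /len /= addrC addrA subrK.
Qed.

Lemma len_ge0 (x : I01 R) l : path (@le01 R) x l -> all (fun q => 0 <= len q) (cells x l).
Proof.
elim: l x => //= y l IH x /andP[xy yl]; rewrite -/(cells y l) IH// andbT.
by rewrite subr_ge0.
Qed.

Lemma partition_le s : partition01 s -> path (@le01 R) (@zero01 R) s.
Proof. by move=> /partition01P[+ _]; apply: sub_path => a b; exact: ltW. Qed.

(** The first i + 1 cells are at least as long as the i-th one, and all lengths together add up to
    1. *)
Lemma len_nth s p i : partition01 s -> perm_eq p (cells (@zero01 R) s) ->
  sorted longer p -> (i < size p)%N -> i.+1%:R * len (nth pair0 p i) <= 1.
Proof.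
move=> ps pp sp ip; have /partition01P[_ ls] := ps.
have pos : all (fun q => 0 <= len q) p.
  by rewrite (perm_all _ pp); exact/len_ge0/partition_le.
have s1 : \sum_(q <- p) len q = 1.
  by rewrite (perm_big _ pp) /= sum_len ls subr0.
apply: (@le_trans _ _ (\sum_(q <- p) len q)); last by rewrite s1.
rewrite -{2}(cat_take_drop i.+1 p) big_cat /= ler_wpDr//.
  rewrite big_seq; apply: sumr_ge0 => q /mem_drop; exact: (allP pos).
rewrite (big_nth pair0) size_takel// mulr_natl -[X in _ *+ X](subn0 i.+1).
rewrite -sumr_const_nat; apply: ler_sum_nat => j /andP[_ ji].
rewrite nth_take//.
have tr : transitive longer by move=> b a c /= h h'; exact: le_trans h' h.
have re : reflexive longer by move=> a; exact: lexx.
apply: (sorted_leq_nth tr re pair0 sp) => //.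
by rewrite inE; exact: leq_trans ji ip.
Qed.

Lemma norm_psum (f : I01 R -> R) p : `|psum f p (size p)| = seq_norm e [seq incr f q | q <- p].
Proof.
rewrite /seq_norm /comb_norm size_map; congr (`|_|); apply: eq_bigr => i _.
by rewrite (nth_map pair0).
Qed.

Lemma norm_psum_partition (f : I01 R -> R) s p : perm_eq p (cells (@zero01 R) s) ->
  `|psum f p (size p)| = alpha e f s.
Proof. by move=> pp; rewrite norm_psum alphaE; apply: (seq_norm_perm he); exact: perm_map. Qed.

Lemma psum_widen f p m : (size p <= m)%N -> psum f p m = psum f p (size p).
Proof.
move=> pm; rewrite /psum -!(big_mkord xpredT (fun i => incr f (nth pair0 p i) *: e i)).
rewrite (big_cat_nat _ pm)//= [X in _ + X]big1_seq ?addr0// => i.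
rewrite mem_index_iota => /andP[_ /andP[pi _]].
by rewrite nth_default// incr_pair0 scale0r.
Qed.

Lemma psum_le (f : I01 R -> R) p m : `|psum f p m| <= `|psum f p (size p)|.
Proof.
have [pm|pm] := leqP (size p) m; first by rewrite (psum_widen _ pm).
exact: (@comb_norm_leq _ _ _ he m (size p) (fun i => incr f (nth pair0 p i)) (ltnW pm)).
Qed.

(** From position m on, the sorted cells are no longer than 1/(m + 1), hence short in the sense of
    [eta]. The bound depends on m and not on the partition. *)
Lemma psum_tail (f : I01 R -> R) s p m (eta M : R) : 0 < eta -> 0 <= M ->
  (forall s, partition01 s -> mesh s <= eta -> alpha e f s <= M) ->
  partition01 s -> perm_eq p (cells (@zero01 R) s) -> sorted longer p ->
  1 <= m.+1%:R * eta -> `|psum f p (size p) - psum f p m| <= M.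
Proof.
move=> eta0 M0 hM ps pp sp meta.
have [pm|pm] := leqP (size p) m; first by rewrite (psum_widen _ pm) subrr normr0.
have short : all (fun q => len q <= eta) (drop m p).
  apply/(all_nthP pair0) => i; rewrite size_drop ltn_subRL => ip.
  rewrite nth_drop; have := len_nth ps pp sp ip.
  have [|h h1] := leP (len (nth pair0 p (m + i))) eta => //.
  suff : (1 : R) < 1 by rewrite ltxx.
  apply: le_lt_trans meta _; apply: lt_le_trans h1.
  apply: (@lt_le_trans _ _ (m.+1%:R * len (nth pair0 p (m + i)))).
    by rewrite ltr_pM2l.
  by apply: ler_wpM2r; [rewrite ltW// (lt_trans eta0)|rewrite ler_nat ltnS leq_addr].
have := path_incr_le he eta0 hM (partition_le ps).
apply: le_trans; rewrite -(seq_norm_perm he (perm_map _ (perm_filter _ pp))).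
apply: (@le_trans _ _ (seq_norm e [seq incr f q | q <- drop m p])); last first.
  apply: (seq_norm_subseq he); apply: map_subseq.
  rewrite -{2}(cat_take_drop m p) filter_cat (all_filterP short).
  exact: suffix_subseq.
(* Padding by zeros keeps the remaining increments at their positions; the zeros do not affect the
   norm. *)
pose c := nseq m 0 ++ [seq incr f q | q <- drop m p].
have -> : psum f p (size p) - psum f p m = \sum_(i < size c) nth 0 c i *: e i.
  rewrite size_cat size_nseq size_map size_drop subnKC ?(ltnW pm)//.
  rewrite /psum -!(big_mkord xpredT (fun i => incr f (nth pair0 p i) *: e i)).
  rewrite -(big_mkord xpredT (fun i => nth 0 c i *: e i)).
  rewrite !(big_cat_nat (leq0n m) (ltnW pm))/= addrAC subrr add0r.
  rewrite [X in _ = X + _]big1_seq ?add0r; last first.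
    move=> i; rewrite mem_index_iota => /andP[_ /andP[_ im]].
    by rewrite nth_cat size_nseq im nth_nseq im scale0r.
  apply: eq_big_nat => i /andP[mi ip].
  rewrite nth_cat size_nseq ltnNge mi /= (nth_map pair0) ?size_drop ?ltn_sub2r//.
  by rewrite nth_drop subnKC.
rewrite -/(comb_norm e (size c) (nth 0 c)) -/(seq_norm e c) -(seq_norm_nz he).
rewrite filter_cat (_ : [seq x <- nseq m 0 | x != 0] = [::]).
  exact: (seq_norm_filter he).
by apply/eqP; rewrite -[_ == _]negbK -has_filter -all_predC; apply/allP => x /nseqP[-> _] /=; rewrite eqxx.
Qed.

(** A functional of norm at most 1 on X applied to the increments along one partition. These serve
    as the norming set [B] in Simons' argument. *)
Definition variation_functional (b : dual V) := exists s p (phi : dual X),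
  [/\ partition01 s, perm_eq p (cells (@zero01 R) s), sorted longer p,
    forall x, `|phi x| <= `|x| & forall g : V, b g = phi (psum g p (size p))].

Lemma V_alpha_le (g : V) s : partition01 s -> alpha e g s <= `|g|.
Proof. by move=> ps; apply: VX_alpha_le => //; exact: VX0_funVX. Qed.

Lemma psumD (f g : V) p m : psum (f + g : V) p m = psum f p m + psum g p m.
Proof.
rewrite -big_split; apply: eq_bigr => i _ /=; rewrite -scalerDl; congr (_ *: _).
set q := nth _ _ _; rewrite -[LHS]/((f q.2 + g q.2) - (f q.1 + g q.1)).
by rewrite opprD addrACA.
Qed.

Lemma psumZ k (f : V) p m : psum (k *: f : V) p m = k *: psum f p m.
Proof.
rewrite scaler_sumr; apply: eq_bigr => i _ /=; rewrite scalerA; congr (_ *: _).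
by set q := nth _ _ _; rewrite -[LHS]/(k * f q.2 - k * f q.1) -mulrBr.
Qed.

Lemma variation_functional_le b : variation_functional b -> forall g, `|b g| <= `|g|.
Proof.
move=> [s [p [phi [ps pp sp phi1 bE]]]] g; rewrite bE; apply: le_trans (phi1 _) _.
by rewrite (norm_psum_partition _ pp); exact: V_alpha_le.
Qed.

Lemma variation_functional_norming (g : V) (eps : R) : 0 < eps ->
  exists2 b, variation_functional b & `|g| - eps <= b g.
Proof.
move=> eps0; have [s ps hs] : exists2 s, partition01 s & `|g| - eps <= alpha e g s.
  apply: contrapT => h; have : `|g| <= `|g| - eps.
    apply: VX_fine_norm_ge => s ps; rewrite leNgt; apply/negP => /ltW hs.
    by apply: h; exists s.
  by rewrite leNgt ltrBlDr ltrDl eps0.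
pose p := sort longer (cells (@zero01 R) s).
have pp : perm_eq p (cells (@zero01 R) s) by rewrite perm_sort.
have sp : sorted longer p by apply: sort_sorted => a b; exact: le_total.
have [phi [phi1 phig]] := norming_functional (psum g p (size p)).
have [|||b bE] := @dual_ex R V (fun f : V => phi (psum f p (size p))) 1.
- by move=> f h; rewrite psumD dualD.
- by move=> k f; rewrite psumZ dualZ.
- move=> f; rewrite mul1r; apply: le_trans (phi1 _) _.
  by rewrite (norm_psum_partition _ pp); exact: V_alpha_le.
exists b; first by exists s, p, phi.
by rewrite bE phig (norm_psum_partition _ pp).
Qed.

(* Each partition is stored with its intervals sorted by decreasing length, so
   that the i-th interval has length at most 1/(i+1): an ultralimit of variation
   functionals is again given by a sequence of intervals (A_i, B_i) and an
   element xi of the dual of X. *)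
Lemma ulim_variation_functional (U : set_system nat) (UU : UltraFilter U)
    (b : nat -> dual V) : (forall N, variation_functional (b N)) ->
  exists (z : nat -> I01 R * I01 R) (xi : dual X), forall g : V,
    (forall m, `|\sum_(i < m) incr g (z i) *: e i| <= `|g|) /\
    (forall eps : R, 0 < eps -> exists m,
      `|ulim U (fun N => b N g) - xi (\sum_(i < m) incr g (z i) *: e i)| <= eps).
Proof.
move=> bv.
have [s [p [phi bP]]] : exists (s : nat -> seq (I01 R)) (p : nat -> seq (I01 R * I01 R))
    (phi : nat -> dual X), forall N, [/\ partition01 (s N),
      perm_eq (p N) (cells (@zero01 R) (s N)), sorted longer (p N),
      forall x, `|phi N x| <= `|x| & forall g : V, b N g = phi N (psum g (p N) (size (p N)))].
  pose s N := sval (cid (bv N)); pose p N := sval (cid (svalP (cid (bv N)))).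
  pose phi N := sval (cid (svalP (cid (svalP (cid (bv N)))))).
  by exists s, p, phi => N; exact: (svalP (cid (svalP (cid (svalP (cid (bv N))))))).
pose A i := sval (cid (I01_ulim UU (fun N => (nth pair0 (p N) i).1))).
pose B i := sval (cid (I01_ulim UU (fun N => (nth pair0 (p N) i).2))).
have AP i : \val (nth pair0 (p N) i).1 @[N --> U] --> \val (A i).
  exact: (svalP (cid (I01_ulim UU (fun N => (nth pair0 (p N) i).1)))).
have BP i : \val (nth pair0 (p N) i).2 @[N --> U] --> \val (B i).
  exact: (svalP (cid (I01_ulim UU (fun N => (nth pair0 (p N) i).2)))).
have phib x N : `|phi N x| <= `|x| by have [_ _ _ + _] := bP N; exact.
have [|||xi xiE] := @dual_ex R X (fun x => ulim U (fun N => phi N x)) 1.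
- move=> x y; rewrite -(ulimD (phib x) (phib y)); congr (ulim U).
  by apply/funext => N; rewrite dualD.
- move=> k x; rewrite -(ulimZ k (phib x)); congr (ulim U).
  by apply/funext => N; rewrite dualZ.
- by move=> x; rewrite mul1r; exact: ulim_norm_le.
exists (fun i => (A i, B i)), xi => g.
have gcont (t : nat -> I01 R) t0 : \val (t N) @[N --> U] --> \val t0 ->
    g (t N) @[N --> U] --> g t0.
  move=> tc; apply/cvgrPdist_le => eps eps0.
  have gV : VX0 e g by have /asboolP := VX0_funP g.
  have [eta eta0 heta] := VX0_unif_continuous he gV eps0.
  by move/cvgrPdist_le: tc => /(_ _ eta0); apply: filterS => N; exact: heta.
have icont i : incr g (nth pair0 (p N) i) @[N --> U] --> incr g (A i, B i).
  by apply: cvgB; apply: gcont.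
(* Used twice: with a fixed norming functional, to bound the partial sums, and with [phi N], to
   identify the limit through [xi]. *)
have scont m (psi : nat -> dual X) (c : nat -> R) :
    (forall i, psi N (e i) @[N --> U] --> c i) ->
    psi N (psum g (p N) m) @[N --> U] --> \sum_(i < m) incr g (A i, B i) * c i.
  move=> psic.
  rewrite (_ : (fun N => _) = (fun N => \sum_(i < m) incr g (nth pair0 (p N) i) * psi N (e i))).
    elim: m => [|m IH].
      rewrite big_ord0 (_ : (fun N => _) = cst 0); first exact: cvg_cst.
      by apply/funext => N; rewrite big_ord0.
    rewrite big_ord_recr /= (_ : (fun N => _) = (fun N =>
      \sum_(i < m) incr g (nth pair0 (p N) i) * psi N (e i) +
      incr g (nth pair0 (p N) m) * psi N (e m))).
      by apply: cvgD IH _; apply: cvgM; [exact: icont|exact: psic].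
    by apply/funext => N; rewrite big_ord_recr.
  by apply/funext => N; rewrite /psum dual_sum; apply: eq_bigr => i _; rewrite dualZ.
have psN m N : `|psum g (p N) m| <= `|g|.
  have [ps pp _ _ _] := bP N.
  by apply: le_trans (psum_le _ _ _) _; rewrite (norm_psum_partition _ pp) V_alpha_le.
split=> [m|eps eps0].
  have [psi [psi1 psix]] := norming_functional (\sum_(i < m) incr g (A i, B i) *: e i).
  rewrite -psix dual_sum; under eq_bigr do rewrite dualZ.
  apply: (cvgr_to_le (scont m (fun=> psi) _ (fun i => cvg_cst _))).
  apply: (@filterS _ U _ setT) => [N _|]; last exact: filterT.
  by apply: le_trans (ler_norm _) _; apply: le_trans (psi1 _) _.
have gV : VX0 e g by have /asboolP := VX0_funP g.
have /VX0P[_ /(_ _ eps0)[eta eta0 heta]] := gV.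
(* As m + 1 exceeds 1/eta, [psum_tail] applies to all N at once, so cutting at m costs at most eps
   in the ultralimit too. *)
pose m := Num.truncn eta^-1; exists m.
have meta : 1 <= m.+1%:R * eta.
  by rewrite -ler_pdivrMr// mul1r ltW// truncnS_gt.
rewrite dual_sum; under eq_bigr do rewrite dualZ.
have c1 := scont m phi (fun i => xi (e i)).
have {}c1 : phi N (psum g (p N) m) @[N --> U] --> \sum_(i < m) incr g (A i, B i) * xi (e i).
  by apply: c1 => i; rewrite xiE; exact: (@ulimP _ _ U UU _ _ (phib (e i))).
have bg N : `|b N g| <= `|g| by exact: variation_functional_le.
have c2 := @ulimP _ _ U UU _ _ bg.
have c3 : `|b N g - phi N (psum g (p N) m)| @[N --> U] -->
    `|ulim U (fun N => b N g) - \sum_(i < m) incr g (A i, B i) * xi (e i)|.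
  by apply: cvg_norm; apply: cvgB.
apply: (cvgr_to_le c3); apply: (@filterS _ U _ setT) => [N _|]; last exact: filterT.
have [ps pp sp _ bE] := bP N.
rewrite /= bE -dualB; apply: le_trans (phib _ _) _.
exact: (psum_tail eta0 (ltW eps0) heta ps pp sp meta).
Qed.

(** The smallest set closed under midpoints that contains the tail of g. A property stable under
    midpoints passes from the tail to the hull by instantiating [P]. *)
Definition midpoint_hull (g : nat -> V) n : set V := [set y | forall P : set V,
  (forall k, (n <= k)%N -> P (g k)) ->
  (forall x y, P x -> P y -> P (2^-1 *: (x + y))) -> P y].

(** If [phi >= eps] on the sequence, then also on its midpoint hulls, which therefore stay away from
    0, and Simons' argument yields y_n in the hulls whose ultralimit values do not tend to 0. Up to
    1/(n + 1) these values are [xi] at bounded vectors of X; the coordinates of these vectors are 0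
    or increments of y_n over fixed intervals, hence tend to 0. By [weakly_null] the values tend to
    0 after all. *)
Lemma pointwise_null_weakly_null (g : nat -> V) (M eps : R) (phi : dual V) :
  (forall n, `|g n| <= M) -> (forall t, g n t @[n --> \oo] --> (0 : R)) ->
  0 < eps -> ~ (forall n, eps <= phi (g n)).
Proof.
move=> gM g0 eps0 phig.
have [U [UU oU]] := ultraFilterLemma (@eventually_filter).
have h2 (r : R) x : `|2^-1 * x : R| <= r <-> `|x| <= 2 * r.
  by rewrite normrM normfV (ger0_norm (ler0n R 2)) ler_pdivrMl.
have phi0 : 0 < `|phi| + 1 by rewrite ltr_wpDl.
have := @simons_sequence R V U UU oU (midpoint_hull g) M (eps / (`|phi| + 1))
  variation_functional.
have CM n y : midpoint_hull g n y -> `|y| <= M.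
  move=> /(_ [set z : V | `|z| <= M]); apply=> [k _|x y' xM yM /=]; first exact: gM.
  rewrite normrZ normfV (ger0_norm (ler0n R 2)) ler_pdivrMl//.
  by apply: le_trans (ler_normD _ _) _; rewrite mulr_natl mulr2n lerD.
have Cphi n y : midpoint_hull g n y -> eps <= phi y.
  move=> /(_ [set z : V | eps <= phi z]); apply=> [k _|x y' xM yM /=]; first exact: phig.
  rewrite dualZ dualD ler_pdivlMl//.
  by rewrite mulr_natl mulr2n lerD.
case.
- by rewrite divr_gt0.
- by move=> n x y hx hy P h1 h2'; exact: (h2' _ _ (hx P h1 h2') (hy P h1 h2')).
- move=> n y hy P h1 h2'; apply: (hy P _ h2') => k nk; apply: h1; exact: ltnW.
- by move=> n; exists (g n) => P h1 _; exact: (h1 n).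
- exact: CM.
- move=> y /Cphi; rewrite ler_pdivrMr// => h; apply: le_trans h _.
  apply: le_trans (ler_norm _) _; apply: le_trans (dual_le _ _) _.
  by rewrite mulrC ler_wpM2l// lerDl.
- exact: variation_functional_le.
- exact: variation_functional_norming.
move=> b [y [bV yC]]; apply.
have [z [xi zP]] := ulim_variation_functional UU bV.
have ex n : {m | `|ulim U (fun N => b N (y n)) - xi (\sum_(i < m) incr (y n) (z i) *: e i)|
    <= n.+1%:R^-1}.
  by apply: cid; apply: (zP (y n)).2; rewrite invr_gt0.
pose m n := sval (ex n); pose x n := \sum_(i < m n) incr (y n) (z i) *: e i.
have y0 t : y n t @[n --> \oo] --> (0 : R).
  apply/cvgr0Pnorm_le => d d0.
  have /cvgr0Pnorm_le/(_ _ d0)[N _ hN] := g0 t.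
  exists N => // n /= Nn.
  apply: (yC n [set h : V | `|h t| <= d]) => [k nk|h h' hd h'd /=].
    by apply: hN; exact: leq_trans nk.
  rewrite -[X in `|X|]/(2^-1 * (h t + h' t)); apply/h2.
  by apply: le_trans (ler_normD _ _) _; rewrite mulr_natl mulr2n lerD.
have [c [ce cx]] := coord_functional he.
have := @weakly_null _ _ _ hX c x M xi cx.
have xM n : `|x n| <= M by apply: le_trans ((zP (y n)).1 _) _; exact: CM.
move=> /(_ xM) xi0.
have {}xi0 : xi (x n) @[n --> \oo] --> (0 : R).
  apply: xi0 => i; apply/cvgr0Pnorm_le => d d0.
  have : incr (y n) (z i) @[n --> \oo] --> (0 : R).
    by rewrite -[0 : R](subrr (0 : R)); apply: cvgB; exact: y0.
  move=> /cvgr0Pnorm_le/(_ _ d0); apply: filterS => n hn.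
  rewrite /x dual_sum; under eq_bigr do rewrite dualZ ce.
  have [im|im] := ltnP i (m n).
    rewrite (bigD1 (Ordinal im))//= eqxx mulr1 big1 ?addr0// => j ji.
    by rewrite eq_sym (negbTE (_ : nat_of_ord j != i)) ?mulr0.
  rewrite big1 ?normr0 ?ltW// => j _.
  by rewrite gtn_eqF ?mulr0// (leq_trans (ltn_ord j)).
have : (ulim U (fun N => b N (y n)) - xi (x n)) + xi (x n) @[n --> \oo] --> (0 : R) + 0.
  apply: cvgD => //; apply/cvgr0Pnorm_le => d d0; near=> n.
  apply: le_trans (svalP (ex n)) _; near: n.
  by apply: filterS (near_infty_natSinv_lt (PosNum d0)) => n /= /ltW.
rewrite addr0 (_ : (fun n => _) = (fun n => ulim U (fun N => b N (y n))))//.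
by apply/funext => n; rewrite subrK.
Unshelve. all: by end_near. Qed.

End VariationFunctionals.

(** * The bidual is determined by evaluations *)

Lemma seq_norm_map_le_in (R : realType) (X : normedModType R) (e : nat -> X)
    (he : symmetric_basis e) (T : eqType) (s : seq T) (f g : T -> R) :
  (forall x, x \in s -> `|f x| <= `|g x|) -> seq_norm e (map f s) <= seq_norm e (map g s).
Proof.
move=> fg; rewrite /seq_norm !size_map; apply: (comb_norm_le he) => i si.
case: s si fg => // x s si fg; rewrite !(nth_map x)//; apply: fg.
exact: mem_nth.
Qed.

(** * Projection onto a subinterval, and Cousin's lemma *)

Section Clip.
Context {R : realType}.
Implicit Types (t p q : I01 R).

Definition clip p q t := if lt01 t p then p else if lt01 q t then q else t.

Lemma clip_lip p q t t' : le01 p q -> le01 t t' ->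
  le01 (clip p q t) (clip p q t') /\
  \val (clip p q t') - \val (clip p q t) <= \val t' - \val t.
Proof.
have E u : \val (clip p q u) = if \val u < \val p then \val p
    else if \val q < \val u then \val q else \val u.
  by rewrite /clip /lt01; case: ifP => // _; case: ifP.
rewrite /le01 !E; move: (\val p) (\val q) (\val t) (\val t') => a b x y ab xy {E}.
by case: (ltP x a) => ?; case: (ltP y a) => ?; case: (ltP b x) => ?; case: (ltP b y) => ?;
  split; lra.
Qed.

Lemma clip_id p q t : le01 p t -> le01 t q -> clip p q t = t.
Proof. by rewrite /le01 /clip /lt01 !ltNge => -> ->. Qed.

Lemma clip_left p q t : le01 p q -> le01 t p -> clip p q t = p.
Proof.
rewrite /le01 /clip /lt01 => pq tp; case: ltP => // pt; rewrite ltNge.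
have tp' : t = p by apply/val_inj/le_anti; rewrite tp pt.
by rewrite tp' pq.
Qed.

Lemma clip_right p q t : le01 p q -> le01 q t -> clip p q t = q.
Proof.
rewrite /le01 /clip /lt01 => pq qt; rewrite ltNge (le_trans pq qt) /=.
by case: ltP => // tq; apply/val_inj/le_anti; rewrite qt tq.
Qed.

Lemma clip_ge p q t : le01 p q -> le01 p (clip p q t).
Proof.
by rewrite /le01 /clip /lt01 => pq; case: ltP => // pt; case: ltP.
Qed.

Lemma clip_le p q t : le01 p q -> le01 (clip p q t) q.
Proof.
by rewrite /le01 /clip /lt01 => pq; case: ltP => // pt; case: ltP.
Qed.

(** Let t be the supremum of the points reached by admissible chains of cells. The condition to the
    left of t shows that t is reached, the condition to its right that t is passed unless t = 1. All
    cells used have t as an end point; none straddles it. *)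
Lemma cousin (G : I01 R -> I01 R -> Prop) :
  (forall t, exists2 s : R, 0 < s &
    (forall y, lt01 t y -> \val y <= \val t + s -> G t y) /\
    (forall x, lt01 x t -> \val t - s <= \val x -> G x t)) ->
  exists2 l, partition01 l & forall c : I01 R * I01 R, c \in cells (@zero01 R) l -> G c.1 c.2.
Proof.
move=> loc; pose reach x := exists l, [/\ path (@lt01 R) (@zero01 R) l,
  last (@zero01 R) l = x & forall c : I01 R * I01 R, c \in cells (@zero01 R) l -> G c.1 c.2].
have step x y : reach x -> lt01 x y -> G x y -> reach y.
  move=> [l [pl <- Gl]] xy Gxy; exists (rcons l y); split.
  - by rewrite rcons_path pl.
  - by rewrite last_rcons.
  - move=> c; rewrite -cats1 /cells pairmap_cat mem_cat /= inE.
    by move=> /orP[/Gl//|/eqP->].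
pose S := [set \val x | x in reach].
have S0 : S 0 by exists (@zero01 R) => //; exists [::]; split.
have hS : has_sup S.
  by split; [exists 0|exists 1 => _ [x _ <-]; exact: I01_le1].
have [t tE] : exists t : I01 R, \val t = sup S.
  apply: I01_ex; first by apply: ub_le_sup S0; exact: hS.2.
  by apply: ge_sup; [exact: hS.1|move=> _ [x _ <-]; exact: I01_le1].
have [s s0 [Gr Gl]] := loc t.
have rt : reach t.
  have [_ [x rx <-] hx] := sup_adherent s0 hS; rewrite -tE in hx.
  have xt : le01 x t by rewrite /le01 tE; apply: ub_le_sup; [exact: hS.2|exists x].
  have [<-//|nxt] := eqVneq x t.
  have {}xt : lt01 x t.
    rewrite /lt01 lt_neqAle; apply/andP; split; last exact: xt.
    by apply: contra_neq nxt => /val_inj.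
  exact: (step _ _ rx xt (Gl _ xt (ltW hx))).
have [t1|t1] := eqVneq (\val t) 1.
  have [l [pl ll Gl']] := rt; exists l => //.
  by apply/partition01P; split=> //; rewrite ll; exact: val_inj.
have tlt : \val t < 1 by rewrite lt_neqAle t1 I01_le1.
have t0 := I01_ge0 t.
have [y yE] : exists y : I01 R, \val y = Num.min 1 (\val t + s).
  by apply: I01_ex; [rewrite le_min; lra|rewrite ge_min lexx].
have ty : lt01 t y by rewrite /lt01 yE lt_min tlt ltrDl.
have hy : \val y <= \val t + s by rewrite yE ge_min lexx orbT.
have ry : reach y by exact: (step _ _ rt ty (Gr _ ty hy)).
have : \val y <= sup S by apply: ub_le_sup; [exact: hS.2|exists y].
by rewrite -tE leNgt; move: ty; rewrite /lt01 => ->.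
Qed.

End Clip.

(** * Functionals on functions that vanish on a finite set *)

Section SmallMass.
Context {R : realType} {X : normedModType R} {e : nat -> X}.
Variable he : symmetric_basis e.
Hypothesis hX : reflexive_space X.
Local Notation V := (VX0_space he).

Lemma V_ex (f : I01 R -> R) : VX0 e f -> exists g : V, forall t, g t = f t.
Proof.
move=> fV; have fp : (f : I01 R -> R^o) \in VX0_pred (e := e) by apply/asboolP.
by exists (VX0Space he fp).
Qed.

Lemma V_VX0 (g : V) : VX0 e g.
Proof. by have /asboolP := VX0_funP g. Qed.

Lemma V_ext (f g : V) : (forall t, f t = g t) -> f = g.
Proof. by move=> h; apply: val_inj; apply/funext. Qed.

Lemma V_norm_le (g : V) M : (forall s, partition01 s -> alpha e g s <= M) -> `|g| <= M.
Proof. exact: VX_fine_norm_ge. Qed.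

Lemma V_comp (g : V) (psi : R -> R) (k : I01 R -> I01 R) :
  psi (g (k (@zero01 R))) = 0 -> (forall a b, `|psi a - psi b| <= `|a - b|) ->
  (forall x y, le01 x y -> le01 (k x) (k y) /\ \val (k y) - \val (k x) <= \val y - \val x) ->
  exists2 h : V, (forall t, h t = psi (g (k t))) & `|h| <= `|g|.
Proof.
move=> g0 psil kl; have [h hE] := V_ex (comp_VX0 he (V_VX0 g) g0 psil kl).
exists h => //; apply: V_norm_le => s ps.
rewrite (_ : (h : I01 R -> R) = psi \o g \o k); last exact/funext.
apply: (comp_VX_norm he (VX0_funVX g) psil (fun x y xy => (kl x y xy).1)).
exact: partition_le.
Qed.

(** The size of [phi] on functions supported in an open interval; since -h qualifies along with h, a
    bound from above suffices. *)
Definition mass_le (phi : dual V) (d : R) (x y : I01 R) := forall h : V,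
  (forall t, ~~ (lt01 x t && lt01 t y) -> h t = 0) -> `|h| <= 1 -> phi h <= d.

(** Functions in the unit ball supported in (t, t + 1/(n + 1)) tend to 0 pointwise, being eventually
    0 at each point; so [phi] cannot stay above d on them. Excluding t itself is essential: [phi]
    may be an evaluation at t. *)
Lemma mass_right (phi : dual V) d (t : I01 R) : 0 < d -> exists2 s : R, 0 < s &
  forall y, \val y <= \val t + s -> mass_le phi d t y.
Proof.
move=> d0; apply: contrapT => hn.
have ex n : {h : V | [/\ forall x, ~~ (lt01 t x && (\val x < \val t + n.+1%:R^-1)) -> h x = 0,
    `|h| <= 1 & d <= phi h]}.
  apply: cid; apply: contrapT => hn'; apply: hn; exists n.+1%:R^-1; first by rewrite invr_gt0.
  move=> y yt h hsupp h1; rewrite leNgt; apply/negP => dh; apply: hn'.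
  exists h; split=> //; last exact: ltW.
  move=> x hx; apply: hsupp; apply: contra hx => /andP[-> xy] /=.
  exact: lt_le_trans xy yt.
pose h n := sval (ex n).
apply: (@pointwise_null_weakly_null _ _ _ he hX h 1 d phi).
- by move=> n; have [] := svalP (ex n).
- move=> x; apply: cvg_near_cst.
  have [tx|xt] := ltP (\val t) (\val x); last first.
    near=> n; have [hx _ _] := svalP (ex n); apply: hx.
    by rewrite negb_and /lt01 -leNgt xt.
  have tx' : 0 < \val x - \val t by rewrite subr_gt0.
  near=> n; have [hx _ _] := svalP (ex n); apply: hx.
  rewrite negb_and; apply/orP; right; rewrite -leNgt -lerBrDl ltW//; near: n.
  have := near_infty_natSinv_lt (PosNum tx'); apply: filterS => k hk; exact: hk.
- exact: d0.
- by move=> n; have [] := svalP (ex n).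
Unshelve. all: by end_near. Qed.

Lemma mass_left (phi : dual V) d (t : I01 R) : 0 < d -> exists2 s : R, 0 < s &
  forall x, \val t - s <= \val x -> mass_le phi d x t.
Proof.
move=> d0; apply: contrapT => hn.
have ex n : {h : V | [/\ forall x, ~~ ((\val t - n.+1%:R^-1 < \val x) && lt01 x t) -> h x = 0,
    `|h| <= 1 & d <= phi h]}.
  apply: cid; apply: contrapT => hn'; apply: hn; exists n.+1%:R^-1; first by rewrite invr_gt0.
  move=> y yt h hsupp h1; rewrite leNgt; apply/negP => dh; apply: hn'.
  exists h; split=> //; last exact: ltW.
  move=> x hx; apply: hsupp; apply: contra hx => /andP[xy ->]; rewrite andbT.
  exact: le_lt_trans yt xy.
pose h n := sval (ex n).
apply: (@pointwise_null_weakly_null _ _ _ he hX h 1 d phi).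
- by move=> n; have [] := svalP (ex n).
- move=> x; apply: cvg_near_cst.
  have [xt|tx] := ltP (\val x) (\val t); last first.
    near=> n; have [hx _ _] := svalP (ex n); apply: hx.
    by rewrite negb_and orbC /lt01 -leNgt tx.
  have tx' : 0 < \val t - \val x by rewrite subr_gt0.
  near=> n; have [hx _ _] := svalP (ex n); apply: hx.
  rewrite negb_and; apply/orP; left; rewrite -leNgt lerBrDl -lerBrDr ltW//; near: n.
  have := near_infty_natSinv_lt (PosNum tx'); apply: filterS => k hk; exact: hk.
- exact: d0.
- by move=> n; have [] := svalP (ex n).
Unshelve. all: by end_near. Qed.

Lemma mass_partition (phi : dual V) d : 0 < d -> exists2 l, partition01 l &
  forall p, p \in cells (@zero01 R) l -> mass_le phi d p.1 p.2.
Proof.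
move=> d0; apply: cousin => t.
have [s s0 hs] := mass_right phi t d0; have [s' s'0 hs'] := mass_left phi t d0.
exists (Num.min s s'); first by rewrite lt_min s0.
split=> [y _ hy|x _ hx]; [apply: hs|apply: hs'].
  by apply: le_trans hy _; rewrite lerD2l ge_min lexx.
by apply: le_trans hx; rewrite lerD2l lerN2 ge_min lexx orbT.
Qed.

Definition trunc (eta x : R) := Num.max (- eta) (Num.min x eta).

(** Truncation and remainder are both 1-Lipschitz, so neither of them increases the variation
    norm. *)
Lemma trunc_lip eta a b : 0 <= eta -> `|trunc eta a - trunc eta b| <= `|a - b| /\
  `|(a - trunc eta a) - (b - trunc eta b)| <= `|a - b|.
Proof.
move=> eta0; wlog ab : a b / a <= b.
  move=> hw; have [|/ltW] := leP a b; first exact: hw.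
  by move=> /hw; rewrite distrC (distrC b) (distrC (b - _)).
have h : 0 <= trunc eta b - trunc eta a <= b - a.
  rewrite /trunc; case: (leP a eta) => ?; case: (leP b eta) => ?;
    case: (leP (- eta) a) => ?; case: (leP (- eta) b) => ?;
    case: (leP (- eta) eta) => ?; apply/andP; split; lra.
move: h => /andP[h1 h2].
rewrite (distrC (trunc eta a)) (distrC a) (distrC (a - _)) !ger0_norm; lra.
Qed.

Lemma trunc_le eta a : 0 <= eta -> `|trunc eta a| <= eta.
Proof.
move=> eta0; rewrite ler_norml /trunc le_max lexx /= ge_max ge_min lexx orbT andbT.
lra.
Qed.

Lemma trunc_id eta a : `|a| <= eta -> trunc eta a = a.
Proof.
by rewrite ler_norml => /andP[h1 h2]; rewrite /trunc (min_idPl h2) (max_idPr h1).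
Qed.

(* The part of h above the level eta splits into its restrictions to the cells
   of the partition; few of them are nonzero because fundamental is unbounded. *)
Lemma truncated_part_small (phi : dual V) (eta eps : R) : 0 < eta -> 0 < eps ->
  exists2 l, partition01 l & forall h : V, (forall t, t \in l -> h t = 0) -> `|h| <= 1 ->
    exists h' : V, [/\ forall t, `|h' t| <= eta, `|h'| <= 1 & phi h <= phi h' + eps].
Proof.
move=> eta0 eps0; have [N hN] := fundamental_unbounded he hX eta^-1.
have d0 : 0 < eps / (N%:R + 1) by rewrite divr_gt0// ltr_wpDl.
have [l pl ml] := mass_partition phi d0; exists l => // h hl h1.
have h0 : h (@zero01 R) = 0 by have [] := VX0_funVX h.
have t0 : trunc eta 0 = 0 by rewrite trunc_id// normr0 ltW.
have lip a b := trunc_lip a b (ltW eta0).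
have idl (x y : I01 R) : le01 x y -> le01 (id x) (id y) /\ \val (id y) - \val (id x) <= \val y - \val x.
  by move=> xy.
have [h' h'E h'1] := @V_comp h (trunc eta) id ltac:(by rewrite /= h0 t0) (fun a b => (lip a b).1) idl.
have [h'' h''E h''1] := @V_comp h (fun x => x - trunc eta x) id ltac:(by rewrite /= h0 t0 subr0)
  (fun a b => (lip a b).2) idl.
exists h'; split; [by move=> t; rewrite h'E trunc_le// ltW|exact: le_trans h1|].
have -> : h = h' + h''.
  by apply: V_ext => t; rewrite -[RHS]/(h' t + h'' t) h'E h''E addrC subrK.
rewrite dualD lerD2l.
have part01 := partition_le pl.
have h''0 t : t \in @zero01 R :: l -> h'' t = 0.
  rewrite h''E inE => /predU1P[->|/hl->]; by rewrite ?h0 t0 subr0.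
(* [h''] vanishes at the nodes, so composing it with the projection onto a cell gives its
   restriction to that cell, with no larger norm. The default 0 is for pairs that do not arise as
   cells. *)
pose piece p : V := if pselect (le01 p.1 p.2 /\ h'' p.1 = 0) is left H then
  sval (cid2 (@V_comp h'' id (clip p.1 p.2) ltac:(by rewrite (clip_left H.1) ?H.2 //; exact: I01_ge0)
    (fun a b => lexx _) (fun x y => clip_lip H.1))) else 0.
have pieceE p : le01 p.1 p.2 -> h'' p.1 = 0 ->
    (forall t, piece p t = h'' (clip p.1 p.2 t)) /\ `|piece p| <= 1.
  move=> p12 p0; rewrite /piece; case: pselect => [H|[]//].
  case: cid2 => g gE g1 /=; split=> //.
  exact: le_trans g1 (le_trans h''1 h1).
have cellsP (x : I01 R) l' p : path (@le01 R) x l' -> p \in cells x l' ->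
    [/\ le01 p.1 p.2, p.1 \in x :: l' & p.2 \in x :: l'].
  elim: l' x => //= y l' IH x /andP[xy yl]; rewrite inE => /predU1P[->|].
    by rewrite /= !inE !eqxx orbT.
  by move=> /(IH _ yl)[a b c]; split=> //; rewrite inE ?b ?c orbT.
have decomp : h'' = \sum_(p <- cells (@zero01 R) l) piece p.
  apply: V_ext => t.
  rewrite -[RHS]/(delta he t (\sum_(p <- cells (@zero01 R) l) piece p)) dual_sum.
  (* At most one cell has t in its interior; on all the others the projection of t is a node, where
     [h''] is 0. *)
  have aux x l' : path (@le01 R) x l' -> (forall t, t \in x :: l' -> h'' t = 0) ->
      \sum_(p <- cells x l') delta he t (piece p) =
      h'' (clip x (last x l') t).
    elim: l' x => [|y l' IH] x /=.
      move=> _ hx; rewrite big_nil (_ : clip x x t = x) ?hx ?inE//.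
      rewrite /clip; case: ifP => // h2; case: ifP => // h3.
      by apply/val_inj/le_anti; move: h2 h3; rewrite /lt01 !leNgt => -> ->.
    move=> /andP[xy yl] hx; rewrite big_cons IH// => [|t' ht']; last first.
      by apply: hx; rewrite inE ht' orbT.
    have x0 : h'' x = 0 by apply: hx; rewrite inE eqxx.
    have y0 : h'' y = 0 by apply: hx; rewrite !inE eqxx orbT.
    have ylast : le01 y (last y l').
      by move: yl; case/lastP: l' {IH hx} => [|l' z]; rewrite ?last_rcons; [rewrite /le01|
        move=> /order_path_min -/(_ (@le01_trans R)) /allP/(_ z); apply; rewrite mem_rcons inE eqxx].
    have [pE _] := pieceE (x, y) xy x0.
    rewrite pE /=.
    have [ty|yt] := leP (\val t) (\val y).
      rewrite (clip_left ylast ty) y0 addr0.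
      have [tx|xt] := leP (\val t) (\val x).
        by rewrite !clip_left//; exact: le_trans xy ylast.
      rewrite !clip_id//; try exact: ltW.
      exact: le_trans ty ylast.
    rewrite (clip_right xy (ltW yt)) y0 add0r.
    have xt : le01 x t by apply: le_trans xy (ltW yt).
    have [tl|lt] := leP (\val t) (\val (last y l')).
      by rewrite !clip_id//; exact: ltW.
    have lt' : le01 (last y l') t := ltW lt.
    by rewrite (clip_right ylast lt') (clip_right (le_trans xy ylast) lt').
  have /partition01P[_ ll] := pl.
  rewrite aux// ll clip_id//; [exact: I01_ge0|exact: I01_le1].
pose big p := `[< exists t, [/\ le01 p.1 t, le01 t p.2 & eta < `|h t|] >].
pose v (p : I01 R * I01 R) : I01 R :=
  if pselect (exists t, [/\ le01 p.1 t, le01 t p.2 & eta < `|h t|]) is left H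
  then sval (cid H) else p.1.
have uv p : le01 p.1 p.2 -> [/\ le01 p.1 p.1, le01 p.1 (v p) & le01 (v p) p.2].
  move=> p12; rewrite /v; case: pselect => [H|_]; last by split=> //; exact: lexx.
  by case: cid => t /= [a b _]; split=> //; exact: lexx.
have hl0 p : p \in cells (@zero01 R) l -> h p.1 = 0.
  move=> /(cellsP _ _ _ part01)[_ + _]; rewrite inE => /predU1P[->//|]; exact: hl.
(* Starting from the left nodes, where h = 0, N cells with values above [eta] would give increments
   of norm at least [eta * fundamental e N > 1]. *)
have cnt : (count big (cells (@zero01 R) l) < N)%N.
  rewrite ltnNge; apply/negP => hc.
  have := insert_incr_VX he (VX0_funVX h) uv part01; rewrite leNgt => /negP; apply.
  apply: (le_lt_trans h1).
  apply: (@lt_le_trans _ _ (eta * fundamental e N)); first by rewrite -ltr_pdivrMl// mulr1.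
  apply: (@le_trans _ _ (seq_norm e (nseq (count big (cells (@zero01 R) l)) eta))).
    rewrite /seq_norm size_nseq; apply: (@le_trans _ _ (eta * fundamental e (count big (cells (@zero01 R) l)))).
      by apply: ler_wpM2l; [exact: ltW|exact: comb_norm_leq].
    rewrite -{1}(ger0_norm (ltW eta0)) -comb_normZ.
    by apply/eq_ler/eq_comb_norm => i ni; rewrite nth_nseq ni mulr1.
  rewrite (_ : nseq _ _ = [seq x <- [seq (if big p then eta else 0) | p <- cells (@zero01 R) l] | x != 0]).
    rewrite (seq_norm_nz he); apply: (seq_norm_map_le_in he) => p pp.
    rewrite (hl0 _ pp) subr0 /big; case: asboolP => bp; last by rewrite normr0.
    rewrite /v; case: pselect => // H; case: cid => t /= [_ _ ht].
    by rewrite ger0_norm ltW.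
  elim: (cells (@zero01 R) l) => //= q r IH; case: (big q) => /=; last by rewrite eqxx.
  by rewrite (gt_eqF eta0) /= -IH.
rewrite decomp dual_sum.
apply: (@le_trans _ _ (\sum_(p <- cells (@zero01 R) l | big p) (eps / (N%:R + 1)))).
  rewrite [leRHS]big_mkcond /= big_seq [leRHS]big_seq; apply: ler_sum => p pp.
  have [p12 pm1 pm2] := cellsP _ _ _ part01 pp.
  have [pE p1] := pieceE p p12 (h''0 _ pm1).
  case: (boolP (big p)) => [_|/asboolP nb].
    apply: (ml p pp _ _ p1) => t nt; rewrite pE.
    have [tp|pt] := leP (\val t) (\val p.1); first by rewrite clip_left// h''0.
    have [qt|tq] := leP (\val p.2) (\val t); first by rewrite clip_right// h''0.
    by move: nt; rewrite /lt01 pt tq.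
  rewrite (_ : piece p = 0) ?dual0//; apply: V_ext => t.
  rewrite pE h''E trunc_id ?subrr//; rewrite leNgt; apply/negP => et; apply: nb.
  by exists (clip p.1 p.2 t); split=> //; [exact: clip_ge|exact: clip_le].
rewrite big_const_seq iter_addr_0 -[leLHS]mulr_natl mulrCA ger_pMr//.
by rewrite ler_pdivrMr ?ltr_wpDl// mul1r ler_wpDr// ler_nat ltnW.
Qed.

(** If no finite set worked, truncation at the levels 1/(n + 1) would produce elements of the unit
    ball that tend uniformly to 0 while [phi] stays at least eps/2 on them. *)
Lemma vanishing_small (phi : dual V) (eps : R) : 0 < eps -> exists2 l, partition01 l &
  forall h : V, (forall t, t \in l -> h t = 0) -> `|h| <= 1 -> phi h <= eps.
Proof.
move=> eps0; apply: contrapT => hn.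
have e2 : 0 < eps / 2 by rewrite divr_gt0.
have ex n : {h : V | [/\ forall t, `|h t| <= n.+1%:R^-1, `|h| <= 1 & eps / 2 <= phi h]}.
  apply: cid; have eta0 : 0 < n.+1%:R^-1 :> R by rewrite invr_gt0.
  have [l pl hl] := truncated_part_small phi eta0 e2.
  apply: contrapT => hn'; apply: hn; exists l => // h h0 h1.
  have [h' [h'1 h'2 h'3]] := hl h h0 h1.
  rewrite leNgt; apply/negP => eh; apply: hn'; exists h'; split=> //; lra.
pose h n := sval (ex n).
apply: (@pointwise_null_weakly_null _ _ _ he hX h 1 (eps / 2) phi) => //.
- by move=> n; have [] := svalP (ex n).
- move=> t; apply/cvgr0Pnorm_le => d d0.
  apply: filterS (near_infty_natSinv_lt (PosNum d0)) => n /= /ltW hn'.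
  by have [h1 _ _] := svalP (ex n); exact: le_trans (h1 t) hn'.
- by move=> n; have [] := svalP (ex n).
Qed.

End SmallMass.

(** * Piecewise linear interpolation and the identification of the bidual *)

Section Interpolation.
Context {R : realType} {X : normedModType R} {e : nat -> X}.
Variable he : symmetric_basis e.
Hypothesis hX : reflexive_space X.
Local Notation V := (VX0_space he).

Definition ramp (p : I01 R * I01 R) (t : I01 R) : R :=
  (\val (clip p.1 p.2 t) - \val p.1) / len p.

Lemma ramp_left p t : lt01 p.1 p.2 -> le01 t p.1 -> ramp p t = 0.
Proof. by move=> /ltW pp tp; rewrite /ramp clip_left// subrr mul0r. Qed.

Lemma ramp_right p t : lt01 p.1 p.2 -> le01 p.2 t -> ramp p t = 1.
Proof.
move=> pp tp; rewrite /ramp clip_right//; last exact: ltW.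
by rewrite mulfV// gt_eqF// subr_gt0.
Qed.

Lemma ramp_mono p t t' : lt01 p.1 p.2 -> le01 t t' -> ramp p t <= ramp p t'.
Proof.
move=> pp tt'; rewrite /ramp ler_pM2r ?invr_gt0 ?subr_gt0// lerD2r.
exact: (clip_lip (ltW pp) tt').1.
Qed.

Lemma ramp_ge0 p t : lt01 p.1 p.2 -> 0 <= ramp p t.
Proof.
move=> pp; rewrite -(ramp_left pp (lexx _)); have [tp|pt] := leP (\val t) (\val p.1).
  by rewrite !ramp_left// /le01.
by apply: ramp_mono => //; exact: ltW.
Qed.

Lemma ramp_le1 p t : lt01 p.1 p.2 -> ramp p t <= 1.
Proof.
move=> pp; rewrite -(ramp_right pp (lexx _)); have [pt|tp] := leP (\val p.2) (\val t).
  by rewrite !ramp_right// /le01.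
by apply: ramp_mono => //; exact: ltW.
Qed.

Lemma ramp_lt1 p t : lt01 p.1 p.2 -> ramp p t < 1 -> lt01 t p.2.
Proof.
move=> pp r1; rewrite /lt01 ltNge; apply/negP => h.
by move: r1; rewrite ramp_right ?ltxx.
Qed.

Lemma ramp_V p : lt01 p.1 p.2 -> exists g : V, forall t, g t = ramp p t.
Proof.
move=> pp; have p0 : 0 < len p by rewrite subr_gt0.
apply: V_ex; apply: (monotone_VX0 he hX).
- by rewrite ramp_left//; exact: I01_ge0.
- by move=> x y; exact: ramp_mono.
move=> eps eps0; exists (eps * len p); first exact: mulr_gt0.
move=> x y xy hxy; rewrite /ramp -mulrBl ler_pdivrMr//; apply: le_trans hxy.
apply: le_trans (clip_lip (ltW pp) xy).2; lra.
Qed.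

Definition rampV p : V :=
  if pselect (lt01 p.1 p.2) is left H then sval (cid (ramp_V H)) else 0.

Lemma rampVE p t : lt01 p.1 p.2 -> rampV p t = ramp p t.
Proof.
by move=> pp; rewrite /rampV; case: pselect => // H; case: cid.
Qed.

Definition interp (l : seq (I01 R)) (f : I01 R -> R) : V :=
  \sum_(p <- cells (@zero01 R) l) incr f p *: rampV p.

Lemma cells_lt x (l : seq (I01 R)) p : path (@lt01 R) x l -> p \in cells x l -> lt01 p.1 p.2.
Proof.
elim: l x => //= y l IH x /andP[xy yl]; rewrite inE => /predU1P[->//|].
exact: IH.
Qed.

Lemma cells_ge x (l : seq (I01 R)) p : path (@lt01 R) x l -> p \in cells x l -> le01 x p.1.
Proof.
elim: l x => //= y l IH x /andP[xy yl]; rewrite inE => /predU1P[->|]; first exact: lexx.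
by move=> /(IH _ yl); apply: le_trans; exact: ltW.
Qed.

Lemma interpE l f t : partition01 l ->
  interp l f t = \sum_(p <- cells (@zero01 R) l) incr f p * ramp p t.
Proof.
move=> /partition01P[pl _]; rewrite -[LHS]/(delta he t (interp l f)) dual_sum.
rewrite big_seq [RHS]big_seq; apply: eq_bigr => p pp.
by rewrite dualZ; congr (_ * _); exact: rampVE (cells_lt pl pp).
Qed.

Lemma sum_ramp_node x l f t : path (@lt01 R) x l -> t \in x :: l ->
  \sum_(p <- cells x l) incr f p * ramp p t = f t - f x.
Proof.
elim: l x => [|y l IH] x /=.
  by move=> _; rewrite inE => /eqP->; rewrite big_nil subrr.
move=> /andP[xy yl] tl; rewrite big_cons -/(cells y l).
have [->|nt] := eqVneq t x.
  rewrite subrr ramp_left ?mulr0 ?add0r//; last exact: lexx.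
  rewrite big1_seq// => p /= pp; rewrite ramp_left ?mulr0 ?(cells_lt yl pp)//.
  exact: le_trans (ltW xy) (cells_ge yl pp).
have {}tl : t \in y :: l by move: tl; rewrite inE (negbTE nt).
rewrite IH// ramp_right//.
  by rewrite mulr1 /incr /= addrC addrA subrK.
move: tl; rewrite inE => /predU1P[->|tl]; first exact: lexx.
have lt_tr : transitive (@lt01 R) by move=> b a c; exact: lt_trans.
by apply: ltW; have /(order_path_min lt_tr)/allP/(_ t tl) := yl.
Qed.

Lemma interp_node l f t : f (@zero01 R) = 0 -> partition01 l -> t \in @zero01 R :: l ->
  interp l f t = f t.
Proof.
move=> f0 pl tl; have /partition01P[pl' _] := pl.
by rewrite interpE// sum_ramp_node// f0 subr0.
Qed.

(* For a uniform random level u the points round u t are monotone in t, and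
   interp l f t is the mean of f (round u t). *)
Fixpoint round (u : R) (x : I01 R) (l : seq (I01 R)) (t : I01 R) :=
  if l is y :: l' then (if u < ramp (x, y) t then round u y l' t else x) else x.

Lemma round_ge u x l t : path (@lt01 R) x l -> le01 x (round u x l t).
Proof.
elim: l x => [|y l IH] x /=; first by move=> _; exact: lexx.
move=> /andP[xy yl]; case: ifP => _; last exact: lexx.
by apply: le_trans (IH _ yl); exact: ltW.
Qed.

Lemma round_mono u x l t t' : path (@lt01 R) x l -> le01 t t' ->
  le01 (round u x l t) (round u x l t').
Proof.
move=> + tt'; elim: l x => [|y l IH] x /=; first by move=> _; exact: lexx.
move=> /andP[xy yl]; case: ifP => h.
  by rewrite (lt_le_trans h (ramp_mono (p := (x, y)) xy tt')); exact: IH.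
case: ifP => _; last exact: lexx.
by apply: le_trans (round_ge _ _ yl); exact: ltW.
Qed.

Lemma round_sum (u : R) x l t f : 0 <= u < 1 -> path (@lt01 R) x l ->
  \sum_(p <- cells x l) incr f p * (u < ramp p t)%R%:R = f (round u x l t) - f x.
Proof.
move=> /andP[u0 u1]; elim: l x => [|y l IH] x /=; first by rewrite big_nil subrr.
move=> /andP[xy yl]; rewrite big_cons -/(cells y l); case: ifP => h.
  by rewrite IH// mulr1 /incr /= addrC addrA subrK.
rewrite mulr0 add0r subrr big1_seq// => p /= pp.
have ty : lt01 t y.
  apply: (@ramp_lt1 (x, y)) => //; apply: le_lt_trans u1.
  by rewrite leNgt h.
rewrite ramp_left ?(cells_lt yl pp)//.
  by rewrite ltNge u0 mulr0.
by apply: ltW; apply: lt_le_trans ty (cells_ge yl pp).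
Qed.

Lemma count_level N (x : R) : 0 <= x <= N%:R ->
  x <= \sum_(k < N) (k%:R < x)%R%:R <= x + 1.
Proof.
elim: N x => [|N IH] x /andP[x0 xN].
  by rewrite big_ord0; apply/andP; split; move: x0 xN; lra.
rewrite big_ord_recr /=; have [xN'|Nx] := leP x N%:R.
  by rewrite addr0; apply: IH; rewrite x0.
rewrite (eq_bigr (fun=> 1)) => [|k _]; last first.
  by rewrite (_ : _ < _ = true)//; apply: le_lt_trans Nx; rewrite ler_nat ltnW.
by rewrite sumr_const card_ord natr1 xN /= -natr1 lerD2r ltW.
Qed.

(** The mean over the level is replaced by the average A over the levels k/N. Each f composed with a
    rounding map has variation at most that of f, as rounding is monotone, and so has A. By
    [count_level], A differs from the interpolant by at most E/N pointwise; for a fixed partition s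
    this costs at most D/N, which is made at most eps. *)
Lemma interp_norm f l : VX e f -> partition01 l -> `|interp l f| <= fine (VX_norm e f).
Proof.
move=> fV pl; apply: V_norm_le => s ps; apply/ler_addgt0Pr => eps eps0.
have /partition01P[pl' _] := pl; have f0 : f (@zero01 R) = 0 by case: fV.
pose E : R := \sum_(p <- cells (@zero01 R) l) `|incr f p|.
have E0 : 0 <= E by apply: sumr_ge0.
pose D := (\sum_(i < size s) 2 * E) * `|e 0%N|.
have D0 : 0 <= D by rewrite mulr_ge0// sumr_ge0// => i _; rewrite mulr_ge0.
pose N := (Num.truncn (D / eps)).+1.
have hN : D <= N%:R * eps by rewrite -ler_pdivrMr// ltW// truncnS_gt.
have N0 : 0 < N%:R :> R by rewrite ltr0n.
pose F k t := f (round (k%:R / N%:R) (@zero01 R) l t).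
pose A t := N%:R^-1 * \sum_(k < N) F k t.
have AE t : `|interp l f t - A t| <= E / N%:R.
  have -> : A t = \sum_(p <- cells (@zero01 R) l) incr f p *
      (N%:R^-1 * \sum_(k < N) (k%:R / N%:R < ramp p t)%R%:R).
    rewrite /A; under [RHS]eq_bigr do rewrite mulrCA.
    rewrite -mulr_sumr; congr (_ * _).
    under [RHS]eq_bigr do rewrite mulr_sumr; rewrite exchange_big /=.
    apply: eq_bigr => k _; rewrite round_sum ?f0 ?subr0//.
    by rewrite divr_ge0//= ltr_pdivrMr// mul1r ltr_nat.
  rewrite interpE// -sumrB; apply: le_trans (ler_norm_sum _ _ _) _.
  rewrite /E mulr_suml big_seq [leRHS]big_seq; apply: ler_sum => p pp.
  rewrite -mulrBr normrM ler_wpM2l//.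
  have pp' := cells_lt pl' pp.
  have /count_level : 0 <= N%:R * ramp p t <= N%:R.
    by rewrite mulr_ge0 ?ramp_ge0 ?(ltW N0)//= ler_piMr ?(ltW N0) ?ramp_le1.
  rewrite (eq_bigr (fun k : 'I_N => (k%:R / N%:R < ramp p t)%R%:R)) => [|k _]; last first.
    by rewrite ltr_pdivrMr// mulrC.
  set S := \sum_(k < N) _ => /andP[h1 h2].
  set r := ramp p t in h1 h2 *.
  rewrite -(ler_pM2l N0) -{1}(gtr0_norm N0) -normrM mulrBr mulVKf ?gt_eqF//.
  rewrite mulfV ?gt_eqF//.
  by rewrite ler_norml; apply/andP; split; lra.
have aA : alpha e A s <= fine (VX_norm e f).
  have aF k : alpha e (F k) s <= fine (VX_norm e f).
    apply: (@comp_VX_norm _ _ _ he f id (round (k%:R / N%:R) (@zero01 R) l)) => //.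
      by move=> x y; exact: round_mono.
    exact: partition_le.
  rewrite /alpha -/(comb_norm e (size s) (fun i => A (nth (@zero01 R) (@zero01 R :: s) i.+1) - A (nth (@zero01 R) (@zero01 R :: s) i))).
  rewrite (@eq_comb_norm _ _ _ _ _ (fun i => N%:R^-1 * \sum_(k < N)
    (F k (nth (@zero01 R) (@zero01 R :: s) i.+1) - F k (nth (@zero01 R) (@zero01 R :: s) i)))); last first.
    by move=> i _; rewrite /A -mulrBr -sumrB.
  rewrite comb_normZ gtr0_norm ?invr_gt0// ler_pdivrMl//.
  apply: le_trans (comb_norm_sum _ _ _ _) _.
  rewrite mulr_natl -[X in _ *+ X](card_ord N) -sumr_const.
  by apply: ler_sum => k _; exact: aF.
pose W : I01 R -> R := fun t => interp l f t - A t.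
have -> : (interp l f : I01 R -> R) = A + W.
  by apply/funext => t; rewrite /W -[RHS]/(A t + (interp l f t - A t)) addrC subrK.
apply: le_trans (alphaD _ _ _ _) _; apply: lerD => //.
rewrite -[alpha e W s]/(comb_norm e (size s) (fun i => W (nth (@zero01 R) (@zero01 R :: s) i.+1)
  - W (nth (@zero01 R) (@zero01 R :: s) i))).
apply: le_trans (comb_norm_l1 he _ _) _.
apply: (@le_trans _ _ (D / N%:R)); last by rewrite ler_pdivrMr// mulrC.
rewrite /D [leRHS]mulrAC; apply: ler_wpM2r => //.
rewrite mulr_suml; apply: ler_sum => i _.
apply: le_trans (ler_normB _ _) _; rewrite -mulrA mulr_natl mulr2n.
by apply: lerD; exact: AE.
Qed.

(** Interpolation replaces [phi] by a combination of evaluations, which F annihilates, plus [psi].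
    As [psi g] is [phi] at [g - interp l g], which vanishes on l and has norm at most 2 |g|, the
    norm of [psi] is at most 2 d. *)
Lemma bidual_unique (F : dual (dual V)) : (forall t, F (delta he t) = 0) -> F = 0.
Proof.
move=> F0; apply: val_inj; apply/funext => phi /=.
apply/eqP; rewrite -normr_le0; apply/ler_addgt0Pr => eps eps0; rewrite add0r.
have [d d0 dF] : exists2 d : R, 0 < d & `|F| * (d * 2) <= eps.
  have F1 : 0 < `|F| + 1 by rewrite ltr_wpDl.
  exists (eps / (`|F| + 1) / 2); first by rewrite !divr_gt0.
  by rewrite divfK ?pnatr_eq0// mulrCA ger_pMr// ler_pdivrMr// mul1r lerDl.
have [l pl hl] := vanishing_small hX phi d0.
have {}hl (h : V) : (forall t, t \in l -> h t = 0) -> `|phi h| <= d * `|h|.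
  wlog : h / 0 <= phi h.
    move=> hw; have [|/ltW h0] := leP 0 (phi h); first exact: hw.
    move=> hz; rewrite -normrN -[`|h|]normrN -dualN; apply: hw.
      by rewrite dualN oppr_ge0.
    by move=> t tl; rewrite -[LHS]/(- h t) hz// oppr0.
  move=> h0 hz; rewrite ger0_norm//.
  have [->|hn0] := eqVneq h 0; first by rewrite dual0 normr0 mulr0.
  have hp : 0 < `|h| by rewrite normr_gt0.
  rewrite -ler_pdivrMr// mulrC -dualZ; apply: hl.
    by move=> t tl; rewrite -[LHS]/(`|h|^-1 * h t) hz// mulr0.
  by rewrite normrZ normfV normr_id mulVf ?gt_eqF.
pose psi := phi - \sum_(p <- cells (@zero01 R) l) phi (rampV p) *: (delta he p.2 - delta he p.1).
have dD x y (G : dual (dual V)) : G (x - y) = G x - G y by rewrite dualB.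
have -> : F phi = F psi.
  rewrite /psi dualB dual_sum big1 ?subr0// => p _.
  by rewrite dualZ dualB !F0 subrr mulr0.
have psiE g : psi g = phi (g - interp l g).
  rewrite dualB /interp dual_sum -[LHS]/(phi g + (- \sum_(p <- cells (@zero01 R) l) phi (rampV p) *: (delta he p.2 - delta he p.1)) g).
  congr (_ + _); rewrite -[LHS]/(- (\sum_(p <- cells (@zero01 R) l) phi (rampV p) *: (delta he p.2 - delta he p.1) : dual V) g).
  congr (- _); elim: (cells _ _) => [|p r IH]; first by rewrite !big_nil.
  rewrite !big_cons -IH dualZ -[LHS]/(phi (rampV p) * (g p.2 - g p.1) + _).
  by rewrite mulrC.
have psin : `|psi| <= d * 2.
  apply: dual_norm_bound; first by rewrite mulr_ge0// ltW.
  move=> g; rewrite psiE; apply: le_trans (hl _ _) _.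
    move=> t tl; rewrite -[LHS]/(g t - interp l g t) interp_node ?subrr//.
      by have [] := VX0_funVX g.
    by rewrite inE tl orbT.
  rewrite -mulrA; apply: ler_wpM2l; first exact: ltW.
  apply: le_trans (ler_normB _ _) _.
  by rewrite mulr_natl mulr2n lerD2l; apply: interp_norm => //; exact: VX0_funVX.
apply: le_trans (dual_le _ _) _; apply: (@le_trans _ _ (`|F| * (d * 2))).
  exact: ler_wpM2l.
exact: dF.
Qed.

Lemma insert_point (x t : I01 R) l : path (@lt01 R) x l -> lt01 x t -> last x l = one01 ->
  exists l', [/\ path (@lt01 R) x l', last x l' = one01, t \in l' & {subset l <= l'}].
Proof.
elim: l x => [|y l IH] x /=.
  by move=> _ + x1; rewrite x1 /lt01 ltNge I01_le1.
move=> /andP[xy yl] xt ly; have [->|nty] := eqVneq t y.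
  by exists (y :: l); split=> //=; rewrite ?xy ?inE ?eqxx.
have [ty|yt] := ltP (\val t) (\val y).
  exists [:: t, y & l]; split=> //=.
  - by rewrite xt yl andbT.
  - by rewrite inE eqxx.
  - by move=> z zl; rewrite inE zl orbT.
have {}yt : lt01 y t.
  rewrite /lt01 lt_neqAle; apply/andP; split; last exact: yt.
  by rewrite eq_sym; apply: contra_neq nty => /val_inj.
have [l' [h1 h2 h3 h4]] := IH y yl yt ly.
exists (y :: l'); split=> //=; first by rewrite xy.
  by rewrite inE h3 orbT.
by move=> z; rewrite !inE => /predU1P[->|/h4->]; rewrite ?eqxx ?orbT.
Qed.

Lemma partition_through (l : seq (I01 R)) : exists2 P, partition01 P &
  {subset l <= @zero01 R :: P}.
Proof.
elim: l => [|t l [P pP lP]].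
  by have [P pP] := @partition01_ex R; exists P.
have [->|t0] := eqVneq t (@zero01 R).
  by exists P => // z; rewrite inE => /predU1P[->|/lP//]; rewrite inE eqxx.
have zt : lt01 (@zero01 R) t.
  rewrite /lt01 lt_neqAle; apply/andP; split; last exact: I01_ge0.
  by rewrite eq_sym; apply: contra_neq t0 => /val_inj.
have /partition01P[h1 h2] := pP.
have [P' [h3 h4 h5 h6]] := insert_point h1 zt h2.
exists P'; first exact/partition01P.
move=> z; rewrite inE => /predU1P[->|/lP]; first by rewrite inE h5 orbT.
by rewrite !inE => /predU1P[->|/h6->]; rewrite ?eqxx ?orbT.
Qed.

(** F is the ultralimit of the interpolants of f, bounded by [interp_norm], along the finite sets of
    points directed by inclusion. At each t the interpolant is exact as soon as the finite set
    contains t. *)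
Lemma bidual_exists f : VX e f -> exists F : dual (dual V), forall t, F (delta he t) = f t.
Proof.
move=> fV; have f0 : f (@zero01 R) = 0 by case: fV.
pose P l := s2val (cid2 (partition_through l)).
have PP l : partition01 (P l) by exact: s2valP.
have lP l : {subset l <= @zero01 R :: P l} by exact: (s2valP' (cid2 (partition_through l))).
pose g l := interp (P l) f.
pose F0 : set_system (seq (I01 R)) :=
  [set A | exists l0 : seq (I01 R), forall l : seq (I01 R), {subset l0 <= l} -> A l].
have FF : ProperFilter F0.
  apply: Build_ProperFilter_ex; first by move=> A [l0 h]; exists l0; exact: h.
  split; first by exists [::].
  - move=> A B [a ha] [b hb]; exists (a ++ b) => l hl; split.
      by apply: ha => x xa; apply: hl; rewrite mem_cat xa.
    by apply: hb => x xb; apply: hl; rewrite mem_cat xb orbT.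
  - by move=> A B AB [a ha]; exists a => l /ha /AB.
have [U [UU FU]] := ultraFilterLemma FF.
set M := fine (VX_norm e f).
have gM l : `|g l| <= M by exact: interp_norm.
have pM (phi : dual V) l : `|phi (g l)| <= M * `|phi|.
  by apply: le_trans (dual_le _ _) _; rewrite mulrC ler_wpM2r.
have pl (phi : dual V) := @ulimP _ _ U UU _ _ (pM phi).
have [|||F hF] := @dual_ex R (dual V) (fun phi => ulim U (fun l => phi (g l))) M.
- by move=> phi psi; apply/cvg_lim => //; apply: cvgD; exact: pl.
- move=> k phi; apply/cvg_lim => //.
  rewrite (_ : (fun l => (k *: phi) (g l)) = (fun l => k * phi (g l)))//.
  by apply: cvgM; [exact: cvg_cst|exact: pl].
- by move=> phi; exact: ulim_norm_le.
exists F => t; rewrite hF; apply/cvg_lim => //.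
apply: cvg_near_cst; apply: FU; exists [:: t] => l hl.
by apply: interp_node => //; apply: lP; apply: hl; rewrite inE.
Qed.

Lemma VX_bidual_delta f t : VX e f -> VX_bidual he f (delta he t) = f t.
Proof.
move=> /bidual_exists[F hF].
by have := @getPex _ [set F : dual (dual V) | forall t, F (delta he t) = f t] (ex_intro _ F hF); exact.
Qed.

End Interpolation.

(** * Semicontinuous differences are continuous *)

Section BallTopology.
Context {R : realType}.

Lemma initial_cvg (S : choiceType) (T : topologicalType) (f : S -> T) I (F : set_system I)
    (FF : Filter F) (x : I -> S) (s : S) :
  f (x i) @[i --> F] --> f s -> x i @[i --> F] --> (s : initial_topology f).
Proof.
move=> c A [B [[W oW <-] /= Wfs sub]]; apply: filterS sub _.
by apply: c; exact: open_nbhs_nbhs.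
Qed.

Lemma dual_ball_cvg (V : normedModType R) (k : nat -> dual_ball V) (k0 : dual_ball V) :
  (forall g : V, (\val (k n) : dual V) g @[n --> \oo] --> (\val k0 : dual V) g) ->
  k n @[n --> \oo] --> k0.
Proof.
move=> h.
have h1 : (\val (k n) : dual V) @[n --> \oo] --> (\val k0 : weak_star V).
  apply: (@initial_cvg _ _ (fun phi : dual V => (phi : {ptws V -> R^o}))).
  by apply/(@pointwise_cvgP _ _ _ _) => g; exact: h.
exact: (@initial_cvg _ _ (set_val : dual_ball V -> weak_star V)).
Qed.

Lemma dual_ball_eval_continuous (V : normedModType R) (g : V) :
  continuous (fun k : dual_ball V => (\val k : dual V) g : R).
Proof.
move=> k.
have c1 : continuous (set_val : dual_ball V -> weak_star V) by exact: initial_continuous.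
have c2 : continuous (fun phi : weak_star V => (phi : dual V) g : R).
  move=> phi.
  have c3 : continuous (fun phi : weak_star V => ((phi : dual V) : {ptws V -> R^o})).
    exact: initial_continuous.
  have c4 : continuous (fun h : {ptws V -> R^o} => h g) by exact: proj_continuous.
  exact: continuous_comp (c3 phi) (c4 _).
exact: continuous_comp (c1 k) (c2 _).
Qed.

Lemma I01_continuousP (f : I01 R -> R) : continuous f <-> forall t (eps : R), 0 < eps ->
  exists2 d : R, 0 < d & forall y, `|\val t - \val y| < d -> `|f t - f y| < eps.
Proof.
split=> [cf t eps eps0|h t].
  have := cf t => /cvgrPdist_lt/(_ eps eps0)/nbhs_ballP[d d0 hd].
  by exists d => // y ty; apply: hd.
move=> A /nbhs_ballP[eps eps0 hA]; have [d d0 hd] := h t eps eps0.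
by apply/nbhs_ballP; exists d => // y ty; apply: hA; exact: hd.
Qed.

End BallTopology.

(** * A jump of f makes u + v unbounded *)

Section SemicontinuousDifference.
Context {R : realType} {X : normedModType R} {e : nat -> X}.
Variable he : symmetric_basis e.
Hypothesis hX : reflexive_space X.
Local Notation V := (VX0_space he).
Implicit Types z : nat -> I01 R.

Lemma nondecreasing_incr (f : I01 R -> R) z n : VX e f ->
  (forall i j, (i <= j)%N -> le01 (z i) (z j)) ->
  comb_norm e n (fun i => f (z i.+1) - f (z i)) <= fine (VX_norm e f).
Proof.
move=> fV zm.
have pz : path (@le01 R) (@zero01 R) (mkseq z n.+1).
  apply/(pathP (@zero01 R)) => i; rewrite size_mkseq => ni.
  rewrite nth_mkseq//; case: i ni => [|i] ni; first exact: I01_ge0.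
  by rewrite -[nth _ (_ :: _) _]/(nth (@zero01 R) (mkseq z n.+1) i) nth_mkseq ?zm// ltnW.
apply: le_trans (path_incr_VX he fV pz).
pose c := [seq incr f p | p <- cells (@zero01 R) (mkseq z n.+1)].
have sz : size c = n.+1 by rewrite size_map size_pairmap size_mkseq.
apply: (@le_trans _ _ (seq_norm e (behead c))); last first.
  apply: (seq_norm_subseq he); rewrite -/c; case: (c) => // a c'; exact: subseq_cons.
rewrite /seq_norm size_behead sz -[n.+1.-1]/n; apply/eq_ler/eq_comb_norm => i ni.
rewrite nth_behead /c (nth_map (@zero01 R, @zero01 R)) ?size_pairmap ?size_mkseq ?ltnS//.
rewrite (nth_pairmap (@zero01 R)) ?size_mkseq ?ltnS// /incr.
rewrite -[nth _ (_ :: _) _]/(nth (@zero01 R) (mkseq z n.+1) i) !nth_mkseq//.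
by rewrite ltnS ltnW.
Qed.

(** A nonincreasing sequence is read backwards; this reverses the order of the increments and their
    signs, neither of which changes the norm. *)
Lemma monotone_incr (f : I01 R -> R) z n : VX e f ->
  ((forall i j, (i <= j)%N -> le01 (z i) (z j)) \/ (forall i j, (i <= j)%N -> le01 (z j) (z i))) ->
  comb_norm e n (fun i => f (z i.+1) - f (z i)) <= fine (VX_norm e f).
Proof.
move=> fV [zm|zm]; first exact: nondecreasing_incr.
pose z' i := z (n - i)%N.
have zm' i j : (i <= j)%N -> le01 (z' i) (z' j) by move=> ij; apply: zm; rewrite leq_sub2l.
apply: le_trans (nondecreasing_incr n fV zm').
rewrite -(comb_norm_sign he n _ (fun=> true)).
rewrite /comb_norm -(comb_norm_perm he (perm (@rev_ord_inj n))
  (fun i => (-1) ^+ true * (f (z (nat_of_ord i).+1) - f (z i)))).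
apply/eq_ler; congr (`|_|); apply: eq_bigr => i _; congr (_ *: _).
rewrite permE /= expr1 mulN1r opprB /z'.
by congr (f (z _) - f (z _)); have := ltn_ord i; lia.
Qed.

Lemma continuous_of_diff_semicontinuous (f : I01 R -> R) : VX e f ->
  diff_bounded_semicontinuous (fun k : dual_ball V => VX_bidual he f (\val k)) ->
  continuous f.
Proof.
move=> fV [u [v [bu bv lu lv uvE]]].
apply/I01_continuousP => t eps eps0; apply: contrapT => hn.
have osc d : 0 < d -> exists y, `|\val t - \val y| < d /\ eps <= `|f t - f y|.
  move=> d0; apply: contrapT => hy; apply: hn; exists d => // y ty.
  by rewrite ltNge; apply/negP => ey; apply: hy; exists y.
(* Points on one fixed side of t are needed to keep the sequences monotone; if both sides were
   harmless, the smaller of the two radii would contradict [osc]. *)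
have [sg side] : exists sg : bool, forall d, 0 < d -> exists y,
    [/\ 0 < (-1) ^+ sg * (\val y - \val t), (-1) ^+ sg * (\val y - \val t) < d &
      eps <= `|f t - f y|].
  apply: contrapT => hside.
  have bad (sg : bool) : exists2 d : R, 0 < d & forall y,
      0 < (-1) ^+ sg * (\val y - \val t) -> (-1) ^+ sg * (\val y - \val t) < d ->
      `|f t - f y| < eps.
    apply: contrapT => hb; apply: hside; exists sg => d d0.
    apply: contrapT => hy; apply: hb; exists d => // y y1 y2.
    by rewrite ltNge; apply/negP => ey; apply: hy; exists y.
  have [d d0 hd] := bad false; have [d' d'0 hd'] := bad true.
  have [|y [ty ey]] := osc (Num.min d d'); first by rewrite lt_min d0.
  move: ty; rewrite lt_min distrC => /andP[t1 t2].
  have [yt|ty|yt] := ltgtP (\val y) (\val t).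
  - have := hd' y; rewrite expr1 mulN1r opprB subr_gt0 => /(_ yt).
    by rewrite ltr0_norm ?subr_lt0// opprB in t2; move=> /(_ t2); rewrite ltNge ey.
  - have := hd y; rewrite expr0 mul1r subr_gt0 => /(_ ty).
    by rewrite gtr0_norm ?subr_gt0// in t1; move=> /(_ t1); rewrite ltNge ey.
  - by move: ey; rewrite (val_inj yt) subrr normr0 leNgt eps0.
have bex (w : dual_ball V -> R) : bounded_fun w -> exists2 M : R, 0 <= M & forall k, `|w k| <= M.
  move=> [M [_ hM]]; exists (`|M| + 1); first by rewrite addr_ge0.
  by move=> k; apply: hM => //; rewrite ltr_pwDr// ler_norm.
have [Mu Mu0 hMu] := bex u bu; have [Mv Mv0 hMv] := bex v bv.
(* u + v starts at or above -(Mu + Mv), ends at or below Mu + Mv and gains L_N eps/2 in total; this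
   is impossible once L_N eps > 4 (Mu + Mv). *)
have [N0 hN0] := fundamental_unbounded he hX (4 * (Mu + Mv) / eps).
have N00 : (0 < N0)%N.
  rewrite lt0n; apply: contraTneq hN0 => ->.
  by rewrite -leNgt /fundamental /comb_norm big_ord0 normr0 divr_ge0 ?mulr_ge0 ?addr_ge0// ltW.
pose N := (N0.*2)%N; have hN : 4 * (Mu + Mv) / eps < fundamental e N.
  by apply: lt_le_trans hN0 (comb_norm_leq he _ _); rewrite /N -addnn leq_addr.
have NN : 0 < N%:R :> R by rewrite ltr0n double_gt0.
have lN : 0 < fundamental e N.
  by apply: le_lt_trans hN; rewrite divr_ge0 ?mulr_ge0 ?addr_ge0// ltW.
pose b := fundamental e N / N%:R; have b0 : 0 < b by rewrite divr_gt0.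
pose y z : dual V := \sum_(j < N) ((-1) ^+ j * b) *: delta he (z j).
(* The points approach t as the index grows, so those still at t come last and the next one to move
   can be put between t and its predecessor. *)
pose mono z := (forall i j, (i <= j)%N -> 0 <= (-1) ^+ sg * (\val (z i) - \val (z j))) /\
  (forall i, 0 <= (-1) ^+ sg * (\val (z i) - \val t)).
have yE z g : y z g = b * \sum_(j < N) (-1) ^+ j * g (z j).
  rewrite /y mulr_sumr; elim: (N) => [|n IH]; first by rewrite !big_ord0.
  rewrite !big_ord_recr /= -IH -[LHS]/(_ + (-1) ^+ n * b * g (z n)).
  by congr (_ + _); rewrite -mulrA mulrCA.
have yball z : mono z -> dual_ball V (y z).
  move=> [zm _]; apply: dual_norm_ge => g g1; rewrite yE normrM (gtr0_norm b0).
  have dm : (forall i j, (i <= j)%N -> le01 (z i) (z j)) \/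
      (forall i j, (i <= j)%N -> le01 (z j) (z i)).
    case: (sg) zm => zm; [left|right] => i j /zm.
      by rewrite expr1 mulN1r opprB subr_ge0.
    by rewrite expr0 mul1r subr_ge0.
  have h1 := monotone_incr N (VX0_funVX g) dm.
  (* Keeping every other increment pairs z_(2i) with z_(2i+1), so these increments add up to minus
     the alternating sum; [comb_norm_mean] then gives the factor L_N/N. *)
  pose a i := if odd i then 0 else g (z i.+1) - g (z i).
  have h2 : comb_norm e N a <= `|g|.
    apply: le_trans h1; apply: (comb_norm_le he) => i _; rewrite /a.
    by case: ifP => // _; rewrite normr0.
  have sa : \sum_(i < N) a i = - \sum_(j < N) (-1) ^+ j * g (z j).
    rewrite /N; elim: (N0) => [|n IH]; first by rewrite !big_ord0 oppr0.
    rewrite doubleS !big_ord_recr /= IH /a /= odd_double /= addr0 !opprD.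
    by rewrite exprS -signr_odd odd_double expr0 mul1r mulr1 mulN1r opprK -addrA (addrC (g _)).
  rewrite -normrN -sa /b mulrC mulrA ler_pdivrMr// mul1r.
  apply: le_trans (comb_norm_mean he N a) _; rewrite ler_piMr ?(ltW NN)//.
  exact: le_trans h2 g1.
pose K z (zm : mono z) : dual_ball V := exist _ (y z) (mem_set (yball z zm)).
pose W k := u k + v k.
have FE z (zm : mono z) : u (K z zm) - v (K z zm) = b * \sum_(j < N) (-1) ^+ j * f (z j).
  have := congr1 (fun w => w (K z zm)) uvE; rewrite /= => <-.
  rewrite /y dual_sum mulr_sumr; apply: eq_bigr => i _.
  by rewrite dualZ VX_bidual_delta// -mulrA mulrCA.
have change (h : I01 R -> R) z z' n : (n < N)%N -> (forall i, i != n -> z' i = z i) ->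
    \sum_(j < N) (-1) ^+ j * h (z' j) =
    \sum_(j < N) (-1) ^+ j * h (z j) + (-1) ^+ n * (h (z' n) - h (z n)).
  move=> nN zz; rewrite (bigD1 (Ordinal nN))//= [X in _ = X + _](bigD1 (Ordinal nN))//=.
  rewrite (eq_bigr (fun j : 'I_N => (-1) ^+ j * h (z j))) => [|j jn]; last by rewrite zz.
  by rewrite mulrBr [RHS]addrAC addrCA subrr addr0.
(* By semicontinuity u and v each lose at most b * eps / 4 when z_n moves
   slightly off t, while u - v changes by b * eps; so u + v gains b * eps / 2. *)
have step n : (n <= N)%N -> exists z, exists zm : mono z,
   [/\ forall i, (n <= i)%N -> z i = t, forall i, (i < n)%N -> 0 < (-1) ^+ sg * (\val (z i) - \val t)
   & - (Mu + Mv) + n%:R * (b * eps / 2) <= W (K z zm)].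
  elim: n => [_|n IH nN].
    have tm : mono (fun=> t).
      by split=> [i j _|i]; rewrite subrr mulr0.
    exists (fun=> t), tm; split=> //; rewrite mul0r addr0.
    have := hMu (K _ tm); have := hMv (K _ tm); rewrite !ler_norml /W; lra.
  have [z [zm [zt zp hz]]] := IH (ltnW nN).
  (* The distance from t to the point moved last, or 1 when none has moved. *)
  pose d : R := if n is n'.+1 then (-1) ^+ sg * (\val (z n') - \val t) else 1.
  have d0 : 0 < d by rewrite /d; case: (n) zp => // n' zp; exact: zp.
  have ex m : {s | [/\ 0 < (-1) ^+ sg * (\val s - \val t),
      (-1) ^+ sg * (\val s - \val t) < Num.min d m.+1%:R^-1 & eps <= `|f t - f s|]}.
    by apply: cid; apply: side; rewrite lt_min d0 invr_gt0 /= ltr0Sn.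
  pose s m := sval (ex m).
  have s1 m : 0 < (-1) ^+ sg * (\val (s m) - \val t) by have [] := svalP (ex m).
  have s2 m : (-1) ^+ sg * (\val (s m) - \val t) < d.
    by have [_ + _] := svalP (ex m); rewrite lt_min => /andP[].
  have s3 m : (-1) ^+ sg * (\val (s m) - \val t) < m.+1%:R^-1.
    by have [_ + _] := svalP (ex m); rewrite lt_min => /andP[].
  have s4 m : eps <= `|f t - f (s m)| by have [] := svalP (ex m).
  pose zz m i := if i == n then s m else z i.
  have zzE m i : i != n -> zz m i = z i by rewrite /zz => /negbTE->.
  have zzn m : zz m n = s m by rewrite /zz eqxx.
  have mm m : mono (zz m).
    split=> [i j ij|i]; last first.
      by rewrite /zz; case: eqP => _; [exact: ltW|exact: zm.2].
    have [ni|ni] := eqVneq i n; have [nj|nj] := eqVneq j n.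
    - by rewrite ni nj subrr mulr0.
    - by rewrite ni zzn zzE// zt -?ni//; exact: ltW.
    - rewrite nj zzn zzE//; have := s2 m; rewrite /d; move: ij ni; rewrite nj.
      case: (n) => [|n'] ij ni h; first by move: ij; rewrite leqn0 (negbTE ni).
      have ij' : (i <= n')%N by rewrite -ltnS ltn_neqAle ni.
      have := zm.1 i n' ij'; move: h; rewrite !mulrBr.
      move: (_ * \val (s m)) (_ * \val t) (_ * \val (z n')) (_ * \val (z i)).
      by move=> x1 x2 x3 x4 ? ?; rewrite subr_ge0; lra.
    - by rewrite !zzE//; exact: zm.1.
  have scvg (g : V) : g (s m) @[m --> \oo] --> g t.
    apply/cvgrPdist_le => d' d'0; have [eta eta0 heta] := VX0_unif_continuous he (V_VX0 g) d'0.
    apply: filterS (near_infty_natSinv_lt (PosNum eta0)) => m /= hm; apply: heta.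
    rewrite distrC; apply: ltW; apply: lt_trans hm; apply: le_lt_trans (s3 m).
    by rewrite -[leLHS](ger0_norm (normr_ge0 _)) -(gtr0_norm (s1 m)) normrM normr_sign mul1r normr_id.
  have kc : K (zz m) (mm m) @[m --> \oo] --> K z zm.
    apply: dual_ball_cvg => g.
    rewrite (_ : (fun m => _) = (fun m => y z g + b * ((-1) ^+ n * (g (s m) - g t)))); last first.
      apply/funext => m; rewrite -[LHS]/(y (zz m) g) !yE.
      by rewrite (change g z (zz m) n nN (zzE m)) mulrDr zzn zt.
    have cc (a : R) : a + b * ((-1) ^+ n * (g (s m) - g t)) @[m --> \oo] -->
        a + b * ((-1) ^+ n * (g t - g t)).
      apply: cvgD; first exact: cvg_cst.
      apply: cvgM; first exact: cvg_cst.
      apply: cvgM; first exact: cvg_cst.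
      by apply: cvgB; [exact: scvg|exact: cvg_cst].
    by have := cc (y z g); rewrite subrr !mulr0 addr0; exact.
  pose c := b * eps / 4; have c0 : 0 < c by rewrite divr_gt0// mulr_gt0.
  have [Wu nWu hWu] := lu (K z zm) (u (K z zm) - c) ltac:(by rewrite lte_fin ltrBlDr ltrDl).
  have [Wv nWv hWv] := lv (K z zm) (v (K z zm) - c) ltac:(by rewrite lte_fin ltrBlDr ltrDl).
  have nW : \forall m \near \oo, Wu (K (zz m) (mm m)) /\ Wv (K (zz m) (mm m)).
    exact: filterI (kc _ nWu) (kc _ nWv).
  have [m [hu hv]] := filter_ex nW.
  have {hu}hu := hWu _ hu; have {hv}hv := hWv _ hv; rewrite !lte_fin in hu hv.
  exists (zz m), (mm m); split=> [i ni|i ni|].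
  - by rewrite zzE ?zt ?(ltnW ni)// gtn_eqF.
  - rewrite /zz; case: eqP => [_|ni']; first exact: s1.
    by apply: zp; move: ni; rewrite ltnS leq_eqVlt => /predU1P[].
  have D : b * eps <= `|(u (K (zz m) (mm m)) - v (K (zz m) (mm m))) - (u (K z zm) - v (K z zm))|.
    rewrite !FE (change f z (zz m) n nN (zzE m)) -mulrBr addrC addKr normrM gtr0_norm//.
    by rewrite ler_pM2l// normrM normr_sign mul1r zzn zt// distrC.
  apply: (@le_trans _ _ (W (K z zm) + b * eps / 2)).
    by move: hz; rewrite -natr1; lra.
  move: D hu hv; rewrite /W /c ler_normr => /orP[]; lra.
have [z [zm [_ _ hz]]] := step N (leqnn N).
have h1 : W (K z zm) <= Mu + Mv.
  have := hMu (K _ zm); have := hMv (K _ zm); rewrite !ler_norml /W; lra.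
have h2 : N%:R * (b * eps / 2) = fundamental e N * eps / 2.
  have bN : N%:R * b = fundamental e N by rewrite mulrC divfK// gt_eqF.
  by rewrite -bN !mulrA.
move: hN; rewrite ltr_pdivrMr// => hN; rewrite h2 in hz.
have fin (S L w : R) : - S + L / 2 <= w -> w <= S -> 4 * S < L -> False.
  by clear; lra.
exact: fin hz h1 hN.
Qed.

End SemicontinuousDifference.

(** * Approximation by functions monotone on cells *)

Section MonotoneInterpolation.
Context {R : realType}.
Implicit Types (p : I01 R * I01 R) (f g : I01 R -> R).

Lemma uniform_continuous f : continuous f -> forall eps : R, 0 < eps ->
  exists2 eta : R, 0 < eta & forall x y, `|\val x - \val y| <= eta -> `|f x - f y| <= eps.
Proof.
move=> /I01_continuousP cf eps eps0; apply: contrapT => hn.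
have ex n : {xy : I01 R * I01 R | `|\val xy.1 - \val xy.2| <= n.+1%:R^-1 /\
    eps < `|f xy.1 - f xy.2|}.
  apply: cid; apply: contrapT => h; apply: hn; exists n.+1%:R^-1; first by rewrite invr_gt0.
  move=> x y xy; rewrite leNgt; apply/negP => exy; apply: h.
  by exists (x, y).
pose x n := (sval (ex n)).1; pose y n := (sval (ex n)).2.
have xy n : `|\val (x n) - \val (y n)| <= n.+1%:R^-1 by have [] := svalP (ex n).
have fxy n : eps < `|f (x n) - f (y n)| by have [] := svalP (ex n).
have [U [UU oU]] := ultraFilterLemma (@eventually_filter).
have [t tc] := I01_ulim UU x.
have e2 : 0 < eps / 2 by rewrite divr_gt0.
have [d d0 hd] := cf t (eps / 2) e2.
have d2 : 0 < d / 2 by rewrite divr_gt0.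
have h1 : U [set n | `|\val t - \val (x n)| < d / 2].
  by move/cvgrPdist_lt: tc => /(_ _ d2).
have h2 : U [set n | n.+1%:R^-1 < d / 2].
  by apply: oU; exact: (near_infty_natSinv_lt (PosNum d2)).
have [n [/= hx hn']] := filter_ex (filterI h1 h2).
have fx : `|f t - f (x n)| < eps / 2.
  by apply: hd; apply: lt_trans hx _; rewrite ltr_pdivrMr// ltr_pMr// ltr1n.
have fy : `|f t - f (y n)| < eps / 2.
  apply: hd; rewrite -(subrK (\val (x n)) (\val t)) -addrA [ltRHS]splitr.
  by apply: le_lt_trans (ler_normD _ _) _; apply: ltrD hx _; exact: le_lt_trans (xy n) hn'.
have := fxy n; rewrite ltNge => /negP; apply.
rewrite -(subrK (f t) (f (x n))) -addrA [leRHS]splitr.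
apply: le_trans (ler_normD _ _) _; apply: lerD; last exact: ltW.
by rewrite distrC ltW.
Qed.

Lemma continuous_bounded f : continuous f -> exists M : R, forall t, `|f t| <= M.
Proof.
move=> cf; apply: contrapT => hn.
have ex n : {x : I01 R | n%:R < `|f x|}.
  apply: cid; apply: contrapT => h; apply: hn; exists n%:R => t.
  by rewrite leNgt; apply/negP => ht; apply: h; exists t.
pose x n := sval (ex n).
have [U [UU oU]] := ultraFilterLemma (@eventually_filter).
have [t tc] := I01_ulim UU x.
have /I01_continuousP/(_ t 1 ltr01)[d d0 hd] := cf.
have h1 : U [set n | `|\val t - \val (x n)| < d] by move/cvgrPdist_lt: tc => /(_ _ d0).
have h2 : U [set n | `|f t| + 1 <= n%:R].
  by apply: oU; apply: nbhs_infty_ger.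
have [n [/= hx hn']] := filter_ex (filterI h1 h2).
have := svalP (ex n); rewrite -/(x n) ltNge => /negP; apply; apply: le_trans hn'.
rewrite -{1}(subrK (f t) (f (x n))) addrC; apply: le_trans (ler_normD _ _) _.
by rewrite lerD2l distrC ltW// hd.
Qed.

Definition runmax g p s : R := sup [set g r | r in [set r | le01 p.1 r /\ le01 r s]].

(** Inside the cell g may exceed [g p.2]. The cap makes the climb end exactly at [g p.2 - g p.1], so
    that the contributions of successive cells fit together. *)
Definition climb g p t : R := Num.min (runmax g p (clip p.1 p.2 t)) (g p.2) - g p.1.

Section Climb.
Variables (g : I01 R -> R) (p : I01 R * I01 R) (M : R).
Hypothesis gM : forall t, `|g t| <= M.
Hypothesis p12 : le01 p.1 p.2.
Hypothesis gp : g p.1 <= g p.2.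

Lemma runmax_has_sup s : le01 p.1 s ->
  has_sup [set g r | r in [set r | le01 p.1 r /\ le01 r s]].
Proof.
move=> ps; split; first by exists (g p.1), p.1 => //=; split=> //; exact: lexx.
by exists M => _ [r _ <-]; apply: le_trans (ler_norm _) (gM r).
Qed.

Lemma runmax_ge s r : le01 p.1 r -> le01 r s -> g r <= runmax g p s.
Proof.
move=> pr rs; apply: ub_le_sup; last by exists r.
exact: (runmax_has_sup (le_trans pr rs)).2.
Qed.

Lemma runmax_le s c : le01 p.1 s -> (forall r, le01 p.1 r -> le01 r s -> g r <= c) ->
  runmax g p s <= c.
Proof.
move=> ps h; apply: ge_sup; first exact: (runmax_has_sup ps).1.
by move=> _ [r /= [pr rs] <-]; exact: h.
Qed.

Lemma climb_left t : le01 t p.1 -> climb g p t = 0.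
Proof.
move=> tp; rewrite /climb clip_left//.
have -> : runmax g p p.1 = g p.1.
  apply/eqP; rewrite eq_le; apply/andP; split; last by apply: runmax_ge; exact: lexx.
  apply: runmax_le; first exact: lexx.
  by move=> r pr rp; have -> : r = p.1 by apply/val_inj/le_anti; apply/andP; split; [exact: rp|exact: pr].
by rewrite (min_idPl gp) subrr.
Qed.

Lemma climb_right t : le01 p.2 t -> climb g p t = g p.2 - g p.1.
Proof.
move=> pt; rewrite /climb clip_right//; congr (_ - _).
by apply/min_idPr; apply: runmax_ge => //; exact: lexx.
Qed.

Lemma climb_mono t t' : le01 t t' -> climb g p t <= climb g p t'.
Proof.
move=> tt'; rewrite /climb lerD2r le_min ge_min ge_min lexx orbT andbT.
apply/orP; left; apply: runmax_le; first exact: clip_ge.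
move=> r pr rt; apply: runmax_ge => //.
exact: le_trans rt (clip_lip p12 tt').1.
Qed.

Lemma climb_bounds t : 0 <= climb g p t <= g p.2 - g p.1.
Proof.
apply/andP; split.
  have [tp|pt] := leP (\val t) (\val p.1); first by rewrite climb_left.
  by rewrite -(climb_left (lexx _)); apply: climb_mono; exact: ltW.
by rewrite /climb lerD2r ge_min lexx orbT.
Qed.

(** Let s and s' be the clipped points and D > 0 the growth. If g stayed below g s + D/2 between
    them, the running maximum, which is at least g s, could grow by D/2 at most. The factor 2 avoids
    the question whether a maximum is attained. *)
Lemma climb_local t t' : le01 t t' -> exists a b,
  [/\ le01 t a, le01 a b, le01 b t' & climb g p t' - climb g p t <= 2 * `|g b - g a|].
Proof.
move=> tt'; have := climb_mono tt'; rewrite -subr_ge0 le_eqVlt => /predU1P[D0|D0].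
  by exists t, t; split; rewrite -?D0 ?mulr_ge0//; exact: lexx.
set D := climb g p t' - climb g p t in D0 *.
have tp : lt01 t p.2.
  rewrite /lt01 ltNge; apply/negP => h; move: D0; rewrite /D !climb_right ?subrr ?ltxx//.
  exact: le_trans h tt'.
have pt' : lt01 p.1 t'.
  rewrite /lt01 ltNge; apply/negP => h; move: D0; rewrite /D !climb_left ?subrr ?ltxx//.
  exact: le_trans tt' h.
pose s := clip p.1 p.2 t; pose s' := clip p.1 p.2 t'.
have ts : le01 t s.
  have [h|h] := leP (\val t) (\val p.1); first by rewrite /s clip_left.
  have pt : le01 p.1 t := ltW h.
  by rewrite /s (clip_id pt (ltW tp)); exact: lexx.
have st' : le01 s' t'.
  have [h|h] := leP (\val p.2) (\val t'); first by rewrite /s' clip_right.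
  have tp' : le01 t' p.2 := ltW h.
  by rewrite /s' (clip_id (ltW pt') tp'); exact: lexx.
have ss' : le01 s s' by exact: (clip_lip p12 tt').1.
have ps : le01 p.1 s by exact: clip_ge.
apply: contrapT => hn.
have small r : le01 s r -> le01 r s' -> g r <= g s + D / 2.
  move=> sr rs'; rewrite leNgt; apply/negP => hr; apply: hn; exists s, r; split=> //.
    exact: le_trans rs' st'.
  have := ler_norm (g r - g s); lra.
have RR : runmax g p s' <= runmax g p s + D / 2.
  apply: runmax_le; first exact: le_trans ps ss'.
  move=> r pr rs'; have [rs|sr] := leP (\val r) (\val s).
    by apply: (le_trans (runmax_ge pr rs)); rewrite lerDl ltW// divr_gt0.
  apply: le_trans (small r (ltW sr) rs') _; rewrite lerD2r.
  by apply: runmax_ge => //; exact: lexx.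
have : D <= D / 2; last by have := D0; lra.
rewrite {1}/D /climb -/s -/s' opprB addrA subrK.
have D2 : 0 < D / 2 by rewrite divr_gt0.
move: (runmax g p s) (runmax g p s') (g p.2) (D / 2) RR D2 => x y z w RR D2.
by case: (leP y z) => ?; case: (leP x z) => ?; lra.
Qed.

End Climb.

(* On each cell the interpolant follows the running maximum (or minimum) of f,
   so that it only moves when f does: its increments are controlled by the
   oscillation of f on the same interval, at every scale. *)
Definition cell_interp f p t : R :=
  if f p.1 <= f p.2 then climb f p t else - climb (fun t => - f t) p t.

Section CellInterp.
Variables (f : I01 R -> R) (p : I01 R * I01 R).
Hypothesis cf : continuous f.
Hypothesis p12 : le01 p.1 p.2.

Lemma cell_interp_climb : exists (g : I01 R -> R) (M : R) (sg : bool),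
  [/\ forall t, `|g t| <= M, g p.1 <= g p.2, forall t, g t = (-1) ^+ sg * f t &
      forall t, cell_interp f p t = (-1) ^+ sg * climb g p t].
Proof.
have [M hM] := continuous_bounded cf.
rewrite /cell_interp; have [h|h] := leP (f p.1) (f p.2).
  by exists f, M, false; split=> // t; rewrite expr0 mul1r.
exists (fun t => - f t), M, true; split=> [t||t|t]; rewrite ?expr1 ?mulN1r//.
- by rewrite normrN.
- by rewrite lerN2 ltW.
Qed.

Lemma sign_dist (sg : bool) (a b : R) : `|(-1) ^+ sg * a - (-1) ^+ sg * b| = `|a - b|.
Proof. by rewrite -mulrBr normrM normr_sign mul1r. Qed.

Lemma cell_interp_left t : le01 t p.1 -> cell_interp f p t = 0.
Proof.
move=> tp; have [g [M [sg [gM gp _ ->]]]] := cell_interp_climb.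
by rewrite (climb_left gM p12 gp tp) ?mulr0.
Qed.

Lemma cell_interp_right t : le01 p.2 t -> cell_interp f p t = f p.2 - f p.1.
Proof.
move=> pt; have [g [M [sg [gM gp gE ->]]]] := cell_interp_climb.
by rewrite (climb_right gM p12 pt) !gE -mulrBr signrMK.
Qed.

Lemma cell_interp_le (w : R) t : `|f p.2 - f p.1| <= w -> `|cell_interp f p t| <= w.
Proof.
apply: le_trans; have [g [M [sg [gM gp gE ->]]]] := cell_interp_climb.
have /andP[h1 h2] := climb_bounds gM p12 gp t.
by rewrite -(sign_dist sg) -!gE normrM normr_sign mul1r ger0_norm// (le_trans h2)// ler_norm.
Qed.

Lemma cell_interp_local t t' : le01 t t' -> exists a b,
  [/\ le01 t a, le01 a b, le01 b t' & `|cell_interp f p t' - cell_interp f p t| <= 2 * `|f b - f a|].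
Proof.
move=> tt'; have [g [M [sg [gM gp gE cE]]]] := cell_interp_climb.
have [a [b [h1 h2 h3 h4]]] := climb_local gM p12 gp tt'.
exists a, b; split=> //; rewrite !cE sign_dist -(sign_dist sg (f b)) -!gE ger0_norm//.
by rewrite subr_ge0 (climb_mono gM p12).
Qed.

End CellInterp.

Lemma cell_interp_V {X : normedModType R} {e : nat -> X} (he : symmetric_basis e)
    (hX : reflexive_space X) f p : continuous f -> le01 p.1 p.2 ->
  exists g : VX0_space he, forall t, g t = cell_interp f p t.
Proof.
move=> cf p12; have [g [M [sg [gM gp gE cE]]]] := cell_interp_climb p cf.
have [G GE] : exists G : VX0_space he, forall t, G t = climb g p t; last first.
  by exists ((-1) ^+ sg *: G) => t; rewrite cE -GE.
apply: V_ex; apply: (monotone_VX0 he hX).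
- by apply: (climb_left gM p12 gp); exact: I01_ge0.
- by move=> x y; exact: (climb_mono gM p12).
move=> eps eps0; have e2 : 0 < eps / 2 by rewrite divr_gt0.
have [eta eta0 heta] := uniform_continuous cf e2; exists eta => // x y xy hxy.
have [a [b [h1 h2 h3 h4]]] := climb_local gM p12 gp xy.
apply: le_trans h4 _; rewrite mulrC -ler_pdivlMr// !gE sign_dist; apply: heta.
have ab : le01 a b by exact: h2.
by rewrite ger0_norm ?subr_ge0//; apply: le_trans hxy; apply: lerB; [exact: h3|exact: h1].
Qed.

End MonotoneInterpolation.

(** * Monotone interpolation over a whole partition *)

Section MonoInterp.
Context {R : realType}.
Variable f : I01 R -> R.
Hypothesis cf : continuous f.
Local Notation S := (fun x l t => \sum_(p <- cells x l) cell_interp f p t).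

Lemma sum_cell_left x l t : path (@le01 R) x l -> le01 t x -> S x l t = 0.
Proof.
elim: l x => [|y l IH] x; first by rewrite /= big_nil.
move=> /= /andP[xy yl] tx; rewrite big_cons cell_interp_left// add0r IH//.
exact: le_trans tx xy.
Qed.

(** Finds the cell containing t: the cells before it telescope and those after it contribute 0. [Q]
    transports what is known about the cells; it has to hold for degenerate pairs because these are
    the answer for an empty list. *)
Lemma sum_cell_right x l t (Q : I01 R * I01 R -> Prop) : path (@le01 R) x l ->
  le01 x t -> le01 t (last x l) -> (forall y, Q (y, y)) -> (forall p, p \in cells x l -> Q p) ->
  exists p, [/\ Q p, le01 x p.1, le01 p.1 t, le01 t p.2 &
    S x l t = f p.1 - f x + cell_interp f p t].
Proof.
elim: l x => [|y l IH] x /=.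
  move=> _ xt tx Q0 _; exists (x, x); split=> //=; first exact: lexx.
  by rewrite big_nil cell_interp_right//= ?subrr ?addr0//; exact: lexx.
move=> /andP[xy yl] xt tl Q0 QQ; rewrite big_cons.
have [ty|yt] := leP (\val t) (\val y).
  exists (x, y); split=> //=; first by apply: QQ; rewrite inE eqxx.
    exact: lexx.
  by rewrite sum_cell_left// subrr add0r addr0.
have [|p [Qp yp pt tp ->]] := IH y yl (ltW yt) tl Q0.
  by move=> p pl; apply: QQ; rewrite inE pl orbT.
exists p; split=> //; first exact: le_trans xy yp.
by rewrite cell_interp_right ?(ltW yt)//=; [ring|exact: ltW].
Qed.

Lemma cells_le x (l : seq (I01 R)) p : path (@le01 R) x l -> p \in cells x l -> le01 p.1 p.2.
Proof.
elim: l x => [|y l IH] x //= /andP[xy yl]; rewrite inE => /predU1P[->//|].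
exact: IH.
Qed.

(** The constant 5 is 2 + 1 + 2: a partial cell at either end costs twice an increment of f, and the
    complete cells between them telescope to a single increment. The largest of the three increments
    supplies a and b. *)
Lemma sum_cell_local x l t t' : path (@le01 R) x l -> le01 x t -> le01 t t' ->
  le01 t' (last x l) -> exists a b,
  [/\ le01 t a, le01 a b, le01 b t' & `|S x l t' - S x l t| <= 5 * `|f b - f a|].
Proof.
elim: l x => [|y l IH] x /=.
  move=> _ xt tt' t'x; exists t, t; split; [exact: lexx|exact: lexx|exact: tt'|].
  by rewrite !big_nil !subrr normr0 mulr0.
move=> /andP[xy yl] xt tt' t'l; rewrite !big_cons.
have [t'y|yt'] := leP (\val t') (\val y).
  have [a [b [ta ab bt h]]] := @cell_interp_local _ f (x, y) cf xy _ _ tt'.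
  exists a, b; split=> //; rewrite !sum_cell_left ?addr0//; last exact: le_trans tt' t'y.
  apply: le_trans h _; rewrite ler_wpM2r//; lra.
have [ty|yt] := leP (\val t) (\val y); last first.
  have [a [b [ta ab bt h]]] := IH y yl (ltW yt) tt' t'l.
  exists a, b; split=> //; rewrite !cell_interp_right//=; last 2 first.
  - exact: ltW.
  - exact: ltW.
  by rewrite opprD addrACA subrr add0r.
have [y'|p pl|p [pp yp pt' tp ->]] :=
    @sum_cell_right y l t' (fun p => le01 p.1 p.2) yl (ltW yt') t'l.
- exact: lexx.
- exact: cells_le pl.
rewrite (sum_cell_left yl ty) addr0.
have xy' : le01 (x, y).1 (x, y).2 by [].
have [a1 [b1 [ta1 ab1 bt1]]] := cell_interp_local cf xy' ty.
have [a2 [b2 [ta2 ab2 bt2]]] := cell_interp_local cf pp pt'.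
rewrite (cell_interp_left cf pp (lexx _)) subr0.
rewrite (@cell_interp_right _ f (x, y) cf xy y)/=; last exact: lexx.
rewrite (@cell_interp_right _ f (x, y) cf xy t')/=; last exact: ltW.
set c := cell_interp f (x, y) t; set c' := cell_interp f p t' => h2 h1.
have -> : f y - f x + (f p.1 - f y + c') - c = (f y - f x - c) + (f p.1 - f y) + c' by ring.
pose N a b := `|f b - f a|.
have H w : N a1 b1 <= w -> N y p.1 <= w -> N a2 b2 <= w ->
    `|(f y - f x - c) + (f p.1 - f y) + c'| <= 5 * w.
  move=> w1 w2 w3; apply: le_trans (ler_normD _ _) _.
  have := ler_normD (f y - f x - c) (f p.1 - f y); move: w1 w2 w3 h1 h2; rewrite /N.
  by clear; lra.
have yt'' : le01 y t' by exact: ltW.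
have [m12|m12] := leP (N a1 b1) (N y p.1); have [m23|m23] := leP (N y p.1) (N a2 b2).
- exists a2, b2; split=> //; first exact: le_trans ty (le_trans yp ta2).
  by apply: H => //; exact: le_trans m12 m23.
- exists y, p.1; split=> //; apply: H => //; exact: ltW.
- have [m13|m13] := leP (N a1 b1) (N a2 b2).
    exists a2, b2; split=> //; first exact: le_trans ty (le_trans yp ta2).
    exact: H.
  exists a1, b1; split=> //; first exact: le_trans bt1 yt''.
  by apply: H => //; exact: ltW.
- exists a1, b1; split=> //; first exact: le_trans bt1 yt''.
  by apply: H => //; [exact: ltW|exact: ltW (lt_trans m23 m12)].
Qed.

Lemma mono_interp {X : normedModType R} {e : nat -> X} (he : symmetric_basis e)
    (hX : reflexive_space X) (w : R) : f (@zero01 R) = 0 -> 0 < w ->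
  exists g : VX0_space he, (forall t, `|g t - f t| <= w) /\
    forall t t', le01 t t' -> exists a b,
      [/\ le01 t a, le01 a b, le01 b t' & `|g t' - g t| <= 5 * `|f b - f a|].
Proof.
move=> f0 w0; have w2 : 0 < w / 2 by rewrite divr_gt0.
have [eta eta0 heta] := uniform_continuous cf w2.
have [l [pl ll /allP al]] := @subdivide R zero01 one01 eta eta0 ltr01.
have pl' : path (@le01 R) (@zero01 R) l by apply: sub_path pl => x y; exact: ltW.
have osc p : p \in cells (@zero01 R) l ->
    le01 p.1 p.2 /\ forall t, le01 p.1 t -> le01 t p.2 -> `|f t - f p.1| <= w / 2.
  move=> pp; split=> [|t pt tp]; first by apply: ltW; exact: cells_lt pp.
  apply: heta; rewrite ger0_norm ?subr_ge0//; apply: le_trans (al _ pp).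
  exact: lerB.
have gex (x : I01 R) (l' : seq (I01 R)) : path (@le01 R) x l' ->
    exists g : VX0_space he, forall t, g t = S x l' t.
  elim: l' x => [|y l' IH] x /=; first by exists 0 => t; rewrite big_nil.
  move=> /andP[xy yl]; have [g gE] := IH _ yl.
  have [h hE] := @cell_interp_V R X e he hX f (x, y) cf xy.
  by exists (h + g) => t; rewrite big_cons -gE -hE.
have [g gE] := gex _ _ pl'; exists g; split=> [t|t t' tt'].
  have := @sum_cell_right _ l t (fun p => le01 p.1 p.2 /\
    forall t, le01 p.1 t -> le01 t p.2 -> `|f t - f p.1| <= w / 2) pl'.
  rewrite ll => /(_ (I01_ge0 t) (I01_le1 t)) [|p pp|p [[pp op] _ pt tp SE]].
  - move=> y; split=> /= [|s ys sy]; first exact: lexx.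
    have -> : s = y by apply/val_inj/le_anti; apply/andP; split; [exact: sy|exact: ys].
    by rewrite subrr normr0 ltW.
  - exact: osc.
  rewrite gE SE f0 subr0 addrAC [w]splitr addrC; apply: le_trans (ler_normD _ _) _.
  apply: lerD; first by apply: cell_interp_le => //; apply: op => //; exact: lexx.
  by rewrite distrC; exact: op.
rewrite !gE; apply: sum_cell_local => //; first exact: I01_ge0.
by rewrite ll; exact: I01_le1.
Qed.

Lemma osc_points : exists u v : I01 R * I01 R -> I01 R,
  (forall p, le01 p.1 p.2 -> [/\ le01 p.1 (u p), le01 (u p) (v p) & le01 (v p) p.2]) /\
  forall p a b, le01 p.1 p.2 -> le01 p.1 a -> le01 a b -> le01 b p.2 ->
    `|f b - f a| <= 2 * `|f (v p) - f (u p)|.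
Proof.
have [M hM] := continuous_bounded cf.
suff ex p : {uv : I01 R * I01 R | le01 p.1 p.2 ->
    [/\ le01 p.1 uv.1, le01 uv.1 uv.2 & le01 uv.2 p.2] /\
    forall a b, le01 p.1 a -> le01 a b -> le01 b p.2 -> `|f b - f a| <= 2 * `|f uv.2 - f uv.1|}.
  exists (fun p => (sval (ex p)).1), (fun p => (sval (ex p)).2).
  by split=> [p pp|p a b pp]; have [h1 h2] := svalP (ex p) pp; [|exact: h2].
apply: cid; have [pp|] := pselect (le01 p.1 p.2); last by exists p.
pose A : set R := [set `|f ab.2 - f ab.1| | ab in [set ab | [/\ le01 p.1 ab.1, le01 ab.1 ab.2 & le01 ab.2 p.2]]].
have ubA : has_ubound A.
  exists (M + M) => _ [ab _ <-]; apply: le_trans (ler_normB _ _) _.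
  by apply: lerD; exact: hM.
have hs : has_sup A.
  by split=> //; exists `|f p.2 - f p.1|, p => //; split=> //; exact: lexx.
have leA a b : le01 p.1 a -> le01 a b -> le01 b p.2 -> `|f b - f a| <= sup A.
  by move=> h1 h2 h3; apply: (ub_le_sup ubA); exists (a, b).
have [s0|s0] := leP (sup A) 0.
  exists p => _; split; first by split=> //; exact: lexx.
  move=> a b h1 h2 h3; apply: le_trans (le_trans (leA _ _ h1 h2 h3) s0) _.
  by rewrite mulr_ge0.
have s2 : 0 < sup A / 2 by rewrite divr_gt0.
have [_ [[u v] /= [h1 h2 h3] <-] h4] := sup_adherent s2 hs.
exists (u, v) => _; split=> //= a b k1 k2 k3; apply: le_trans (leA _ _ k1 k2 k3) _.
move: h4; clear; set x := sup A; move: (`|_|) => y; lra.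
Qed.

End MonoInterp.

(** * Norms of lists of values *)

Section MapNorms.
Context {R : realType} {X : normedModType R} (e : nat -> X) (he : symmetric_basis e).

Lemma seq_norm_mapE (T : Type) (x0 : T) (s : seq T) (a : T -> R) :
  seq_norm e (map a s) = comb_norm e (size s) (fun i => a (nth x0 s i)).
Proof. by rewrite /seq_norm size_map; apply: eq_comb_norm => i si; rewrite (nth_map x0). Qed.

Lemma seq_norm_mapD (T : Type) (s : seq T) (a b : T -> R) :
  seq_norm e [seq a x + b x | x <- s] <= seq_norm e (map a s) + seq_norm e (map b s).
Proof.
case: s => [|x0 s]; last by rewrite !(seq_norm_mapE x0); exact: comb_normD.
by rewrite /seq_norm /comb_norm /= big_ord0 normr0 addr0.
Qed.

Lemma seq_norm_map_sum (T : Type) (s : seq T) K (a : nat -> T -> R) :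
  seq_norm e [seq \sum_(k < K) a k x | x <- s] <= \sum_(k < K) seq_norm e (map (a k) s).
Proof.
case: s => [|x0 s]; first by rewrite /seq_norm /comb_norm /= big_ord0 normr0 sumr_ge0.
rewrite (seq_norm_mapE x0); apply: le_trans (comb_norm_sum _ _ _ _) _.
by apply: ler_sum => k _; rewrite (seq_norm_mapE x0).
Qed.

Lemma seq_norm_map_if (T : Type) (s : seq T) (q : pred T) (a : T -> R) :
  seq_norm e [seq if q x then a x else 0 | x <- s] = seq_norm e [seq a x | x <- s & q x].
Proof.
rewrite -(seq_norm_nz he) -[RHS](seq_norm_nz he); congr (seq_norm e _).
elim: s => //= x s IH; case: (q x) => /=; first by rewrite IH.
by rewrite eqxx.
Qed.

End MapNorms.

Lemma dist4 (R : realFieldType) (x1 x2 x3 x4 a b c : R) :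
  `|x1| <= a -> `|x2| <= a -> `|x3| <= b -> `|x4| <= b -> b <= c -> a <= b ->
  `|x1 - x2 - (x3 - x4)| <= 4 * c.
Proof.
move=> h1 h2 h3 h4 bc ab; have k1 := ler_normB (x1 - x2) (x3 - x4).
have k2 := ler_normB x1 x2; have k3 := ler_normB x3 x4; lra.
Qed.

Lemma telescope2 (R : realType) (h : nat -> R) K :
  \sum_(k < K) (h k.+2 - h k) = h K.+1 + h K - h 1%N - h 0%N.
Proof.
elim: K => [|K IH]; first by rewrite big_ord0; ring.
by rewrite big_ord_recr /= IH; ring.
Qed.

(** * Approximating sequences and the splitting into three scales *)

Section Approximation.
Context {R : realType} {X : normedModType R} {e : nat -> X}.
Variables (he : symmetric_basis e) (hX : reflexive_space X).
Local Notation V := (VX0_space he).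
Variable f : I01 R -> R.
Hypotheses (cf : continuous f) (fV : VX e f).

Lemma V_sum I (r : seq I) (F : I -> V) t : (\sum_(i <- r) F i : V) t = \sum_(i <- r) F i t.
Proof. by elim/big_rec2: _ => // i y x _ <-. Qed.

Definition tracks (g : V) := forall t t', le01 t t' -> exists a b,
  [/\ le01 t a, le01 a b, le01 b t' & `|g t' - g t| <= 5 * `|f b - f a|].

(** The recursion produces G_k together with the next radius, since [d k.+1] must be a mesh at which
    the variation of G_k is already at most [d k]. Halving makes the radii summable. *)
Lemma approximation_sequence : exists (G : nat -> V) (d : nat -> R),
  [/\ d 0%N = 1, forall k, 0 < d k /\ d k.+1 <= d k / 2,
      forall k t, `|G k t - f t| <= d k ^+ 2,
      forall k, tracks (G k) &
      forall k s, partition01 s -> mesh s <= d k.+1 -> alpha e (G k) s <= d k].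
Proof.
have ex (d : R) : {gd : V * R | 0 < d -> [/\ 0 < gd.2, gd.2 <= d / 2,
    forall t, `|gd.1 t - f t| <= d ^+ 2, tracks gd.1 &
    forall s, partition01 s -> mesh s <= gd.2 -> alpha e gd.1 s <= d]}.
  apply: cid; have [d0|] := boolP (0 < d); last by exists (0, 0).
  have dd : 0 < d ^+ 2 by rewrite exprn_gt0.
  have [g [g1 g2]] := mono_interp cf he hX fV.1 dd.
  have [_ /(_ d d0) [eta eta0 heta]] := (VX0P _ _).1 (V_VX0 g).
  exists (g, Num.min eta (d / 2)) => _; split=> //=.
  - by rewrite lt_min eta0 divr_gt0.
  - by rewrite ge_min lexx orbT.
  - by move=> s ps; rewrite le_min => /andP[h _]; exact: heta.
pose d := fix d k := if k is k'.+1 then (sval (ex (d k'))).2 else 1.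
have d0 k : 0 < d k.
  elim: k => [|k IH]; first exact: ltr01.
  by have [] := svalP (ex (d k)) IH.
exists (fun k => (sval (ex (d k))).1), d; split=> // k.
- by split=> //; have [] := svalP (ex (d k)) (d0 k).
- by have [] := svalP (ex (d k)) (d0 k).
- by have [] := svalP (ex (d k)) (d0 k).
- by have [] := svalP (ex (d k)) (d0 k).
Qed.

Section Bound.
Variables (G : nat -> V) (d : nat -> R).
Hypotheses (d1 : d 0%N = 1) (dd : forall k, 0 < d k /\ d k.+1 <= d k / 2).
Hypothesis close : forall k t, `|G k t - f t| <= d k ^+ 2.
Hypothesis track : forall k, tracks (G k).
Hypothesis small : forall k s, partition01 s -> mesh s <= d k.+1 -> alpha e (G k) s <= d k.

Lemma radius_gt0 k : 0 < d k. Proof. exact: (dd k).1. Qed.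

Lemma radius_mono k : d k.+1 <= d k.
Proof. by have [h1 h2] := dd k; move: h1 h2; move: (d k) (d k.+1); move=> *; lra. Qed.

Lemma radius_sum K : \sum_(k < K) d k <= 2.
Proof.
suff : \sum_(k < K) d k <= 2 - 2 * d K.
  by move=> /le_trans; apply; rewrite gerBl mulr_ge0// ltW// radius_gt0.
elim: K => [|K IH]; first by rewrite big_ord0 d1 mulr1 subrr.
rewrite big_ord_recr /=; move: IH (dd K).2; move: (\sum_(i < K) _) (d K) (d K.+1).
by move=> *; lra.
Qed.

Local Notation D k p := (incr (G k.+1) p - incr (G k) p).

(** A cell no longer than [d k.+2] is short for both G_(k+1) and G_k. Each difference contributes at
    most [d k + d k], and the radii sum to at most 2. *)
Lemma incr_small s (sg : nat -> bool) K : path (@le01 R) (@zero01 R) s ->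
  seq_norm e [seq \sum_(k < K) (if len p <= d k.+2 then (-1) ^+ sg k * D k p else 0)
        | p <- cells (@zero01 R) s] <= 4.
Proof.
move=> ps.
apply: le_trans (seq_norm_map_sum e _ K (fun k p =>
  if len p <= d k.+2 then (-1) ^+ sg k * D k p else 0)) _.
apply: (@le_trans _ _ (\sum_(k < K) (d k + d k))); last first.
  rewrite big_split /=; have := radius_sum K; move: (\sum_(k < K) d k).
  by move=> *; lra.
apply: ler_sum => k _; set l := cells _ _.
apply: (@le_trans _ _ (seq_norm e [seq (if len p <= d k.+2 then incr (G k.+1) p else 0) +
    (if len p <= d k.+2 then - incr (G k) p else 0) | p <- l])).
  apply: (seq_norm_map_le he) => p; case: ifP => _; last by rewrite addr0.
  by rewrite normrM normr_sign mul1r.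
apply: le_trans (seq_norm_mapD _ _ _ _) _; apply: lerD.
  rewrite (seq_norm_map_if he); apply: le_trans (path_incr_le he (radius_gt0 _) (@small k.+1) ps) _.
  exact: radius_mono.
apply: (@le_trans _ _ (seq_norm e [seq if len p <= d k.+2 then incr (G k) p else 0 | p <- l])).
  by apply: (seq_norm_map_le he) => p; case: ifP => _; rewrite ?normrN.
rewrite (seq_norm_map_if he); apply: (path_incr_le he (radius_gt0 _) _ ps).
by move=> s' ps' ms; apply: small => //; apply: le_trans ms _; exact: radius_mono.
Qed.

(** On a cell longer than [d k] the k-th difference moves by at most 4 (d k)^2, hence by at most
    [4 * len p * d k]. Summing over k gives [8 * len p], and the lengths add up to 1. *)
Lemma incr_large s (sg : nat -> bool) K : partition01 s ->
  seq_norm e [seq \sum_(k < K) (if d k < len p then (-1) ^+ sg k * D k p else 0)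
        | p <- cells (@zero01 R) s] <= 8 * `|e 0%N|.
Proof.
move=> /partition01P [ps ls].
have ps' : path (@le01 R) (@zero01 R) s by apply: sub_path ps => x y; exact: ltW.
have /allP len0 := len_ge0 ps'.
apply: (@le_trans _ _ (seq_norm e [seq 8 * len p | p <- cells (@zero01 R) s])).
  apply: (seq_norm_map_le_in he) => p pl; have p0 := len0 _ pl.
  rewrite [leRHS]ger0_norm ?mulr_ge0//; apply: le_trans (ler_norm_sum _ _ _) _.
  apply: (@le_trans _ _ (\sum_(k < K) 4 * len p * d k)); last first.
    rewrite -mulr_sumr; have := radius_sum K; move: (\sum_(k < K) d k) => x hx.
    apply: le_trans (ler_wpM2l _ hx) _; first by rewrite mulr_ge0.
    by rewrite mulrAC -natrM.
  apply: ler_sum => k _; case: ifPn => [h|_]; last first.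
    by rewrite normr0 !mulr_ge0// ltW// radius_gt0.
  rewrite normrM normr_sign mul1r.
  have dk : d k ^+ 2 <= len p * d k.
    by rewrite expr2 ler_wpM2r// ltW// radius_gt0.
  have dk1 : d k.+1 ^+ 2 <= d k ^+ 2.
    by rewrite lerXn2r ?nnegrE ?(ltW (radius_gt0 _))//; exact: radius_mono.
  have -> : D k p = (G k.+1 p.2 - f p.2) - (G k.+1 p.1 - f p.1)
      - ((G k p.2 - f p.2) - (G k p.1 - f p.1)) by rewrite /incr; ring.
  have h1 := close k.+1 p.2; have h2 := close k.+1 p.1.
  have h3 := close k p.2; have h4 := close k p.1.
  move: h1 h2 h3 h4.
  move: (G k.+1 p.2 - f p.2) (G k.+1 p.1 - f p.1) (G k p.2 - f p.2) (G k p.1 - f p.1).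
  by move=> x1 x2 x3 x4 h1 h2 h3 h4; rewrite -mulrA; exact: (dist4 h1 h2 h3 h4 dk dk1).
rewrite (seq_norm_mapE _ (@zero01 R, @zero01 R)); apply: le_trans (comb_norm_l1 he _ _) _.
rewrite ler_wpM2r//.
have -> : \sum_(i < size (cells (@zero01 R) s)) `|8 * len (nth (zero01, zero01) (cells zero01 s) i)|
    = \sum_(p <- cells (@zero01 R) s) 8 * len p.
  rewrite (big_nth (@zero01 R, @zero01 R)) big_mkord; apply: eq_bigr => i _.
  by rewrite ger0_norm// mulr_ge0// len0// mem_nth.
by rewrite -mulr_sumr sum_len ls subr0 mulr1.
Qed.

(** The constant is 40 = 2 * 2 * 5 * 2: at most two indices k per cell, two functions in each
    difference, the tracking constant 5 and the factor 2 of [osc_points]. *)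
Lemma incr_middle s (sg : nat -> bool) K : path (@le01 R) (@zero01 R) s ->
  seq_norm e [seq \sum_(k < K) (if d k.+2 < len p <= d k then (-1) ^+ sg k * D k p else 0)
        | p <- cells (@zero01 R) s] <= 40 * fine (VX_norm e f).
Proof.
move=> ps; have [u [v [uv osc]]] := osc_points cf.
have M0 : 0 <= 40 :> R by [].
apply: (@le_trans _ _ (seq_norm e [seq 40 * (f (v p) - f (u p)) | p <- cells (@zero01 R) s])); last first.
  rewrite (seq_norm_mapE _ (@zero01 R, @zero01 R)) comb_normZ ger0_norm// ler_wpM2l//.
  by have := insert_incr_VX he fV uv ps; rewrite (seq_norm_mapE _ (@zero01 R, @zero01 R)).
apply: (seq_norm_map_le_in he) => p pl.
have pp := cells_le ps pl.
rewrite normrM ger0_norm//; set N : R := `|f (v p) - f (u p)|.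
have Dle k : `|D k p| <= 20 * N.
  have gle j : `|incr (G j) p| <= 10 * N.
    have [a [b [h1 h2 h3 h4]]] := track j pp.
    have h5 : `|f b - f a| <= 2 * N := osc p a b pp h1 h2 h3.
    by move: h4 h5; rewrite /incr; move: (`|_|) (`|f b - f a|) N; move=> *; lra.
  have -> : 20 * N = 10 * N + 10 * N by ring.
  by apply: le_trans (ler_normB _ _) _; exact: lerD (gle k.+1) (gle k).
(* The cell is in the middle range for k exactly when [h k.+2 - h k] is 1 and not 0, so the number
   of such k telescopes to at most 2. *)
pose h k : R := (d k < len p)%R%:R.
apply: (@le_trans _ _ (\sum_(k < K) (h k.+2 - h k) * (20 * N))).
  apply: le_trans (ler_norm_sum _ _ _) _; apply: ler_sum => k _.
  have d2 : d k.+2 <= d k by apply: le_trans (radius_mono _) (radius_mono _).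
  rewrite /h [d k < _]ltNge; case: (boolP (len p <= d k)) => h1; case: (boolP (d k.+2 < len p)) => h2 //=.
  - by rewrite subr0 mul1r normrM normr_sign mul1r.
  - by rewrite normr0 subrr mul0r.
  - by rewrite normr0 subrr mul0r.
  - by move: h1; rewrite -ltNge => /(le_lt_trans d2); rewrite (negbTE h2).
rewrite -mulr_suml telescope2.
have N0 : 0 <= 20 * N by apply: mulr_ge0 => //; exact: normr_ge0.
have h01 k : 0 <= h k <= 1 by rewrite /h; case: (_ < _); rewrite ?lexx ?ler01.
have le2 : h K.+1 + h K - h 1%N - h 0%N <= 2.
  have := h01 K.+1; have := h01 K; have := h01 1%N; have := h01 0%N.
  by move: (h K.+1) (h K) (h 1%N) (h 0%N); move=> *; lra.
apply: le_trans (ler_wpM2r N0 le2) _; rewrite mulrA -natrM//.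
Qed.

Lemma signed_sum_bound K (sg : nat -> bool) :
  `|\sum_(k < K) (-1) ^+ sg k *: (G k.+1 - G k)| <=
    4 + 40 * fine (VX_norm e f) + 8 * `|e 0%N|.
Proof.
apply: V_norm_le => s ps; have /partition01P [ps0 _] := ps.
have ps1 : path (@le01 R) (@zero01 R) s by apply: sub_path ps0 => x y; exact: ltW.
rewrite alphaE.
have -> : [seq incr (\sum_(k < K) (-1) ^+ sg k *: (G k.+1 - G k) : V) p | p <- cells (@zero01 R) s] =
  [seq (\sum_(k < K) (if len p <= d k.+2 then (-1) ^+ sg k * D k p else 0) +
        \sum_(k < K) (if d k.+2 < len p <= d k then (-1) ^+ sg k * D k p else 0)) +
        \sum_(k < K) (if d k < len p then (-1) ^+ sg k * D k p else 0) | p <- cells (@zero01 R) s].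
  apply: eq_map => p; rewrite -!big_split /= /incr !V_sum -sumrB; apply: eq_bigr => k _.
  have -> : ((-1) ^+ sg k *: (G k.+1 - G k)) p.2 - ((-1) ^+ sg k *: (G k.+1 - G k)) p.1 =
    (-1) ^+ sg k * D k p.
    have E t : ((-1) ^+ sg k *: (G k.+1 - G k)) t = (-1) ^+ sg k * (G k.+1 t - G k t) by [].
    by rewrite !E /incr; ring.
  have d2 : d k.+2 <= d k by apply: le_trans (radius_mono _) (radius_mono _).
  rewrite [d k < _]ltNge [d k.+2 < _]ltNge.
  case: (boolP (len p <= d k.+2)) => h1 /=; first by rewrite (le_trans h1 d2) /= !addr0.
  by case: ifP => _ /=; rewrite ?addr0 ?add0r.
apply: le_trans (seq_norm_mapD _ _ _ _) _; apply: lerD; last exact: incr_large.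
by apply: le_trans (seq_norm_mapD _ _ _ _) _; apply: lerD; [exact: incr_small|exact: incr_middle].
Qed.

(** The signs are those of [phi] on the differences; they vary with [phi], which is why the
    preceding bound is uniform in the signs. *)
Lemma dual_sum_bound (phi : dual V) K : \sum_(k < K) `|phi (G k.+1 - G k)| <=
  `|phi| * (4 + 40 * fine (VX_norm e f) + 8 * `|e 0%N|).
Proof.
pose sg k := phi (G k.+1 - G k) < 0.
apply: le_trans (ler_wpM2l (normr_ge0 phi) (signed_sum_bound K sg)).
apply: le_trans (dual_le _ _); apply: le_trans (ler_norm _).
rewrite dual_sum le_eqVlt; apply/orP; left; apply/eqP; apply: eq_bigr => k _.
by rewrite dualZ /sg; case: ltP => h; [rewrite ltr0_norm ?expr1 ?mulN1r|rewrite ger0_norm ?mul1r].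
Qed.

End Bound.
End Approximation.

(** * Continuous functions are semicontinuous differences *)

Lemma sup_lower_semicontinuous {R : realType} {T : topologicalType} (h : nat -> T -> R) (u : T -> R) :
  (forall n, continuous (h n)) -> (forall n x, h n x <= u x) ->
  (forall x, h n x @[n --> \oo] --> u x) -> lower_semicontinuous (EFin \o u).
Proof.
move=> ch hu hl x a /=; rewrite lte_fin => au.
have [n /= an] := filter_ex (cvgr_gt _ (hl x) _ au).
exists [set y | a < h n y]; first exact: (cvgr_gt _ (ch n x) _ an).
by move=> y /= ay; rewrite lte_fin; apply: lt_le_trans ay (hu n y).
Qed.

(** * Splitting an absolutely summable series of values into positive and negative parts *)

Section Difference.
Context {R : realType} {V : normedModType R}.
Variables (G : nat -> V) (C : R).
Implicit Types phi psi : dual V.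
Hypothesis C0 : 0 <= C.
Hypothesis GC : forall (phi : dual V) K, \sum_(k < K) `|phi (G k.+1 - G k)| <= `|phi| * C.

(** [s = 1] collects the positive parts of the values on the differences, [s = -1] the negative
    parts. *)
Definition pos_var (s : R) (phi : dual V) K : R :=
  \sum_(k < K) Num.max 0 (s * phi (G k.+1 - G k)).

Lemma pos_var_ge0 s phi K : 0 <= pos_var s phi K.
Proof. by apply: sumr_ge0 => k _; rewrite le_max lexx. Qed.

Lemma pos_var_mono s phi : nondecreasing_seq (pos_var s phi).
Proof.
apply/nondecreasing_seqP => K; rewrite /pos_var big_ord_recr /= lerDl.
by rewrite le_max lexx.
Qed.

Lemma pos_var_le s phi K : `|s| = 1 -> pos_var s phi K <= `|phi| * C.
Proof.
move=> s1; apply: le_trans (GC phi K); apply: ler_sum => k _.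
rewrite ge_max normr_ge0 /=; apply: le_trans (ler_norm _) _.
by rewrite normrM s1 mul1r.
Qed.

Lemma max0_sub (x : R) : Num.max 0 x - Num.max 0 (- x) = x.
Proof.
have [h|h] := leP 0 x; first by rewrite max_l ?oppr_le0// subr0.
by rewrite max_r ?oppr_ge0 ?sub0r ?opprK// ltW.
Qed.

Lemma pos_var_sub phi K : phi (G K) = phi (G 0%N) + pos_var 1 phi K - pos_var (-1) phi K.
Proof.
elim: K => [|K IH]; first by rewrite /pos_var !big_ord0 addr0 subr0.
rewrite /pos_var !big_ord_recr /= -!/(pos_var _ _ _) mul1r mulN1r.
have -> : phi (G K.+1) = phi (G K) + phi (G K.+1 - G K) by rewrite dualB addrC subrK.
rewrite IH -{1}(max0_sub (phi (G K.+1 - G K))).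
move: (Num.max 0 (phi _)) (Num.max 0 (- phi _)) => a b.
move: (pos_var 1 phi K) (pos_var (-1) phi K) => p n; ring.
Qed.

Definition tot_var s phi : R := sup (range (pos_var s phi)).

Lemma tot_var_cvg s phi : `|s| = 1 -> pos_var s phi K @[K --> \oo] --> tot_var s phi.
Proof.
move=> s1; apply: nondecreasing_cvgn; first exact: pos_var_mono.
by exists (`|phi| * C) => _ [K _ <-]; exact: pos_var_le.
Qed.

Lemma tot_var_le s phi : `|s| = 1 -> 0 <= tot_var s phi <= `|phi| * C.
Proof.
move=> s1; have c := @tot_var_cvg s phi s1; apply/andP; split.
  by apply: (cvgr_to_ge c); near=> K; exact: pos_var_ge0.
by apply: (cvgr_to_le c); near=> K; exact: pos_var_le.
Unshelve. all: by end_near. Qed.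

Lemma tot_var_ge s phi K : `|s| = 1 -> pos_var s phi K <= tot_var s phi.
Proof.
move=> s1; apply: ub_le_sup; last by exists K.
by exists (`|phi| * C) => _ [K' _ <-]; exact: pos_var_le.
Qed.

Lemma limit_bidual : exists L : dual (dual V),
  (forall phi, phi (G K) @[K --> \oo] --> L phi) /\
  forall phi, L phi = phi (G 0%N) + tot_var 1 phi - tot_var (-1) phi.
Proof.
have n1 : `|1 : R| = 1 by rewrite normr1.
have nN1 : `|-1 : R| = 1 by rewrite normrN1.
pose L phi := phi (G 0%N) + tot_var 1 phi - tot_var (-1) phi.
have cL phi : phi (G K) @[K --> \oo] --> L phi.
  have -> : (fun K => phi (G K)) =
      (fun K => phi (G 0%N) + pos_var 1 phi K - pos_var (-1) phi K).
    by apply/funext => K; exact: pos_var_sub.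
  apply: cvgB; last exact: tot_var_cvg.
  by apply: cvgD; [exact: cvg_cst|exact: tot_var_cvg].
have uniq_lim phi l : phi (G K) @[K --> \oo] --> l -> L phi = l.
  by move=> cl; apply: (cvg_unique _ (cL phi) cl).
have [||phi|L' L'E] := @dual_ex R (dual V) L (`|G 0%N| + C + C).
- move=> phi psi; apply: uniq_lim.
  have -> : (fun K => (phi + psi) (G K)) = (fun K => phi (G K) + psi (G K)) by [].
  exact: cvgD.
- move=> k phi; apply: uniq_lim.
  have -> : (fun K => (k *: phi) (G K)) = (fun K => k * phi (G K)) by [].
  by apply: cvgM => //; exact: cvg_cst.
- have /andP[p1 p2] := @tot_var_le 1 phi n1; have /andP[q1 q2] := @tot_var_le (-1) phi nN1.
  apply: le_trans (ler_normB _ _) _; rewrite (ger0_norm q1) [leRHS]mulrC mulrDr.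
  apply: lerD q2; apply: le_trans (ler_normD _ _) _; rewrite (ger0_norm p1) mulrDr.
  by apply: lerD p2; exact: dual_le.
by exists L'; split=> phi; rewrite L'E.
Qed.

Lemma pos_var_continuous s K : continuous (fun k : dual_ball V => pos_var s (\val k) K).
Proof.
move=> k0; elim: K => [|K IH].
  have E : (fun k : dual_ball V => pos_var s (\val k) 0%N) = (fun=> 0).
    by apply/funext => k; rewrite /pos_var big_ord0.
  by rewrite E; exact: cst_continuous.
have E (k : dual_ball V) : pos_var s (\val k) K.+1 =
    pos_var s (\val k) K + Num.max 0 (s * (\val k : dual V) (G K.+1 - G K)).
  by rewrite /pos_var big_ord_recr.
rewrite (funext E).
have c0 := @dual_ball_eval_continuous R V (G K.+1 - G K) k0.
have c1 : {for k0, continuous (fun k : dual_ball V => s * (\val k : dual V) (G K.+1 - G K) : R)}.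
  exact: (cvgM (cvg_cst s) c0).
have c2 := continuous_max (@cst_continuous (dual_ball V) R 0 k0) c1.
exact: (cvgD IH c2).
Qed.

Lemma diff_bounded_semicontinuous_limit (L : dual (dual V)) :
  (forall phi, phi (G K) @[K --> \oo] --> L phi) ->
  diff_bounded_semicontinuous (fun k : dual_ball V => L (\val k)).
Proof.
move=> cL; have [L' [cL' L'E]] := limit_bidual.
have LE phi : L phi = phi (G 0%N) + tot_var 1 phi - tot_var (-1) phi.
  by rewrite -L'E; exact: (cvg_unique _ (cL phi) (cL' phi)).
have n1 : `|1 : R| = 1 by rewrite normr1.
have nN1 : `|-1 : R| = 1 by rewrite normrN1.
have ball (k : dual_ball V) : `|(\val k : dual V)| <= 1 by exact: (set_valP k).
have tb s (k : dual_ball V) : `|s| = 1 -> `|tot_var s (\val k)| <= C.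
  move=> s1; have /andP[h1 h2] := @tot_var_le s (\val k) s1.
  by rewrite ger0_norm//; apply: le_trans h2 _; rewrite ler_piMl.
have bnd (w : dual_ball V -> R) M : (forall k, `|w k| <= M) -> bounded_fun w.
  move=> h; exists M; split; first exact: num_real.
  by move=> x Mx k _; apply: le_trans (h k) (ltW Mx).
exists (fun k => (\val k : dual V) (G 0%N) + tot_var 1 (\val k)), (fun k => tot_var (-1) (\val k)).
split.
- apply: (bnd _ (`|G 0%N| + C)) => k; apply: le_trans (ler_normD _ _) _; apply: lerD.
    by apply: le_trans (dual_le _ _) _; rewrite ler_piMl.
  exact: tb.
- by apply: (bnd _ C) => k; exact: tb.
- apply: (@sup_lower_semicontinuous _ _ (fun n (k : dual_ball V) => (\val k : dual V) (G 0%N) + pos_var 1 (\val k) n)).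
  + move=> n k.
    exact: (cvgD (@dual_ball_eval_continuous R V (G 0%N) k) (@pos_var_continuous 1 n k)).
  + by move=> n k; rewrite lerD2l; exact: tot_var_ge.
  + by move=> k; apply: cvgD; [exact: cvg_cst|exact: tot_var_cvg].
- apply: (@sup_lower_semicontinuous _ _ (fun n (k : dual_ball V) => pos_var (-1) (\val k) n)).
  + by move=> n; exact: pos_var_continuous.
  + by move=> n k; exact: tot_var_ge.
  + by move=> k; exact: tot_var_cvg.
- by apply/funext => k; rewrite LE.
Qed.

End Difference.

(** The G_k have a limit L in the bidual. They converge to f pointwise, so L and [VX_bidual he f]
    agree at all evaluations, and [bidual_unique] extends this to every functional. *)
Lemma diff_semicontinuous_of_continuous {R : realType} {X : normedModType R} {e : nat -> X}
    (he : symmetric_basis e) (hX : reflexive_space X) (f : I01 R -> R) :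
  VX e f -> continuous f ->
  diff_bounded_semicontinuous (fun k : dual_ball (VX0_space he) => VX_bidual he f (\val k)).
Proof.
move=> fV cf; have [G [d [d1 dd close track small]]] := approximation_sequence he hX cf fV.
have C0 : 0 <= 4 + 40 * fine (VX_norm e f) + 8 * `|e 0%N|.
  have [s ps] := @partition01_ex R.
  by rewrite !addr_ge0 ?mulr_ge0// (le_trans (alpha_ge0 e f s))// VX_alpha_le.
have GC := dual_sum_bound cf fV d1 dd close track small.
apply: (diff_bounded_semicontinuous_limit C0 GC) => phi.
have [L [cL _]] := limit_bidual GC.
suff -> : VX_bidual he f = L by exact: cL.
apply/eqP; rewrite -subr_eq0; apply/eqP; apply: (bidual_unique hX) => t.
have -> : (VX_bidual he f - L) (delta he t) = VX_bidual he f (delta he t) - L (delta he t) by [].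
rewrite VX_bidual_delta//; apply/eqP; rewrite subr_eq0; apply/eqP.
suff Gf : G K t @[K --> \oo] --> f t.
  by apply/esym; exact: (cvg_unique (@Rhausdorff R) (cL (delta he t)) Gf).
have dle k : d k <= (2^-1) ^+ k.
  elim: k => [|k IH]; first by rewrite d1 expr0.
  by apply: le_trans (dd k).2 _; rewrite exprSr ler_pM2r// invr_gt0.
have d0 : d k ^+ 2 @[k --> \oo] --> (0 : R).
  apply: (@squeeze_cvgr _ _ _ _ (fun=> 0) (fun k => (2^-1) ^+ k)).
  - near=> k; rewrite exprn_ge0 ?(ltW (dd k).1)//=.
    have dk1 : d k <= 1 by apply: le_trans (dle k) _; rewrite exprn_ile1// ?invr_ge0// invf_le1// ler1n.
    by apply: le_trans (dle k); rewrite expr2 ger_pMr// (dd k).1.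
  - exact: cvg_cst.
  - by apply: cvg_expr; rewrite ger0_norm ?invr_ge0// invf_lt1// ltr1n.
apply/cvgrPdist_le => eps eps0.
move/cvgrPdist_le: d0 => /(_ eps eps0); apply: filterS => k.
rewrite sub0r normrN ger0_norm ?exprn_ge0 ?(ltW (dd k).1)// => h.
by apply: le_trans h; rewrite distrC; exact: close.
Unshelve. all: by end_near. Qed.

Theorem propositionF (R : realType) (X : completeNormedModType R)
    (e : nat -> X) (he : symmetric_basis e) (hX : reflexive_space X)
    (f : I01 R -> R) (hf : (VX e `\` VX0 e) f) :
  continuous f <->
  diff_bounded_semicontinuous
    (fun k : dual_ball (VX0_space he) => VX_bidual he f (\val k)).
Proof.
split; first exact: (diff_semicontinuous_of_continuous he hX hf.1).
exact: (continuous_of_diff_semicontinuous hX hf.1).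
Qed.
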